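(* Let $(\mathcal M,g,A)$ be a Weyl geometry on a 4-dimensional real oriented manifold, with twistor bundle $\mathcal{PP}'$. 1) The natural totally null bundle $\mathcal N_{FEE'}$ of maximal dimension over $\mathcal{PP}'$ satisfies the integrability condition $[\Gamma(\mathcal N_{FEE'}),\Gamma(\mathcal N_{FEE'})]\subset\Gamma(\mathcal N_{FEE'})$ if and only if $(\mathcal M,g,A)$ is anti-self-dual and satisfies the Einstein-Weyl equations. 2) The natural totally null bundle $\mathcal N_{F'EE'}$ of maximal dimension over $\mathcal{PP}'$ satisfies the integrability condition $[\Gamma(\mathcal N_{F'EE'}),\Gamma(\mathcal N_{F'EE'})]\subset\Gamma(\mathcal N_{F'EE'})$ if and only if $(\mathcal M,g,A)$ is self-dual and satisfies the Einstein-Weyl equations.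
   Context: Weyl geometry. A metric on $\mathcal M$ is a nondegenerate symmetric bilinear complex-valued form. A Weyl geometry $(g,A)$ consists of a metric $g$ and a complex-valued 1-form $A$. In a coframe $(\theta^i)$ of complex-valued 1-forms, $g=g_{ij}\theta^i\theta^j$, the Weyl connection 1-forms $\Gamma^i_{\ j}$ are uniquely determined by $dg_{ij}-g_{ik}\Gamma^k_{\ j}-g_{jk}\Gamma^k_{\ i}=-A\,g_{ij}$ and $d\theta^i=-\Gamma^i_{\ j}\wedge\theta^j$. Curvature: $\frac12R_{ijkl}\theta^k\wedge\theta^l=g_{ih}(d\Gamma^h_{\ j}+\Gamma^h_{\ k}\wedge\Gamma^k_{\ j})$, $R_{jl}=g^{ik}R_{ijkl}$, $R=g^{ij}R_{ij}$, $S_{ij}=R_{(ij)}-\frac14Rg_{ij}$. The Einstein-Weyl equations are $S_{ij}=0$. Let $w_{ijkl}$ be the Weyl tensor of the Levi-Civita connection of $g$ and $w_{ij}=\frac12w_{ijkl}\theta^k\wedge\theta^l$. A null cotetrad is a coframe $(\theta^1,\dots,\theta^4)=(M,P,N,K)$ with $g=MP-NK$, where $\alpha\beta=\frac12(\alpha\otimes\beta+\beta\otimes\alpha)$, and compatible with the orientation in the sense that the volume form is $\eta=M\wedge P\wedge N\wedge K$. The dual frame is $(m,p,n,k)$. Self-dual 2-forms are spanned by $P\wedge K,\ N\wedge K-M\wedge P,\ N\wedge M$; anti-self-dual ones by $M\wedge K,\ N\wedge K+M\wedge P,\ N\wedge P$. $(g,A)$ is anti-self-dual (self-dual) if all 2-forms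 $w_{ij}$ are anti-self-dual (self-dual) on $\mathcal M$. Twistor bundle. Totally null 2-planes of $T_x\mathcal M^{\mathbb C}$ form two disjoint 2-spheres: self-dual ones $s=\mathrm{Span}\{zm-k,zn-p\}$ and anti-self-dual ones $s'=\mathrm{Span}\{z'p-k,z'n-m\}$, with $z,z'\in\mathbb C\cup\{\infty\}$. $\mathcal P$ (resp. $\mathcal P'$) is the $S^2$-bundle over $\mathcal M$ of all self-dual (resp. anti-self-dual) such planes, and $\mathcal{PP}'$ is their fibre product (real dimension 8), with projection $\Pi$ to $\mathcal M$ and local coordinates $(x,z,\bar z,z',\bar z')$. On $\mathcal{PP}'$ (pullbacks not written) $$E=dz-\Gamma^3_{\ 2}+z(\Gamma^1_{\ 1}-\Gamma^4_{\ 4})+z^2\Gamma^2_{\ 3},\quad E'=dz'-\Gamma^3_{\ 1}+z'(\Gamma^2_{\ 2}-\Gamma^4_{\ 4})+z'^2\Gamma^1_{\ 3},$$ $$\Lambda=-N-zz'K-zP-z'M,\quad F=M+zK,\quad F'=P+z'K.$$ Intrinsically $E,E',\Lambda$ are defined up to multiplication by nonvanishing functions, $F$ up to $F\to\alpha F+\beta\Lambda$ and $F'$ up to $F'\to\alpha^{-1}F'+\gamma\Lambda$, $\alpha\neq0$. Standing assumption: $\mathcal M$ is such that $E,E'$ can be chosen globally (e.g. an open subset of $\mathbb R^4$). $\mathcal N_{FEE'}$ (resp. $\mathcal N_{F'EE'}$) is the subbundle of $T(\mathcal{PP}')^{\mathbb C}$, of complex rank 4, annihilated by $\Lambda,F,E,E'$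 (resp. by $\Lambda,F',E,E'$). It is totally null for every metric $\tilde{\tilde g}=\Pi^*g+h\bar hE\bar E+h'\bar h'E'\bar E'$ with $h,h'$ nonvanishing complex functions. $\Gamma(\cdot)$ denotes sections and $[\cdot,\cdot]$ the commutator of complex vector fields. *)

(* Defs.v *)
From mathcomp Require Import all_boot all_order all_algebra.
From mathcomp Require Import all_classical all_reals all_analysis.
From mathcomp Require Export complex.

Set Implicit Arguments.
Unset Strict Implicit.
Unset Printing Implicit Defensive.

Import Order.TTheory GRing.Theory Num.Theory.
Import numFieldNormedType.Exports.

Local Open Scope classical_set_scope.
Local Open Scope ring_scope.
Local Open Scope complex_scope.

Section calculus.
Variables (R : realType) (n : nat).
Implicit Types (U : set 'rV[R]_n) (a : 'I_n).

Definition partial a (f : 'rV[R]_n -> R) (x : 'rV[R]_n) : R :=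
  'D_(delta_mx 0 a) f x.

Fixpoint Ck (k : nat) U (f : 'rV[R]_n -> R) : Prop :=
  if k is k'.+1 then
    (forall x a, U x -> derivable f x (delta_mx 0 a)) /\
    (forall a, Ck k' U (partial a f))
  else forall x, U x -> {for x, continuous f}.

(* Only used with [U] open. *)
Definition smooth U (f : 'rV[R]_n -> R) : Prop := forall k, Ck k U f.

Definition csmooth U (f : 'rV[R]_n -> R[i]) : Prop :=
  smooth U (fun x => complex.Re (f x)) /\ smooth U (fun x => complex.Im (f x)).

Definition csmooth_mx p q U (F : 'rV[R]_n -> 'M[R[i]]_(p, q)) : Prop :=
  forall i j, csmooth U (fun x => F x i j).

Definition cpartial a (f : 'rV[R]_n -> R[i]) (x : 'rV[R]_n) : R[i] :=
  partial a (fun y => complex.Re (f y)) x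
    +i* partial a (fun y => complex.Im (f y)) x.

(* A complex 1-form is the row of its components on the dx^a; a complex
   2-form B is the alternating matrix of the values B(d/dx^a, d/dx^b), i.e.
   B = 1/2 B_ab dx^a /\ dx^b. *)
Definition diff0 (f : 'rV[R]_n -> R[i]) (x : 'rV[R]_n) : 'rV[R[i]]_n :=
  \row_a cpartial a f x.

Definition diff1 (al : 'rV[R]_n -> 'rV[R[i]]_n) (x : 'rV[R]_n) : 'M[R[i]]_n :=
  \matrix_(a, b) (cpartial a (fun y => al y 0 b) x
                  - cpartial b (fun y => al y 0 a) x).

Definition wedge (al be : 'rV[R[i]]_n) : 'M[R[i]]_n :=
  al^T *m be - be^T *m al.

Definition symprod (al be : 'rV[R[i]]_n) : 'M[R[i]]_n :=
  2^-1 *: (al^T *m be + be^T *m al).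

Definition pairing (al X : 'rV[R[i]]_n) : R[i] := \sum_a al 0 a * X 0 a.

Definition bracket (X Y : 'rV[R]_n -> 'rV[R[i]]_n) (x : 'rV[R]_n) :
    'rV[R[i]]_n :=
  \row_b \sum_a (X x 0 a * cpartial a (fun y => Y y 0 b) x
                 - Y x 0 a * cpartial a (fun y => X y 0 b) x).

End calculus.

Record oriented_manifold (R : realType) (n : nat) := OrientedManifold {
  point :> topologicalType;
  chart : Type;
  dom : chart -> set point;
  img : chart -> set 'rV[R]_n;
  coord : chart -> point -> 'rV[R]_n;
  param : chart -> 'rV[R]_n -> point;
  manifold_hausdorff : hausdorff_space point;
  manifold_second_countable : @second_countable point;
  dom_open : forall c, open (dom c);
  img_open : forall c, open (img c);
  dom_cover : forall x, exists c, dom c x;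
  coord_img : forall c x, dom c x -> img c (coord c x);
  param_dom : forall c y, img c y -> dom c (param c y);
  coordK : forall c x, dom c x -> param c (coord c x) = x;
  paramK : forall c y, img c y -> coord c (param c y) = y;
  coord_continuous : forall c x, dom c x -> {for x, continuous (coord c)};
  param_continuous : forall c y, img c y -> {for y, continuous (param c)};
  transition_smooth : forall c d j,
    smooth [set y | img c y /\ dom d (param c y)]
           (fun y => coord d (param c y) 0 j);
  transition_oriented : forall c d y, img c y -> dom d (param c y) ->
    0 < \det (jacobian (fun y' => coord d (param c y')) y)
}.

Definition transition (R : realType) n (M : oriented_manifold R n)
  (c d : chart M) (y : 'rV[R]_n) : 'rV[R]_n := coord d (param c y).

(* [jacobian] acts on row vectors from the right: its (a, b) entry is
   d y_d^b / d y_c^a. *)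
Definition cjacobian (R : realType) n (M : oriented_manifold R n)
  (c d : chart M) (y : 'rV[R]_n) : 'M[R[i]]_n :=
  map_mx (fun r : R => r%:C) (jacobian (transition c d) y).

(* Tensor fields are given by their components in every chart. *)
Record weyl_geometry (R : realType) (M : oriented_manifold R 4) :=
  WeylGeometry {
  metric : chart M -> 'rV[R]_4 -> 'M[R[i]]_4;
  weyl_form : chart M -> 'rV[R]_4 -> 'rV[R[i]]_4;
  metric_smooth : forall c, csmooth_mx (img c) (metric c);
  metric_transform : forall c d y, img c y -> dom d (param c y) ->
    metric c y = cjacobian c d y *m metric d (transition c d y)
                   *m (cjacobian c d y)^T;
  metric_sym : forall c y, img c y -> (metric c y)^T = metric c y;
  metric_nondegenerate : forall c y, img c y -> metric c y \in unitmx;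
  weyl_form_smooth : forall c, csmooth_mx (img c) (weyl_form c);
  weyl_form_transform : forall c d y, img c y -> dom d (param c y) ->
    weyl_form c y = weyl_form d (transition c d y) *m (cjacobian c d y)^T
}.

(* The volume form eta = volume dx^1/\dx^2/\dx^3/\dx^4.  If g = MP - NK, the
   matrix of g in the coframe (M, P, N, K) has determinant 1/16, so that
   eta = +- M/\P/\N/\K means volume^2 = 16 det g.  For a complex metric, the
   choice of the square root is the part of the orientation that selects
   the self-dual 2-forms. *)
Record volume_form (R : realType) (M : oriented_manifold R 4)
    (W : weyl_geometry M) := VolumeForm {
  volume : chart M -> 'rV[R]_4 -> R[i];
  volume_smooth : forall c, csmooth (img c) (volume c);
  volume_transform : forall c d y, img c y -> dom d (param c y) ->
    volume c y = \det (cjacobian c d y) * volume d (transition c d y);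
  volume_normalized : forall c y, img c y ->
    volume c y ^+ 2 = 16 * \det (metric W c y)
}.

Notation i1 := (@Ordinal 4 0 isT) (only parsing).
Notation i2 := (@Ordinal 4 1 isT) (only parsing).
Notation i3 := (@Ordinal 4 2 isT) (only parsing).
Notation i4 := (@Ordinal 4 3 isT) (only parsing).

Section coframes.
Variable R : realType.
Local Notation C := R[i].
(* th x is the matrix whose i-th row is th^i at x. *)
Implicit Types (U : set 'rV[R]_4) (th : 'rV[R]_4 -> 'M[C]_4).
Implicit Types (G : 'rV[R]_4 -> 'M[C]_4) (A : 'rV[R]_4 -> 'rV[C]_4).
Implicit Types (Ga : 'I_4 -> 'I_4 -> 'rV[R]_4 -> 'rV[C]_4) (x : 'rV[R]_4).

(* The matrix (B_ij) such that B = B_ij th^i (x) th^j; for a 2-form this is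
   B = 1/2 B_ij th^i /\ th^j. *)
Definition frame_components (t B : 'M[C]_4) : 'M[C]_4 :=
  (invmx t)^T *m B *m invmx t.

Definition gframe th G x : 'M[C]_4 := frame_components (th x) (G x).

(* Ga i j is the 1-form Gamma^i_j. *)
Definition weyl_connection U th G A Ga : Prop :=
  [/\ forall i j, csmooth_mx U (Ga i j),
      forall x i j, U x ->
        diff0 (fun y => gframe th G y i j) x
          - \sum_k (gframe th G x i k *: Ga k j x
                    + gframe th G x j k *: Ga k i x)
        = - (gframe th G x i j *: A x)
    & forall x i, U x ->
        diff1 (fun y => row i (th y)) x
        = - \sum_j wedge (Ga i j x) (row j (th x))].

Definition levi_civita U th G Ga : Prop :=
  weyl_connection U th G (fun=> 0) Ga.

Definition curvature_form Ga (i j : 'I_4) x : 'M[C]_4 :=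
  diff1 (Ga i j) x + \sum_k wedge (Ga i k x) (Ga k j x).

Definition riemann th G Ga x (i j k l : 'I_4) : C :=
  \sum_h gframe th G x i h
         * frame_components (th x) (curvature_form Ga h j x) k l.

Definition ricci th G Ga x (j l : 'I_4) : C :=
  \sum_i \sum_k invmx (gframe th G x) i k * riemann th G Ga x i j k l.

Definition scalar_curvature th G Ga x : C :=
  \sum_i \sum_j invmx (gframe th G x) i j * ricci th G Ga x i j.

Definition tracefree_ricci th G Ga x (i j : 'I_4) : C :=
  (ricci th G Ga x i j + ricci th G Ga x j i) / 2
  - 4^-1 * scalar_curvature th G Ga x * gframe th G x i j.

(* The Weyl tensor in dimension 4; Ga is meant to be Levi-Civita. *)
Definition weyl_tensor th G Ga x (i j k l : 'I_4) : C :=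
  let g := gframe th G x in
  let r := ricci th G Ga x in
  riemann th G Ga x i j k l
  - 2^-1 * (g i k * r j l - g i l * r j k - g j k * r i l + g j l * r i k)
  + scalar_curvature th G Ga x / 6 * (g i k * g j l - g i l * g j k).

Definition weyl_2form th G Ga x (i j : 'I_4) : 'M[C]_4 :=
  2^-1 *: \sum_k \sum_l weyl_tensor th G Ga x i j k l
                        *: wedge (row k (th x)) (row l (th x)).

Definition self_dual_2form (t B : 'M[C]_4) : Prop :=
  let M := row i1 t in let P := row i2 t in
  let N := row i3 t in let K := row i4 t in
  exists a b c, B = a *: wedge P K + b *: (wedge N K - wedge M P)
                    + c *: wedge N M.

Definition anti_self_dual_2form (t B : 'M[C]_4) : Prop :=
  let M := row i1 t in let P := row i2 t in
  let N := row i3 t in let K := row i4 t in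
  exists a b c, B = a *: wedge M K + b *: (wedge N K + wedge M P)
                    + c *: wedge N P.

End coframes.

Section weyl_geometry_conditions.
Variables (R : realType) (M : oriented_manifold R 4) (W : weyl_geometry M).
Variable vol : volume_form W.
Implicit Types (c : chart M) (U : set 'rV[R]_4) (th : 'rV[R]_4 -> 'M[R[i]]_4).

Definition coframe c U th : Prop :=
  [/\ open U, U `<=` img c, csmooth_mx U th
    & forall y, U y -> th y \in unitmx].

Definition null_cotetrad_at c (y : 'rV[R]_4) (t : 'M[R[i]]_4) : Prop :=
  metric W c y = symprod (row i1 t) (row i2 t) - symprod (row i3 t) (row i4 t)
  /\ volume vol c y = \det t.

Definition null_cotetrad c U th : Prop :=
  coframe c U th /\ forall y, U y -> null_cotetrad_at c y (th y).

Definition einstein_weyl : Prop :=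
  forall c U th Ga, coframe c U th ->
    weyl_connection U th (metric W c) (weyl_form W c) Ga ->
    forall y i j, U y -> tracefree_ricci th (metric W c) Ga y i j = 0.

Definition anti_self_dual : Prop :=
  forall c U th Ga, null_cotetrad c U th ->
    levi_civita U th (metric W c) Ga ->
    forall y i j, U y ->
      anti_self_dual_2form (th y) (weyl_2form th (metric W c) Ga y i j).

Definition self_dual : Prop :=
  forall c U th Ga, null_cotetrad c U th ->
    levi_civita U th (metric W c) Ga ->
    forall y i j, U y ->
      self_dual_2form (th y) (weyl_2form th (metric W c) Ga y i j).

End weyl_geometry_conditions.

Section twistor_bundle.
Variables (R : realType) (M : oriented_manifold R 4) (W : weyl_geometry M).
Variable vol : volume_form W.
Local Notation C := R[i].

(* A complex tangent vector at x, given by its components in the charts. *)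
Definition ctangent (x : M) : set (chart M -> 'rV[C]_4) :=
  [set v | (forall c d, dom c x -> dom d x ->
              v d = v c *m cjacobian c d (coord c x)) /\
           (forall c, ~ dom c x -> v c = 0)].

Definition span_at (x : M) (c : chart M) (u v : 'rV[C]_4) :
    set (chart M -> 'rV[C]_4) :=
  [set w | ctangent x w /\ exists a b, w c = a *: u + b *: v].

Definition dual_vector (t : 'M[C]_4) (i : 'I_4) : 'rV[C]_4 :=
  (col i (invmx t))^T.

(* [None] stands for the value oo of z or z'. *)
Definition sd_plane (x : M) c (t : 'M[C]_4) (z : option C) :=
  let m := dual_vector t i1 in let p := dual_vector t i2 in
  let n := dual_vector t i3 in let k := dual_vector t i4 in
  if z is Some z then span_at x c (z *: m - k) (z *: n - p)
  else span_at x c m n.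

Definition asd_plane (x : M) c (t : 'M[C]_4) (z : option C) :=
  let m := dual_vector t i1 in let p := dual_vector t i2 in
  let n := dual_vector t i3 in let k := dual_vector t i4 in
  if z is Some z then span_at x c (z *: p - k) (z *: n - m)
  else span_at x c p n.

(* PP': pairs of a self-dual and an anti-self-dual totally null plane at the
   same point of M. *)
Record twistor_space := TwistorSpace {
  tpoint : M;
  tplane : set (chart M -> 'rV[C]_4);
  tplane' : set (chart M -> 'rV[C]_4);
  tplane_sd : exists c t z, [/\ dom c tpoint,
    null_cotetrad_at vol c (coord c tpoint) t & tplane = sd_plane tpoint c t z];
  tplane'_asd : exists c t z, [/\ dom c tpoint,
    null_cotetrad_at vol c (coord c tpoint) t & tplane' = asd_plane tpoint c t z]
}.

Definition base (y : 'rV[R]_(4 + 4)) : 'rV[R]_4 := lsubmx y.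
Definition zcoord (y : 'rV[R]_(4 + 4)) : C :=
  rsubmx y 0 i1 +i* rsubmx y 0 i2.
Definition zcoord' (y : 'rV[R]_(4 + 4)) : C :=
  rsubmx y 0 i3 +i* rsubmx y 0 i4.

(* y = (x, Re z, Im z, Re z', Im z') are the coordinates of q attached to the
   chart c and to the null cotetrad th on an open subset of its image.  The
   domains of these coordinates cover PP', the planes z = oo, z' = oo
   included: replacing (M, P, N, K) by the null cotetrad (K, -N, -P, M) of the
   same orientation changes (z, z') into (1/z, -z'), and replacing it by
   (-N, K, -M, P) changes (z, z') into (-z, 1/z'). *)
Definition twistor_coordinates c (th : 'rV[R]_4 -> 'M[C]_4)
    (q : twistor_space) (y : 'rV[R]_(4 + 4)) : Prop :=
  [/\ tpoint q = param c (base y),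
      tplane q = sd_plane (tpoint q) c (th (base y)) (Some (zcoord y))
    & tplane' q = asd_plane (tpoint q) c (th (base y)) (Some (zcoord' y))].

End twistor_bundle.

Section twistor_forms.
Variable R : realType.
Local Notation C := R[i].
Implicit Types (y : 'rV[R]_(4 + 4)) (al : 'rV[R]_4 -> 'rV[C]_4).

Definition pullback al y : 'rV[C]_(4 + 4) := row_mx (al (base y)) 0.
Definition dz : 'rV[C]_(4 + 4) :=
  row_mx 0 (delta_mx 0 i1 + (0 +i* 1) *: delta_mx 0 i2).
Definition dz' : 'rV[C]_(4 + 4) :=
  row_mx 0 (delta_mx 0 i3 + (0 +i* 1) *: delta_mx 0 i4).

Variables (th : 'rV[R]_4 -> 'M[C]_4)
          (Ga : 'I_4 -> 'I_4 -> 'rV[R]_4 -> 'rV[C]_4).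

Let M := pullback (fun x => row i1 (th x)).
Let P := pullback (fun x => row i2 (th x)).
Let N := pullback (fun x => row i3 (th x)).
Let K := pullback (fun x => row i4 (th x)).
Let Gp (i j : 'I_4) := pullback (Ga i j).

Definition formE y : 'rV[C]_(4 + 4) :=
  dz - Gp i3 i2 y + zcoord y *: (Gp i1 i1 y - Gp i4 i4 y)
  + zcoord y ^+ 2 *: Gp i2 i3 y.

Definition formE' y : 'rV[C]_(4 + 4) :=
  dz' - Gp i3 i1 y + zcoord' y *: (Gp i2 i2 y - Gp i4 i4 y)
  + zcoord' y ^+ 2 *: Gp i1 i3 y.

Definition formLambda y : 'rV[C]_(4 + 4) :=
  - N y - (zcoord y * zcoord' y) *: K y - zcoord y *: P y - zcoord' y *: M y.

Definition formF y : 'rV[C]_(4 + 4) := M y + zcoord y *: K y.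
Definition formF' y : 'rV[C]_(4 + 4) := P y + zcoord' y *: K y.

Definition bundleNF y : set 'rV[C]_(4 + 4) :=
  [set X | [/\ pairing (formLambda y) X = 0, pairing (formF y) X = 0,
               pairing (formE y) X = 0 & pairing (formE' y) X = 0]].

Definition bundleNF' y : set 'rV[C]_(4 + 4) :=
  [set X | [/\ pairing (formLambda y) X = 0, pairing (formF' y) X = 0,
               pairing (formE y) X = 0 & pairing (formE' y) X = 0]].

End twistor_forms.

Definition smooth_section (R : realType) n (V : set 'rV[R]_n)
    (D : 'rV[R]_n -> set 'rV[R[i]]_n) (X : 'rV[R]_n -> 'rV[R[i]]_n) : Prop :=
  csmooth_mx V X /\ forall y, V y -> D y (X y).

(* [Gamma(N), Gamma(N)] is contained in Gamma(N), where N is the subbundle of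
   the complexified tangent bundle of PP' which in the coordinates attached to
   a null cotetrad th with Weyl connection forms Ga is D th Ga, and Gamma
   stands for smooth sections over open subsets of coordinate domains. *)
Definition twistor_integrable (R : realType) (M : oriented_manifold R 4)
    (W : weyl_geometry M) (vol : volume_form W)
    (D : ('rV[R]_4 -> 'M[R[i]]_4) ->
         ('I_4 -> 'I_4 -> 'rV[R]_4 -> 'rV[R[i]]_4) ->
         'rV[R]_(4 + 4) -> set 'rV[R[i]]_(4 + 4)) : Prop :=
  forall (c : chart M) U th Ga, null_cotetrad vol c U th ->
    weyl_connection U th (metric W c) (weyl_form W c) Ga ->
    forall V : set 'rV[R]_(4 + 4), open V -> V `<=` [set y | U (base y)] ->
    forall X Y, smooth_section V (D th Ga) X -> smooth_section V (D th Ga) Y ->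
    forall (q : twistor_space vol) y, V y -> twistor_coordinates c th q y ->
      D th Ga y (bracket X Y y).

(* Main.v *)
Require Import Defs.
From mathcomp Require Import all_boot all_order all_algebra.
From mathcomp Require Import all_classical all_reals all_analysis.
From mathcomp Require Import perm.
From mathcomp Require Import ring.

(* In the coordinates attached to a null cotetrad, the bundle is annihilated by
   F = M + z K, H = N + z P, E and E', since Lambda = - H - z' F.  Given E = 0,
   the structure equations make dF and dH vanish on the bundle, so that by
   Cartan's formula integrability means that dE and dE' vanish on it.  Evaluated
   on the self-dual plane of parameter z, dE is a quartic polynomial in z and dE'
   a polynomial in z and z', whose coefficients are curvature components.  By the
   first Bianchi identity, the vanishing of the second is the tracefree part of
   the symmetrized Ricci tensor being zero.  For the Levi-Civita connection, the
   vanishing of the quartic is anti-self-duality of the Weyl tensor; a change of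
   the 1-form A of the Weyl geometry adds a combination of F and H to E, which
   leaves dE unchanged on the plane, so the quartic only depends on g.  The
   second statement is the first one with M and P exchanged.  The Einstein-Weyl
   equations in an arbitrary coframe follow by a change of coframe, null
   cotetrads being obtained locally by diagonalizing g. *)

Set Implicit Arguments.
Unset Strict Implicit.
Unset Printing Implicit Defensive.

Import Order.TTheory GRing.Theory Num.Theory.
Import numFieldNormedType.Exports.

Local Open Scope classical_set_scope.
Local Open Scope ring_scope.
Local Open Scope complex_scope.

(** * Smooth functions *)

Section smooth_functions.
Variables (R : realType) (n : nat).
Implicit Types (U : set 'rV[R]_n) (f g : 'rV[R]_n -> R) (x : 'rV[R]_n).

Local Notation e_ a := (delta_mx 0 a : 'rV[R]_n).

(** The bundle projects onto the self-dual plane of parameter z; the kernel is spanned by d/dzbar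
    and d/dz'bar, which dE and dE' do not see once E = E' = 0. On a plane a 2-form is a single
    number, its value on [z m - k], [z n - p]. Hence the bracket of two lifts of these vectors
    decides integrability, and dE, dE' contribute one scalar function each. All finite z, z' occur
    over every base point, so the coefficients of these polynomials must vanish.

    The two curvature conditions use different connections: E and E' come from the Weyl connection,
    duality from the Levi-Civita one. An explicit formula for the difference produces either from
    the other in the same null cotetrad, so that a hypothesis about one applies in a problem about
    the other. Likewise the Einstein-Weyl equations range over all coframes, while integrability
    speaks of null cotetrads; since a tensor vanishes or not at each point separately, a null
    cotetrad near that point is enough. *)

Lemma Ck_ext k U f g : open U -> (forall x, U x -> f x = g x) ->
  Ck k U f -> Ck k U g.
Proof.
move=> oU; have nU (h h' : 'rV[R]_n -> R) x : U x -> (forall y, U y -> h y = h' y) ->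
    \forall y \near x, h y = h' y.
  move=> Ux H; have xU : nbhs x U by exact: open_nbhs_nbhs.
  exact: (filterS H xU).
elim: k f g => [|k IH] f g fg /=.
  move=> fC x Ux; rewrite /= /prop_for /continuous_at -(fg x Ux).
  apply: cvg_trans (fC x Ux).
  by apply: (@near_eq_cvg _ _ (nbhs x)); apply: nU.
case=> fD fC; split=> [x a Ux|a].
  apply: near_eq_derivable (fD x a Ux); exact: nU.
apply: IH (fC a) => x Ux; apply: near_eq_derive; exact: nU.
Qed.

Lemma smooth_ext U f g : open U -> (forall x, U x -> f x = g x) ->
  smooth U f -> smooth U g.
Proof. by move=> oU fg sf k; apply: Ck_ext (sf k). Qed.

Lemma partial_ext U f g a x : open U -> U x -> (forall y, U y -> f y = g y) ->
  partial a f x = partial a g x.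
Proof.
move=> oU Ux fg; apply: near_eq_derive.
have xU : nbhs x U by exact: open_nbhs_nbhs.
exact: (filterS fg xU).
Qed.

Lemma Ck_sub k U V f : V `<=` U -> Ck k U f -> Ck k V f.
Proof.
move=> VU; elim: k f => [|k IH] f /=; first by move=> fC x /VU; exact: fC.
by case=> fD fC; split=> [x a /VU|a]; [exact: fD|exact: IH].
Qed.

Lemma smooth_sub U V f : V `<=` U -> smooth U f -> smooth V f.
Proof. by move=> VU sf k; apply: Ck_sub (sf k). Qed.

Lemma smooth_continuous U f x : smooth U f -> U x -> {for x, continuous f}.
Proof. by move=> /(_ 0%N); exact. Qed.

Lemma smooth_derivable U f a x : smooth U f -> U x -> derivable f x (e_ a).
Proof. by move=> /(_ 1%N) [+ _]; exact. Qed.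

Lemma smooth_is_derive U f a x : smooth U f -> U x ->
  is_derive x (e_ a) f (partial a f x).
Proof. by move=> sf Ux; apply: derivableP; exact: smooth_derivable Ux. Qed.

Lemma smooth_partial U f a : smooth U f -> smooth U (partial a f).
Proof. by move=> sf k; have [_] := sf k.+1; apply. Qed.

(* Closing the smooth functions under the operations below gives a class which
   is stable under partial derivatives, hence consists of smooth functions. *)
Inductive smooth_closure U : ('rV[R]_n -> R) -> Prop :=
| Smooth_base f : smooth U f -> smooth_closure U f
| Smooth_cst c : smooth_closure U (cst c)
| Smooth_add f g : smooth_closure U f -> smooth_closure U g ->
    smooth_closure U (f + g)
| Smooth_mul f g : smooth_closure U f -> smooth_closure U g ->
    smooth_closure U (f * g)
| Smooth_inv f : smooth_closure U f -> (forall x, U x -> f x != 0) ->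
    smooth_closure U (fun x => (f x)^-1)
| Smooth_sqrt f : smooth_closure U f -> (forall x, U x -> 0 < f x) ->
    smooth_closure U (fun x => Num.sqrt (f x)).

Lemma smooth_closure_derive U f : smooth_closure U f ->
  (forall x, U x -> {for x, continuous f}) /\
  forall a, exists2 g, smooth_closure U g
                     & forall x, U x -> is_derive x (e_ a) f (g x).
Proof.
elim=> {f} [f sf|c|f g sf [fC fD] sg [gC gD]|f g sf [fC fD] sg [gC gD]
           |f sf [fC fD] f0|f sf [fC fD] f0].
- split=> [x Ux|a]; first exact: smooth_continuous Ux.
  exists (partial a f) => [|x Ux]; first exact/Smooth_base/smooth_partial.
  exact: smooth_is_derive Ux.
- split=> [x _|a]; first exact: cst_continuous.
  by exists (cst 0) => [|x _]; [exact: Smooth_cst|exact: is_derive_cst].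
- split=> [x Ux|a]; first exact: continuousD (fC x Ux) (gC x Ux).
  have [[f' sf' fD'] [g' sg' gD']] := (fD a, gD a).
  exists (f' + g') => [|x Ux]; first exact: Smooth_add.
  exact: is_deriveD (fD' x Ux) (gD' x Ux).
- split=> [x Ux|a]; first exact: continuousM (fC x Ux) (gC x Ux).
  have [[f' sf' fD'] [g' sg' gD']] := (fD a, gD a).
  exists (f * g' + g * f') => [|x Ux]; first by apply: Smooth_add; exact: Smooth_mul.
  exact: is_deriveM (fD' x Ux) (gD' x Ux).
- split=> [x Ux|a]; first exact: continuousV (f0 x Ux) (fC x Ux).
  have [f' sf' fD'] := fD a.
  exists (cst (-1) * ((fun x => (f x)^-1) * (fun x => (f x)^-1) * f')).
    apply: Smooth_mul; first exact: Smooth_cst.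
    by apply: Smooth_mul => //; apply: Smooth_mul; apply: Smooth_inv.
  move=> x Ux; have [fd fE] := fD' x Ux.
  apply: DeriveDef; first by apply: derivableV => //; exact: f0.
  rewrite deriveV ?f0// fE !mulrfctE /= mulN1r scaleNr expr2 invfM.
  by [].
- have sqrtC x : U x -> {for x, continuous (fun y => Num.sqrt (f y))}.
    by move=> Ux; apply: continuous_comp; [exact: fC|exact: sqrt_continuous].
  split=> // a; have [f' sf' fD'] := fD a.
  exists (cst (2^-1) * (fun x => (Num.sqrt (f x))^-1) * f').
    apply: Smooth_mul => //; apply: Smooth_mul; first exact: Smooth_cst.
    apply: Smooth_inv => [|x Ux]; first exact: Smooth_sqrt.
    by rewrite gt_eqF// sqrtr_gt0 f0.
  move=> x Ux; have [fd fE] := fD' x Ux.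
  (* The partial derivative is an ordinary derivative at 0 along the line [h *: e_ a + x], where the
     chain rule in one variable applies. *)
  move/derivable1P : (fd) => /derivable1_diffP dF.
  have h0 : f (0 *: e_ a + x) = f x by rewrite scale0r add0r.
  have dS : differentiable (@Num.sqrt R) (f (0 *: e_ a + x)).
    apply/derivable1_diffP; have := @is_derive1_sqrt R (f (0 *: e_ a + x)).
    by rewrite h0 => /(_ (f0 x Ux)) [].
  have dc : differentiable (@Num.sqrt R \o (fun h => f (h *: e_ a + x))) 0.
    exact: differentiable_comp.
  apply: DeriveDef; first by apply: (derivable1P _ _ _).2; apply: (derivable1_diffP _ _).2.
  have E (h : 'rV[R]_n -> R) :
      'D_(e_ a) h x = (fun t : R => h (t *: e_ a + x))^`()%classic 0.
    rewrite derive1E /derive.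
    set u := fun h => h^-1 *: _; set w := fun h => h^-1 *: _.
    suff -> : u = w by [].
    rewrite funeqE /u /w => t /=; rewrite addr0 scale0r add0r.
    by rewrite [t%:A]mulr1.
  rewrite E (@derive1_comp _ (fun h => f (h *: e_ a + x)) (@Num.sqrt R)).
  + rewrite h0 derive1E derive_sqrt ?f0// -E fE invfM.
    by rewrite !mulrfctE.
  + exact/derivable1_diffP.
  + exact/derivable1_diffP.
Qed.

Lemma smooth_closureP U f : open U -> smooth_closure U f -> smooth U f.
Proof.
move=> oU sf k; elim: k f sf => [|k IH] f /smooth_closure_derive[fC fD] //=.
split=> [x a Ux|a]; first by have [g _ /(_ x Ux) []] := fD a.
have [g sg gD] := fD a; apply: (Ck_ext oU) (IH g sg) => x Ux.
by have [_ <-] := gD x Ux.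
Qed.

Section operations.
Variable U : set 'rV[R]_n.
Hypothesis oU : open U.

Lemma smooth_cst c : smooth U (cst c).
Proof. by apply: smooth_closureP => //; exact: Smooth_cst. Qed.

Lemma smoothD f g : smooth U f -> smooth U g -> smooth U (fun x => f x + g x).
Proof.
move=> sf sg; apply: (@smooth_closureP _ (f + g)) => //.
by apply: Smooth_add; apply: Smooth_base.
Qed.

Lemma smoothM f g : smooth U f -> smooth U g -> smooth U (fun x => f x * g x).
Proof.
move=> sf sg; apply: (@smooth_closureP _ (f * g)) => //.
by apply: Smooth_mul; apply: Smooth_base.
Qed.

Lemma smoothN f : smooth U f -> smooth U (fun x => - f x).
Proof.
move=> /(smoothM (smooth_cst (-1))); apply: smooth_ext => // x _ /=.
by rewrite mulN1r.
Qed.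

Lemma smoothV f : smooth U f -> (forall x, U x -> f x != 0) ->
  smooth U (fun x => (f x)^-1).
Proof.
move=> sf f0; apply: smooth_closureP => //.
by apply: Smooth_inv f0; apply: Smooth_base.
Qed.

Lemma smooth_sqrt f : smooth U f -> (forall x, U x -> 0 < f x) ->
  smooth U (fun x => Num.sqrt (f x)).
Proof.
move=> sf f0; apply: smooth_closureP => //.
by apply: Smooth_sqrt f0; apply: Smooth_base.
Qed.

End operations.

End smooth_functions.

(** * Equality of mixed directional derivatives *)

Section schwarz.
Variables (R : realType) (V : normedModType R).
Implicit Types (f : V -> R) (x v z : V).

Lemma is_derive_line f v z (s df : R) :
  is_derive (s *: v + z) v f df -> is_derive s 1 (fun t : R => f (t *: v + z)) df.
Proof.
move=> [fd fE].
have E : (fun h : R => h^-1 *: (((fun t : R => f (t *: v + z)) \o shift s) (h *: 1)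
             - f (s *: v + z))) =
         (fun h => h^-1 *: ((f \o shift (s *: v + z)) (h *: v) - f (s *: v + z))).
  rewrite funeqE => h /=; congr (_ *: (f _ - _)).
  by rewrite [h%:A]mulr1 scalerDl addrA.
by apply: DeriveDef; [rewrite /derivable E|rewrite /derive E].
Qed.

Lemma MVT_line f v z (h : R) : 0 < h ->
  (forall s, 0 <= s <= h -> derivable f (s *: v + z) v) ->
  exists2 s, 0 < s < h
    & f (h *: v + z) - f z = 'D_v f (s *: v + z) * h.
Proof.
move=> h0 fd; pose g (t : R) := f (t *: v + z).
have gD s : s \in `[0, h] -> is_derive s 1 g ('D_v f (s *: v + z)).
  by rewrite in_itv /= => /fd /derivableP; exact: is_derive_line.
have gC : {within `[0, h], continuous g}.
  by apply: derivable_within_continuous => s /gD [].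
have gD' s : s \in `]0, h[ -> is_derive s 1 g ('D_v f (s *: v + z)).
  by move=> /subset_itv_oo_cc; exact: gD.
have [s] := MVT h0 gD' gC.
by rewrite in_itv /= /g scale0r add0r subr0 => sh E; exists s.
Qed.

(** The mean value theorem is used twice: along [u] for the increment [f (h *: v + y) - f y], then
    along [v] for the derivative ['D_u f]. *)
Lemma second_difference f u v x (h : R) : 0 < h ->
  (forall s t, 0 <= s <= h -> 0 <= t <= h ->
     derivable f (t *: v + (s *: u + x)) u /\
     derivable (fun y => 'D_u f y) (t *: v + (s *: u + x)) v) ->
  exists2 st, (0 < st.1 < h) && (0 < st.2 < h)
    & f (h *: v + (h *: u + x)) - f (h *: u + x) - (f (h *: v + x) - f x)
      = 'D_v (fun y => 'D_u f y) (st.2 *: v + (st.1 *: u + x)) * h ^+ 2.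
Proof.
move=> h0 fd; pose g := fun y => f (h *: v + y) - f y.
have h01 : 0 <= h <= h by rewrite ltW /=.
have h00 : 0 <= (0 : R) <= h by rewrite lexx ltW.
have gD s : 0 <= s <= h -> is_derive (s *: u + x) u g
    ('D_u f (h *: v + (s *: u + x)) - 'D_u f (s *: u + x)).
  move=> sh; apply: is_deriveB.
    have := (fd s h sh h01).1 => /derivableP [D1 D2].
    have E : (fun t : R => t^-1 *: (((fun y => f (h *: v + y)) \o shift (s *: u + x)) (t *: u)
             - f (h *: v + (s *: u + x)))) =
         (fun t => t^-1 *: ((f \o shift (h *: v + (s *: u + x))) (t *: u)
             - f (h *: v + (s *: u + x)))).
      by rewrite funeqE => t /=; rewrite addrCA.
    by apply: DeriveDef; [rewrite /derivable E|rewrite /derive E].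
  have := (fd s 0 sh h00).1; rewrite scale0r add0r.
  exact: derivableP.
have [s sh E1] : exists2 s, 0 < s < h & g (h *: u + x) - g x = 'D_u g (s *: u + x) * h.
  by apply: (@MVT_line g u x h h0) => s /gD [].
have sh' : 0 <= s <= h by case/andP: sh => *; rewrite !ltW.
have [t th E2] : exists2 t, 0 < t < h &
    'D_u f (h *: v + (s *: u + x)) - 'D_u f (s *: u + x)
     = 'D_v (fun y => 'D_u f y) (t *: v + (s *: u + x)) * h.
  apply: (@MVT_line (fun y => 'D_u f y) v (s *: u + x) h h0) => t th.
  exact: (fd s t sh' th).2.
exists (s, t); rewrite ?sh ?th //=.
move: E1; rewrite /g => ->; have [_ ->] := gD s sh'.
by rewrite E2 expr2 mulrA.
Qed.

(** The second difference over a small parallelogram is symmetric in [u] and [v], so it equals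
    [h ^+ 2] times each mixed derivative, taken at two points of the parallelogram. By continuity
    the two values at [x] differ by less than any [e]. *)
Lemma schwarz f u v x :
  (\forall y \near x, [/\ derivable f y u, derivable f y v,
     derivable (fun y => 'D_u f y) y v & derivable (fun y => 'D_v f y) y u]) ->
  {for x, continuous (fun y => 'D_v (fun y => 'D_u f y) y)} ->
  {for x, continuous (fun y => 'D_u (fun y => 'D_v f y) y)} ->
  'D_v (fun y => 'D_u f y) x = 'D_u (fun y => 'D_v f y) x.
Proof.
pose A y := 'D_v (fun y => 'D_u f y) y; pose B y := 'D_u (fun y => 'D_v f y) y.
move=> fD cA cB; rewrite -[LHS]/(A x) -[RHS]/(B x).
apply/eqP; rewrite -subr_eq0 -normr_le0; apply/ler_addgt0Pr => e e0; rewrite add0r.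
have e2 : 0 < e / 2 by rewrite divr_gt0.
have nA : \forall y \near x, `|A x - A y| < e / 2.
  exact: (@cvgr_dist_lt _ _ _ (nbhs x) _ A (A x) cA).
have nB : \forall y \near x, `|B x - B y| < e / 2.
  exact: (@cvgr_dist_lt _ _ _ (nbhs x) _ B (B x) cB).
have [d d0 xd] := (nbhs_normP x _).1 (filterI fD (filterI nA nB)).
(* This keeps the parallelogram with sides [h *: u], [h *: v] inside the ball of radius [d]; the
   added 1 covers the case where both vectors are 0. *)
pose h := d / (`|u| + `|v| + 1).
have c0 : 0 < `|u| + `|v| + 1 by rewrite ltr_wpDl // addr_ge0.
have h0 : 0 < h by rewrite divr_gt0.
have inb s t : 0 <= s <= h -> 0 <= t <= h -> `|x - (t *: v + (s *: u + x))| < d.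
  move=> /andP[s0 sh] /andP[t0 th]; rewrite addrA opprD addrCA subrr addr0 normrN.
  apply: (le_lt_trans (ler_normD _ _)); rewrite !normrZ !ger0_norm //.
  apply: (@le_lt_trans _ _ (h * (`|u| + `|v|))).
    by rewrite mulrDr addrC lerD // ler_wpM2r.
  by rewrite /h mulrAC ltr_pdivrMr // ltr_pM2l // ltrDl.
have [st /andP[s_ t_] E1] := @second_difference f u v x h h0
  (fun s t sh th => let: And4 a b c d := (xd _ (inb s t sh th)).1 in conj a c).
have inb' s t : 0 <= s <= h -> 0 <= t <= h -> `|x - (t *: u + (s *: v + x))| < d.
  by move=> sh th; rewrite addrCA; exact: inb.
have [st' /andP[s_' t_'] E2] := @second_difference f v u x h h0
  (fun s t sh th => let: And4 a b c d := (xd _ (inb' s t sh th)).1 in conj b d).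
have W (r : R) : 0 < r < h -> 0 <= r <= h by case/andP=> *; rewrite !ltW.
have [_ [cA1 _]] := xd _ (inb _ _ (W _ s_) (W _ t_)).
have [_ [_ cB1]] := xd _ (inb' _ _ (W _ s_') (W _ t_')).
set p := st.2 *: v + _ in cA1 E1; set q := st'.2 *: u + _ in cB1 E2.
have AB : A p = B q.
  apply: (@mulIf _ (h ^+ 2)); first by rewrite expf_neq0 // gt_eqF.
  apply: (etrans (esym E1)); apply: (etrans _ E2).
  rewrite (addrCA (h *: v)); move: (f _) (f _) (f _) (f _) => a b c d'; ring.
have -> : A x - B x = (A x - A p) - (B x - B q).
  by move: AB; move: (A x) (B x) (A p) (B q) => a b c d' ->; ring.
move: cA1 cB1 => /=; move: (A x) (B x) (A p) (B q) => a b c d' ac bd.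
apply: (le_trans (ler_normB _ _)); rewrite (splitr e).
by apply: lerD; exact: ltW.
Qed.

End schwarz.

(** * Calculus of complex matrix-valued functions *)

Section complex_calculus.
Variables (R : realType) (n : nat) (U : set 'rV[R]_n).
Hypothesis oU : open U.
Local Notation C := R[i].
Implicit Types (f g : 'rV[R]_n -> C) (x : 'rV[R]_n) (a b : 'I_n).

Lemma partialD a (f g : 'rV[R]_n -> R) x : smooth U f -> smooth U g -> U x ->
  partial a (fun y => f y + g y) x = partial a f x + partial a g x.
Proof.
move=> sf sg Ux; have := is_deriveD (smooth_is_derive a sf Ux) (smooth_is_derive a sg Ux).
by case.
Qed.

Lemma partialM a (f g : 'rV[R]_n -> R) x : smooth U f -> smooth U g -> U x ->
  partial a (fun y => f y * g y) x = partial a f x * g x + f x * partial a g x.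
Proof.
move=> sf sg Ux; have := is_deriveM (smooth_is_derive a sf Ux) (smooth_is_derive a sg Ux).
by case=> _; rewrite addrC [g x *: _]mulrC; exact.
Qed.

Lemma partialN a (f : 'rV[R]_n -> R) x : smooth U f -> U x ->
  partial a (fun y => - f y) x = - partial a f x.
Proof. by move=> sf Ux; case: (is_deriveN (smooth_is_derive a sf Ux)). Qed.

Lemma partial_cst a (c : R) x : partial a (fun=> c) x = 0.
Proof. exact: derive_cst. Qed.

Lemma partialC a b (f : 'rV[R]_n -> R) x : smooth U f -> U x ->
  partial a (partial b f) x = partial b (partial a f) x.
Proof.
move=> sf Ux; apply: (@schwarz R 'rV[R]_n f (delta_mx 0 b) (delta_mx 0 a) x).
- have D y : U y -> [/\ derivable f y (delta_mx 0 b), derivable f y (delta_mx 0 a),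
      derivable (fun z => 'D_(delta_mx 0 b) f z) y (delta_mx 0 a) &
      derivable (fun z => 'D_(delta_mx 0 a) f z) y (delta_mx 0 b)].
    move=> Uy; split; try exact: smooth_derivable Uy.
    + exact: (smooth_derivable (smooth_partial _ sf) Uy).
    + exact: (smooth_derivable (smooth_partial _ sf) Uy).
  have xU : nbhs x U by exact: open_nbhs_nbhs.
  exact: (filterS D xU).
- exact: (smooth_continuous (smooth_partial _ (smooth_partial _ sf)) Ux).
- exact: (smooth_continuous (smooth_partial _ (smooth_partial _ sf)) Ux).
Qed.

Lemma ReD (z w : C) : complex.Re (z + w) = complex.Re z + complex.Re w.
Proof. by case: z; case: w. Qed.
Lemma ImD (z w : C) : complex.Im (z + w) = complex.Im z + complex.Im w.
Proof. by case: z; case: w. Qed.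
Lemma ReN (z : C) : complex.Re (- z) = - complex.Re z.
Proof. by case: z. Qed.
Lemma ImN (z : C) : complex.Im (- z) = - complex.Im z.
Proof. by case: z. Qed.
Lemma ReM (z w : C) : complex.Re (z * w) =
  complex.Re z * complex.Re w - complex.Im z * complex.Im w.
Proof. by case: z; case: w. Qed.
Lemma ImM (z w : C) : complex.Im (z * w) =
  complex.Re z * complex.Im w + complex.Im z * complex.Re w.
Proof. by case: z; case: w. Qed.

Lemma csmooth_ext f g : (forall x, U x -> f x = g x) -> csmooth U f -> csmooth U g.
Proof.
by move=> fg [sr si]; split; [apply: smooth_ext sr|apply: smooth_ext si];
   rewrite // => x Ux; rewrite fg.
Qed.

Lemma csmooth_cst (c : C) : csmooth U (fun=> c).
Proof. by split; exact: smooth_cst. Qed.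

Lemma csmoothD f g : csmooth U f -> csmooth U g -> csmooth U (fun x => f x + g x).
Proof.
move=> [fr fi] [gr gi]; split.
  by apply: smooth_ext (smoothD oU fr gr) => // x _; rewrite ReD.
by apply: smooth_ext (smoothD oU fi gi) => // x _; rewrite ImD.
Qed.

Lemma csmoothN f : csmooth U f -> csmooth U (fun x => - f x).
Proof.
move=> [fr fi]; split.
  by apply: smooth_ext (smoothN oU fr) => // x _; rewrite ReN.
by apply: smooth_ext (smoothN oU fi) => // x _; rewrite ImN.
Qed.

Lemma csmoothB f g : csmooth U f -> csmooth U g -> csmooth U (fun x => f x - g x).
Proof. by move=> sf sg; apply: csmoothD sf _; exact: csmoothN. Qed.

Lemma csmoothM f g : csmooth U f -> csmooth U g -> csmooth U (fun x => f x * g x).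
Proof.
move=> [fr fi] [gr gi]; split.
  apply: smooth_ext (smoothD oU (smoothM oU fr gr) (smoothN oU (smoothM oU fi gi))) => // x _.
  by rewrite ReM.
apply: smooth_ext (smoothD oU (smoothM oU fr gi) (smoothM oU fi gr)) => // x _.
by rewrite ImM.
Qed.

Lemma csmooth_sum (I : Type) (r : seq I) (P : pred I) (F : I -> 'rV[R]_n -> C) :
  (forall i, csmooth U (F i)) -> csmooth U (fun x => \sum_(i <- r | P i) F i x).
Proof.
move=> sF; elim: r => [|i r IH].
  by apply: csmooth_ext (csmooth_cst 0) => x _; rewrite big_nil.
case: (boolP (P i)) => Pi.
  by apply: csmooth_ext (csmoothD (sF i) IH) => x _; rewrite big_cons Pi.
by apply: csmooth_ext IH => x _; rewrite big_cons (negPf Pi).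
Qed.

Lemma csmooth_prod (I : Type) (r : seq I) (P : pred I) (F : I -> 'rV[R]_n -> C) :
  (forall i, csmooth U (F i)) -> csmooth U (fun x => \prod_(i <- r | P i) F i x).
Proof.
move=> sF; elim: r => [|i r IH].
  by apply: csmooth_ext (csmooth_cst 1) => x _; rewrite big_nil.
case: (boolP (P i)) => Pi.
  by apply: csmooth_ext (csmoothM (sF i) IH) => x _; rewrite big_cons Pi.
by apply: csmooth_ext IH => x _; rewrite big_cons (negPf Pi).
Qed.

Lemma csmoothV f : csmooth U f -> (forall x, U x -> f x != 0) ->
  csmooth U (fun x => (f x)^-1).
Proof.
move=> [fr fi] f0.
have sq : smooth U (fun x => (complex.Re (f x) * complex.Re (f x)
                              + complex.Im (f x) * complex.Im (f x))^-1).
  apply: smoothV => // [|x Ux].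
    by apply: smoothD => //; exact: smoothM.
  have := f0 x Ux; case: (f x) => p q; rewrite eq_complex /= => /nandP H.
  rewrite gt_eqF // -!expr2; case: H => H.
    by rewrite ltr_pwDl ?sqr_ge0 // exprn_even_gt0.
  by rewrite ltr_wpDl ?sqr_ge0 // exprn_even_gt0.
split.
  apply: smooth_ext (smoothM oU fr sq) => // x _.
  by case: (f x) => p q; rewrite /= !expr2.
apply: smooth_ext (smoothN oU (smoothM oU fi sq)) => // x _.
by case: (f x) => p q; rewrite /= !expr2.
Qed.

Lemma cpartial_ext f g a x : (forall y, U y -> f y = g y) -> U x ->
  cpartial a f x = cpartial a g x.
Proof.
move=> fg Ux; rewrite /cpartial.
by congr (_ +i* _); apply: (partial_ext _ oU Ux) => y Uy; rewrite fg.
Qed.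

Lemma cpartial_cst a (c : C) x : cpartial a (fun=> c) x = 0.
Proof. by rewrite /cpartial !partial_cst. Qed.

Lemma cpartialD a f g x : csmooth U f -> csmooth U g -> U x ->
  cpartial a (fun y => f y + g y) x = cpartial a f x + cpartial a g x.
Proof.
move=> [fr fi] [gr gi] Ux; rewrite /cpartial.
under eq_fun do rewrite ReD; under [X in _ +i* partial _ X _]eq_fun do rewrite ImD.
by rewrite !partialD.
Qed.

Lemma cpartialN a f x : csmooth U f -> U x ->
  cpartial a (fun y => - f y) x = - cpartial a f x.
Proof.
move=> [fr fi] Ux; rewrite /cpartial.
under eq_fun do rewrite ReN; under [X in _ +i* partial _ X _]eq_fun do rewrite ImN.
by rewrite !partialN.
Qed.

Lemma cpartialM a f g x : csmooth U f -> csmooth U g -> U x ->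
  cpartial a (fun y => f y * g y) x = cpartial a f x * g x + f x * cpartial a g x.
Proof.
move=> [fr fi] [gr gi] Ux; rewrite /cpartial.
under eq_fun do rewrite ReM; under [X in _ +i* partial _ X _]eq_fun do rewrite ImM.
have sN := smoothN oU (smoothM oU fi gi).
rewrite !partialD ?partialN ?partialM //; try exact: smoothM.
case: (f x) (g x) => p q [r s] /=; apply/eqP; rewrite eq_complex /=.
by apply/andP; split; apply/eqP; ring.
Qed.

Lemma cpartial_sum a (I : Type) (r : seq I) (P : pred I) (F : I -> 'rV[R]_n -> C) x :
  (forall i, csmooth U (F i)) -> U x ->
  cpartial a (fun y => \sum_(i <- r | P i) F i y) x
  = \sum_(i <- r | P i) cpartial a (F i) x.
Proof.
move=> sF Ux; elim: r => [|i r IH].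
  under eq_fun do rewrite big_nil; rewrite big_nil; exact: cpartial_cst.
under eq_fun do rewrite big_cons; rewrite big_cons; case: ifP => // Pi.
by rewrite cpartialD ?IH //; exact: csmooth_sum.
Qed.

Lemma csmooth_cpartial a f : csmooth U f -> csmooth U (cpartial a f).
Proof. by move=> [fr fi]; split; exact: smooth_partial. Qed.

Lemma cpartialC a b f x : csmooth U f -> U x ->
  cpartial a (cpartial b f) x = cpartial b (cpartial a f) x.
Proof.
move=> [fr fi] Ux.
exact: (congr2 (@Complex R) (partialC a b fr Ux) (partialC a b fi Ux)).
Qed.

End complex_calculus.

Lemma csmooth_sub (R : realType) n (U V : set 'rV[R]_n) f :
  V `<=` U -> csmooth U f -> csmooth V f.
Proof. by move=> VU [fr fi]; split; apply: smooth_sub VU _. Qed.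

Lemma csmooth_mx_sub (R : realType) n (U V : set 'rV[R]_n) p q
    (F : 'rV[R]_n -> 'M[R[i]]_(p, q)) :
  V `<=` U -> csmooth_mx U F -> csmooth_mx V F.
Proof. by move=> VU sF i j; apply: csmooth_sub VU _. Qed.

Section matrix_calculus.
Variables (R : realType) (n : nat) (U : set 'rV[R]_n).
Hypothesis oU : open U.
Local Notation C := R[i].
Implicit Types (x : 'rV[R]_n) (a b : 'I_n).

Lemma csmooth_mx_ext p q (F G : 'rV[R]_n -> 'M[C]_(p, q)) :
  (forall x, U x -> F x = G x) -> csmooth_mx U F -> csmooth_mx U G.
Proof.
by move=> FG sF i j; apply: csmooth_ext (sF i j) => // x Ux; rewrite FG.
Qed.

Lemma csmooth_mx_cst p q (A : 'M[C]_(p, q)) : csmooth_mx U (fun=> A).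
Proof. by move=> i j; exact: csmooth_cst. Qed.

Lemma csmooth_mxD p q (F G : 'rV[R]_n -> 'M[C]_(p, q)) :
  csmooth_mx U F -> csmooth_mx U G -> csmooth_mx U (fun x => F x + G x).
Proof.
move=> sF sG i j; apply: csmooth_ext (csmoothD oU (sF i j) (sG i j)) => // x _.
by rewrite mxE.
Qed.

Lemma csmooth_mxN p q (F : 'rV[R]_n -> 'M[C]_(p, q)) :
  csmooth_mx U F -> csmooth_mx U (fun x => - F x).
Proof.
move=> sF i j; apply: csmooth_ext (csmoothN oU (sF i j)) => // x _.
by rewrite mxE.
Qed.

Lemma csmooth_mxB p q (F G : 'rV[R]_n -> 'M[C]_(p, q)) :
  csmooth_mx U F -> csmooth_mx U G -> csmooth_mx U (fun x => F x - G x).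
Proof. by move=> sF sG; apply: csmooth_mxD => //; exact: csmooth_mxN. Qed.

Lemma csmooth_mxZ p q f (F : 'rV[R]_n -> 'M[C]_(p, q)) :
  csmooth U f -> csmooth_mx U F -> csmooth_mx U (fun x => f x *: F x).
Proof.
move=> sf sF i j; apply: csmooth_ext (csmoothM oU sf (sF i j)) => // x _.
by rewrite mxE.
Qed.

Lemma csmooth_mxM p q r (F : 'rV[R]_n -> 'M[C]_(p, q)) (G : 'rV[R]_n -> 'M[C]_(q, r)) :
  csmooth_mx U F -> csmooth_mx U G -> csmooth_mx U (fun x => F x *m G x).
Proof.
move=> sF sG i j.
have s k : csmooth U (fun x => F x i k * G x k j) by exact: csmoothM.
apply: csmooth_ext (csmooth_sum oU (index_enum 'I_q) xpredT s) => // x _.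
by rewrite mxE.
Qed.

Lemma csmooth_tr p q (F : 'rV[R]_n -> 'M[C]_(p, q)) :
  csmooth_mx U F -> csmooth_mx U (fun x => (F x)^T).
Proof.
by move=> sF i j; apply: csmooth_ext (sF j i) => // x _; rewrite mxE.
Qed.

Lemma csmooth_det p (F : 'rV[R]_n -> 'M[C]_p) :
  csmooth_mx U F -> csmooth U (fun x => \det (F x)).
Proof.
move=> sF; apply: csmooth_sum => // s; apply: csmoothM => //.
  exact: csmooth_cst.
by apply: csmooth_prod => // i; exact: sF.
Qed.

Lemma csmooth_inv p (F : 'rV[R]_n -> 'M[C]_p) :
  csmooth_mx U F -> (forall x, U x -> F x \in unitmx) ->
  csmooth_mx U (fun x => invmx (F x)).
Proof.
move=> sF uF.
apply: (@csmooth_mx_ext _ _ (fun x => (\det (F x))^-1 *: \adj (F x))).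
  by move=> x Ux; rewrite /invmx uF.
apply: csmooth_mxZ.
  apply: (csmoothV oU (csmooth_det sF)) => x Ux.
  by have := uF x Ux; rewrite unitmxE unitfE.
move=> i j; apply: (@csmooth_ext _ _ _ oU (fun x => cofactor (F x) j i)).
  by move=> x _; rewrite mxE.
apply: csmoothM => //; first exact: csmooth_cst.
apply: csmooth_det => // k l.
by apply: csmooth_ext (sF (lift j k) (lift i l)) => // x _; rewrite !mxE.
Qed.

Definition mxpartial p q a (F : 'rV[R]_n -> 'M[C]_(p, q)) x : 'M[C]_(p, q) :=
  \matrix_(i, j) cpartial a (fun y => F y i j) x.

Lemma mxpartial_ext p q a (F G : 'rV[R]_n -> 'M[C]_(p, q)) x :
  (forall y, U y -> F y = G y) -> U x -> mxpartial a F x = mxpartial a G x.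
Proof.
move=> FG Ux; apply/matrixP => i j; rewrite !mxE.
by apply: (cpartial_ext oU) => // y Uy; rewrite FG.
Qed.

Lemma mxpartial_cst p q a (A : 'M[C]_(p, q)) x : mxpartial a (fun=> A) x = 0.
Proof. by apply/matrixP => i j; rewrite !mxE cpartial_cst. Qed.

Lemma mxpartialD p q a (F G : 'rV[R]_n -> 'M[C]_(p, q)) x :
  csmooth_mx U F -> csmooth_mx U G -> U x ->
  mxpartial a (fun y => F y + G y) x = mxpartial a F x + mxpartial a G x.
Proof.
move=> sF sG Ux; apply/matrixP => i j; rewrite !mxE.
under [fun y => (F y + G y) i j]eq_fun do rewrite mxE.
by rewrite (cpartialD (U := U)).
Qed.

Lemma mxpartialZ p q a f (F : 'rV[R]_n -> 'M[C]_(p, q)) x :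
  csmooth U f -> csmooth_mx U F -> U x ->
  mxpartial a (fun y => f y *: F y) x
  = cpartial a f x *: F x + f x *: mxpartial a F x.
Proof.
move=> sf sF Ux; apply/matrixP => i j; rewrite !mxE.
under [fun y => (f y *: F y) i j]eq_fun do rewrite mxE.
by rewrite (cpartialM (U := U)).
Qed.

Lemma mxpartialM p q r a (F : 'rV[R]_n -> 'M[C]_(p, q))
    (G : 'rV[R]_n -> 'M[C]_(q, r)) x :
  csmooth_mx U F -> csmooth_mx U G -> U x ->
  mxpartial a (fun y => F y *m G y) x
  = mxpartial a F x *m G x + F x *m mxpartial a G x.
Proof.
move=> sF sG Ux; apply/matrixP => i j; rewrite !mxE.
under [fun y => (F y *m G y) i j]eq_fun do rewrite mxE.
rewrite (cpartial_sum (U := U)) // => [|k]; last exact: csmoothM.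
rewrite -big_split /=; apply: eq_bigr => k _.
by rewrite !mxE (cpartialM (U := U)).
Qed.

Lemma mxpartial_tr p q a (F : 'rV[R]_n -> 'M[C]_(p, q)) x :
  mxpartial a (fun y => (F y)^T) x = (mxpartial a F x)^T.
Proof.
apply/matrixP => i j; rewrite !mxE.
by under [fun y => (F y)^T i j]eq_fun do rewrite mxE.
Qed.

Lemma mxpartialC p q a b (F : 'rV[R]_n -> 'M[C]_(p, q)) x :
  csmooth_mx U F -> U x ->
  mxpartial a (mxpartial b F) x = mxpartial b (mxpartial a F) x.
Proof.
move=> sF Ux; apply/matrixP => i j.
have E c : (fun y => mxpartial c F y i j) = cpartial c (fun y => F y i j).
  by apply: funext => y; rewrite mxE.
by rewrite [LHS]mxE [RHS]mxE !E; exact: (cpartialC oU a b (sF i j) Ux).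
Qed.

Lemma csmooth_mxpartial p q a (F : 'rV[R]_n -> 'M[C]_(p, q)) :
  csmooth_mx U F -> csmooth_mx U (mxpartial a F).
Proof.
move=> sF i j; apply: csmooth_ext (csmooth_cpartial _ (sF i j)) => // x _.
by rewrite mxE.
Qed.

End matrix_calculus.

(** * Existence of null cotetrads *)

Section local_roots.
Variables (R : realType) (n : nat).
Local Notation C := R[i].
Implicit Types (U V : set 'rV[R]_n).

Lemma open_gt0 U (f : 'rV[R]_n -> R) : open U -> smooth U f ->
  open [set y | U y /\ 0 < f y].
Proof.
move=> oU sf; rewrite openE => y [Uy fy].
have yU : nbhs y U by exact: open_nbhs_nbhs.
have fU : nbhs y (f @^-1` [set r | 0 < r]).
  apply: (smooth_continuous sf Uy).
  by apply: open_nbhs_nbhs; split => //; exact: open_gt.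
exact: filterI yU fU.
Qed.

Lemma open_neq0 U (f : 'rV[R]_n -> C) : open U -> csmooth U f ->
  open [set y | U y /\ f y != 0].
Proof.
move=> oU [fr fi].
have s : smooth U (fun y => complex.Re (f y) * complex.Re (f y)
                            + complex.Im (f y) * complex.Im (f y)).
  by apply: smoothD => //; apply: smoothM.
suff -> : [set y | U y /\ f y != 0] =
    [set y | U y /\ 0 < complex.Re (f y) * complex.Re (f y)
                        + complex.Im (f y) * complex.Im (f y)].
  exact: open_gt0.
apply/seteqP; split=> y [Uy H]; split=> //; move: H.
  case: (f y) => p q; rewrite eq_complex /= => /nandP H; rewrite -!expr2.
  case: H => H.
    by rewrite ltr_pwDl ?sqr_ge0 // exprn_even_gt0.
  by rewrite ltr_wpDl ?sqr_ge0 // exprn_even_gt0.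
by apply: contraTneq => ->; rewrite /= !mulr0 addr0 ltxx.
Qed.

(** Dividing by [f y0] brings the values into the half-plane of positive real part, where the
    principal root of [a + i b] is [p + i q] with [p = sqrt ((r + a) / 2)], [q = b / (2 p)] and [r]
    the modulus. These are smooth because only square roots and inverses of positive functions
    occur; a constant root of [f y0] is then multiplied back. *)
Lemma local_sqrt U (f : 'rV[R]_n -> C) y0 : open U -> csmooth U f -> U y0 ->
  f y0 != 0 ->
  exists V s, [/\ open V, V `<=` U, V y0, csmooth V s
                & forall y, V y -> s y ^+ 2 = f y].
Proof.
move=> oU sf Uy0 f0.
pose c := f y0; pose w y := f y * c^-1.
have [sa sb] : csmooth U w by apply: csmoothM => //; exact: csmooth_cst.
pose a y := complex.Re (w y); pose b y := complex.Im (w y).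
pose V := [set y | U y /\ 0 < a y].
have oV : open V by exact: open_gt0.
have VU : V `<=` U by move=> y [].
have {}sa : smooth V a by exact: smooth_sub sa.
have {}sb : smooth V b by exact: smooth_sub sb.
pose r y := Num.sqrt (a y * a y + b y * b y).
have ab0 y : V y -> 0 < a y * a y + b y * b y.
  by move=> [_ ay]; rewrite ltr_pwDl ?mulr_gt0 // -expr2 sqr_ge0.
have sr : smooth V r.
  by apply: smooth_sqrt => //; apply: smoothD => //; apply: smoothM.
pose p y := Num.sqrt ((r y + a y) * 2^-1).
have ra0 y : V y -> 0 < (r y + a y) * 2^-1.
  by move=> Vy; rewrite mulr_gt0 ?invr_gt0 // addr_gt0 ?sqrtr_gt0 ?ab0 //; case: Vy.
have sp : smooth V p.
  apply: smooth_sqrt => //; apply: smoothM => //; last exact: smooth_cst.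
  exact: smoothD.
have p0 y : V y -> p y != 0 by move=> Vy; rewrite gt_eqF // sqrtr_gt0 ra0.
pose q y := b y * (2 * p y)^-1.
have sq : smooth V q.
  apply: smoothM => //; apply: smoothV => // [|y Vy].
    by apply: smoothM => //; exact: smooth_cst.
  by rewrite mulf_neq0 ?p0.
exists V, (fun y => (p y +i* q y) * sqrtc c); split=> //.
- by split=> //; rewrite /a /w /c divff.
- by apply: csmoothM => //; exact: csmooth_cst.
move=> y Vy; rewrite exprMn sqr_sqrtc.
suff -> : (p y +i* q y) ^+ 2 = w y by rewrite /w divfK.
have p2 : p y * p y = (r y + a y) / 2 by rewrite -expr2 sqr_sqrtr // ltW ?ra0.
have r2 : r y * r y = a y * a y + b y * b y by rewrite -expr2 sqr_sqrtr // ltW ?ab0.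
have q2 : q y * q y = (r y - a y) / 2.
  have -> : q y * q y = b y * b y / (4 * (p y * p y)).
    by rewrite /q; field; exact: p0.
  have -> : b y * b y = (r y - a y) * (r y + a y).
    by rewrite -[b y * b y](addKr (a y * a y)) -r2; ring.
  rewrite p2; field.
  have := ra0 y Vy; rewrite pmulr_lgt0 ?invr_gt0 // => h.
  by rewrite gt_eqF.
rewrite expr2; rewrite [RHS](_ : _ = a y +i* b y); last by rewrite /a /b; case: (w y).
apply/eqP; rewrite eq_complex /=; apply/andP; split; apply/eqP.
  by rewrite p2 q2; field.
by rewrite /q; field; exact: p0.
Qed.

End local_roots.

Section local_factorization.
Variables (R : realType) (m : nat).
Local Notation C := R[i].
Implicit Types (U V : set 'rV[R]_m).

Lemma csmooth_block U p q r s (A : 'rV[R]_m -> 'M[C]_(p, q)) (B : 'rV[R]_m -> 'M[C]_(p, r))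
    (D : 'rV[R]_m -> 'M[C]_(s, q)) (E : 'rV[R]_m -> 'M[C]_(s, r)) : open U ->
  csmooth_mx U A -> csmooth_mx U B -> csmooth_mx U D -> csmooth_mx U E ->
  csmooth_mx U (fun x => block_mx (A x) (B x) (D x) (E x)).
Proof.
move=> oU sA sB sD sE i j.
case: (split_ordP i) => i' ->; case: (split_ordP j) => j' ->.
- by apply: csmooth_ext (sA i' j') => // x _; rewrite block_mxEul.
- by apply: csmooth_ext (sB i' j') => // x _; rewrite block_mxEur.
- by apply: csmooth_ext (sD i' j') => // x _; rewrite block_mxEdl.
- by apply: csmooth_ext (sE i' j') => // x _; rewrite block_mxEdr.
Qed.

(** Polarization: if the quadratic form is zero, so is the symmetric bilinear form. *)
Lemma anisotropic_row n (G : 'M[C]_n) : G^T = G -> G != 0 ->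
  exists v : 'rV[C]_n, (v *m G *m v^T) 0 0 != 0.
Proof.
move=> Gs; apply: contra_neqP => /forallNP H; apply/matrixP => i j; rewrite mxE.
have Q (u v : 'rV[C]_n) : (u *m G *m v^T) 0 0 = 0.
  have q (w : 'rV[C]_n) : (w *m G *m w^T) 0 0 = 0 by apply/eqP; move: (H w) => /negP; rewrite negbK.
  have S : (v *m G *m u^T) 0 0 = (u *m G *m v^T) 0 0.
    by rewrite -[in LHS]Gs -[v in LHS]trmxK -!trmx_mul mxE mulmxA.
  have := q (u + v); rewrite linearD /= !mulmxDl !mulmxDr !mxE.
  have := q u; have := q v; have := S; rewrite !mxE => -> -> ->.
  rewrite add0r addr0 => /eqP; rewrite -mulr2n mulrn_eq0 /= => /eqP //.
have := Q (delta_mx 0 i) (delta_mx 0 j).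
by rewrite -rowE trmx_delta -colE !mxE.
Qed.

Lemma anisotropic_basis n (G : 'M[C]_n.+1) : G^T = G -> G != 0 ->
  exists2 B : 'M[C]_n.+1, B \in unitmx & (B *m G *m B^T) 0 0 != 0.
Proof.
move=> Gs G0; have [v vG] := anisotropic_row Gs G0.
have v0 : v != 0 by apply: contraNneq vG => ->; rewrite !mul0mx mxE.
(* Since [v] has rank 1, the first row of the invertible matrix [row_ebase v] is proportional to
   [v], so this completes [v] to a basis up to a factor. *)
exists (row_ebase v); first exact: row_ebase_unit.
have E : v = (col_ebase v 0 0) *: row 0 (row_ebase v).
  have := mulmx_ebase v; rewrite rank_rV v0 => {1}<-.
  rewrite -mulmxA [col_ebase v]mx11_scalar mul_scalar_mx !mxE /= mulr1n.
  congr (_ *: _); apply/rowP => j; rewrite !mxE (bigD1 0) //= big1 => [|i i0].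
    by rewrite !mxE /= mul1r addr0.
  by rewrite !mxE /= (_ : (0 == i :> nat)%N = false) ?mul0r //; apply/negP => /eqP H;
     move/eqP: i0; apply; apply: val_inj.
apply: contraNneq vG => H.
rewrite E linearZ /= -!scalemxAl -scalemxAr !mxE.
have -> : \sum_j (row 0 (row_ebase v) *m G) 0 j * (row 0 (row_ebase v))^T j 0
   = (row_ebase v *m G *m (row_ebase v)^T) 0 0.
  rewrite [RHS]mxE; apply: eq_bigr => j _; rewrite -row_mul !mxE.
  by [].
by rewrite H !mulr0.
Qed.

Lemma gram_congruence n (B D L E : 'M[C]_n) : E = D^T *m D ->
  B *m (L^T *m E *m L) *m B^T = (D *m L *m B^T)^T *m (D *m L *m B^T).
Proof. by move=> ->; rewrite !trmx_mul trmxK !mulmxA. Qed.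

(** Completion of squares with smooth dependence on the point. A constant change of basis makes the
    upper left entry nonzero at [y0], so that it has a smooth square root [s] nearby. What is left
    is the Schur complement [S] of that entry, again symmetric and invertible at [y0], to which the
    induction applies. *)
Lemma local_factorization n U (G : 'rV[R]_m -> 'M[C]_n) y0 :
  open U -> U y0 -> csmooth_mx U G -> (forall y, U y -> (G y)^T = G y) ->
  G y0 \in unitmx ->
  exists V (L : 'rV[R]_m -> 'M[C]_n), [/\ open V, V `<=` U, V y0, csmooth_mx V L
                & forall y, V y -> G y = (L y)^T *m L y].
Proof.
elim: n U G => [|n IH] U G oU Uy0 sG symG uG.
  exists U, G; split=> // y Uy; apply/matrixP => i; by case: i.
have G0 : G y0 != 0.
  by apply: contraTneq uG => ->; rewrite unitmxE det0 unitr0.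
have [B uB B0] := anisotropic_basis (symG _ Uy0) G0.
pose G' y : 'M[C]_(1 + n) := B *m G y *m B^T.
have sG' : csmooth_mx U G'.
  by apply: csmooth_mxM => //; [apply: csmooth_mxM => //|]; exact: csmooth_mx_cst.
have symG' y : U y -> (G' y)^T = G' y.
  by move=> Uy; rewrite /G' !trmx_mul trmxK symG // mulmxA.
have [V1 [s [oV1 V1U V1y0 ss sE]]] := local_sqrt oU (sG' 0 0) Uy0 B0.
pose V2 := [set y | V1 y /\ s y != 0].
have oV2 : open V2 by exact: open_neq0.
have V2V1 : V2 `<=` V1 by move=> y [].
have V2U : V2 `<=` U by move=> y /V2V1/V1U.
have V2y0 : V2 y0.
  by split=> //; apply: contraNneq B0 => s0; rewrite -/(G' y0) -sE // s0 expr0n.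
have {}ss : csmooth V2 s by exact: csmooth_sub ss.
have {}sG' : csmooth_mx V2 G' by exact: csmooth_mx_sub sG'.
have ssV : csmooth V2 (fun y => (s y)^-1) by apply: csmoothV => // y [].
pose b y : 'M[C]_(1, n) := ursubmx (G' y).
have sb : csmooth_mx V2 b.
  by move=> i j; apply: csmooth_ext (sG' (lshift n i) (rshift 1 j)) => // y _; rewrite !mxE.
pose S y : 'M[C]_n := drsubmx (G' y) - (s y)^-1 ^+ 2 *: ((b y)^T *m b y).
have sS : csmooth_mx V2 S.
  apply: csmooth_mxB => //.
    by move=> i j; apply: csmooth_ext (sG' (rshift 1 i) (rshift 1 j)) => // y _; rewrite !mxE.
  apply: csmooth_mxZ => //; first exact: csmoothM.
  by apply: csmooth_mxM => //; exact: csmooth_tr.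
pose L1 y : 'M[C]_(1 + n) := block_mx (s y)%:M ((s y)^-1 *: b y) 0 1%:M.
have G'E y : V2 y -> G' y = (L1 y)^T *m block_mx 1%:M 0 0 (S y) *m L1 y.
  move=> Vy; have [_ s0] := Vy.
  rewrite /L1 tr_block_mx !tr_scalar_mx trmx0 !mulmx_block.
  rewrite !(mul0mx, mulmx0, mulmx1, mul1mx, addr0, add0r).
  rewrite -[LHS]submxK; congr block_mx.
  - rewrite mul_scalar_mx scale_scalar_mx -expr2 sE; last exact: V2V1.
    rewrite [LHS]mx11_scalar; congr (_%:M); rewrite [LHS]mxE [LHS]mxE.
    by congr (G' y _ _); apply: val_inj.
  - by rewrite mul_scalar_mx scalerA mulfV // scale1r.
  - rewrite linearZ /= mul_mx_scalar scalerA mulfV // scale1r /b trmx_ursub symG' //.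
    exact: V2U.
  - by rewrite [_^T]linearZ /= -scalemxAl -scalemxAr scalerA -expr2 /S addrC subrK.
have symS y : V2 y -> (S y)^T = S y.
  move=> Vy; rewrite /S linearB /= linearZ /= trmx_mul trmxK; congr (_ - _).
  by rewrite trmx_drsub symG' //; exact: V2U.
have uS : S y0 \in unitmx.
  have : G' y0 \in unitmx by rewrite !unitmx_mul unitmx_tr uB uG.
  rewrite G'E // !unitmx_mul => /andP[/andP[_ +] _].
  by rewrite !unitmxE det_ublock det1 mul1r.
have [V [L2 [oV VV2 Vy0 sL2 L2E]]] := IH V2 S oV2 V2y0 sS symS uS.
pose L y : 'M[C]_n.+1 := block_mx (1%:M : 'M[C]_1) 0 0 (L2 y) *m L1 y *m (invmx B)^T.
exists V, L; split=> //.
- by move=> y /VV2/V2U.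
- apply: csmooth_mxM => //; last exact: csmooth_mx_cst.
  apply: csmooth_mxM => //.
    by apply: (@csmooth_block V 1 1 n n (fun=> 1%:M) (fun=> 0) (fun=> 0) L2) => //;
      exact: csmooth_mx_cst.
  apply: (csmooth_mx_sub VV2).
  apply: (@csmooth_block V2 1 1 n n (fun y => (s y)%:M)
            (fun y => (s y)^-1 *: b y) (fun=> 0) (fun=> 1%:M)) => //.
  + move=> i j; apply: csmooth_ext ss => // y _.
    by rewrite !mxE !ord1 eqxx mulr1n.
  + exact: csmooth_mxZ.
  + exact: csmooth_mx_cst.
  + exact: csmooth_mx_cst.
move=> y Vy; have GE : G y = invmx B *m G' y *m (invmx B)^T.
  rewrite /G' !mulmxA mulVmx // mul1mx -mulmxA -trmx_mul mulVmx //.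
  by rewrite trmx1 mulmx1.
rewrite GE (G'E y (VV2 y Vy)); 
apply: (@gram_congruence _ _ (block_mx (1%:M : 'M[C]_1) 0 0 (L2 y))).
rewrite tr_block_mx !trmx0 trmx1 mulmx_block L2E //.
by rewrite !(mul0mx, mulmx0, mulmx1, addr0, add0r).
Qed.

End local_factorization.

Section null_cotetrad_existence.
Variables (R : realType) (M : oriented_manifold R 4) (W : weyl_geometry M).
Variable vol : volume_form W.
Local Notation C := R[i].

(* The matrix of [MP - NK] in the coframe [(M, P, N, K)]. *)
Definition null_gram : 'M[C]_4 := \matrix_(i, j)
  if (i : nat, j : nat) \in [:: (0, 1); (1, 0)]%N then 2^-1
  else if (i : nat, j : nat) \in [:: (2, 3); (3, 2)]%N then - 2^-1 else 0.

(* [M = x1 + i x2], [P = x1 - i x2], [N = - (x3 + i x4)], [K = x3 - i x4]. *)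
Definition null_change : 'M[C]_4 := \matrix_(i, j)
  nth 0 (nth [::] [:: [:: 1; 'i%C; 0; 0]; [:: 1; - 'i%C; 0; 0];
                      [:: 0; 0; -1; - 'i%C]; [:: 0; 0; 1; - 'i%C]] i) j.

Lemma sum4 (V : nmodType) (F : 'I_4 -> V) :
  \sum_i F i = F i1 + F i2 + F i3 + F i4.
Proof.
rewrite !big_ord_recl big_ord0 addr0 !addrA.
by congr (_ + _ + _ + _); congr (F _); apply: val_inj.
Qed.

Lemma ord4P (P : 'I_4 -> Prop) : P i1 -> P i2 -> P i3 -> P i4 -> forall i, P i.
Proof.
by move=> p1 p2 p3 p4 [[|[|[|[|//]]]] i]; rewrite (bool_irrelevance i isT).
Qed.

Lemma null_gramE (t : 'M[C]_4) :
  symprod (row i1 t) (row i2 t) - symprod (row i3 t) (row i4 t)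
  = t^T *m null_gram *m t.
Proof.
apply/matrixP => a b; rewrite !mxE !big_ord1 !mxE !sum4 !mxE !sum4 !mxE /=.
by ring.
Qed.

Lemma null_changeE : null_change^T *m null_gram *m null_change = 1%:M.
Proof.
have i2E : ('i%C : C) * 'i%C = -1 by rewrite -expr2 sqr_i.
rewrite -null_gramE; apply/matrixP; elim/ord4P; elim/ord4P;
  rewrite !mxE !big_ord1 !mxE /=; by field: i2E.
Qed.

Lemma det_null_gram : 16 * \det null_gram = 1.
Proof.
pose B (r : C) : 'M[C]_2 := \matrix_(i, j) if i == j then 0 else r.
have -> : \det null_gram = \det (block_mx (B 2^-1) 0 0 (B (- 2^-1))).
  congr (\det _).
  suff E (i j : 'I_(2 + 2)) : null_gram i j = block_mx (B 2^-1) 0 0 (B (- 2^-1)) i j.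
    by apply/matrixP => i j; exact: E.
  case: (split_ordP i) => i' ->; case: (split_ordP j) => j' ->.
  - rewrite block_mxEul !mxE; case: i' j' => [[|[|//]] ?] [[|[|//]] ?] //=.
  - rewrite block_mxEur !mxE; case: i' j' => [[|[|//]] ?] [[|[|//]] ?] //=.
  - rewrite block_mxEdl !mxE; case: i' j' => [[|[|//]] ?] [[|[|//]] ?] //=.
  - rewrite block_mxEdr !mxE; case: i' j' => [[|[|//]] ?] [[|[|//]] ?] //=.
have detB r : \det (B r) = - r ^+ 2.
  rewrite (expand_det_row _ ord0) !big_ord_recl big_ord0 /cofactor !det_mx11 !mxE /=.
  by ring.
by rewrite det_ublock !detB; field.
Qed.

(** The rows of [L] in [G = L^T L] form an orthonormal coframe, which [null_change] makes null. Its
    determinant agrees with the volume form up to sign, and exchanging the first two rows corrects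
    the sign. *)
Lemma null_cotetrad_exists c U y0 : open U -> U `<=` img c -> U y0 ->
  exists V th, [/\ V `<=` U, V y0 & null_cotetrad vol c V th].
Proof.
move=> oU Uc Uy0.
have sG := csmooth_mx_sub Uc (metric_smooth W c).
have symG y : U y -> (metric W c y)^T = metric W c y.
  by move=> /Uc Uy; exact: (Defs.metric_sym W Uy).
have uG := metric_nondegenerate W (Uc _ Uy0).
have [V [L [oV VU Vy0 sL LE]]] := local_factorization oU Uy0 sG symG uG.
pose t0 y := null_change *m L y.
have gramE t : (forall y, V y -> metric W c y = (t y)^T *m null_gram *m t y) ->
  forall y, V y -> volume vol c y ^+ 2 = \det (t y) ^+ 2.
  move=> tE y Vy; rewrite volume_normalized; last exact/Uc/VU.
  rewrite tE // !det_mulmx det_tr; have := det_null_gram.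
  by move: (\det null_gram) (\det (t y)) => d a dE; ring: dE.
have t0E y : V y -> metric W c y = (t0 y)^T *m null_gram *m t0 y.
  move=> Vy; rewrite /t0 trmx_mul -!mulmxA (mulmxA null_gram) (mulmxA null_change^T).
  by rewrite (mulmxA null_change^T) null_changeE mul1mx LE.
have st0 : csmooth_mx V t0.
  by apply: csmooth_mxM => //; exact: csmooth_mx_cst.
(* Exchanging M and P preserves MP - NK and reverses the sign of the determinant. *)
pose sw (s : bool) : 'M[C]_4 := if s then tperm_mx i1 i2 else 1%:M.
have swE s : (sw s)^T *m null_gram *m sw s = null_gram.
  case: s; rewrite /sw ?trmx1 ?mul1mx ?mulmx1 //.
  rewrite tr_tperm_mx -xrowE -xcolE.
  by apply/matrixP; elim/ord4P; elim/ord4P; rewrite !mxE !permE.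
have vol0 : volume vol c y0 != 0.
  apply/eqP => v0; have := volume_normalized vol (Uc _ Uy0).
  rewrite v0 expr0n => /esym/eqP; rewrite mulf_eq0 pnatr_eq0 /=.
  by move: uG; rewrite unitmxE unitfE => /negPf ->.
have [s sE] : exists s, \det (sw s *m t0 y0) = volume vol c y0.
  have /eqP := gramE t0 t0E y0 Vy0; rewrite eqf_sqr => /orP[]/eqP E.
    by exists false; rewrite /sw mul1mx.
  by exists true; rewrite det_mulmx /sw /tperm_mx det_perm odd_tperm /= E expr1 mulN1r.
pose th y := sw s *m t0 y.
have sth : csmooth_mx V th by apply: csmooth_mxM => //; exact: csmooth_mx_cst.
have thE y : V y -> metric W c y = (th y)^T *m null_gram *m th y.
  move=> Vy; rewrite /th trmx_mul -!mulmxA (mulmxA null_gram) (mulmxA (sw s)^T).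
  by rewrite (mulmxA (sw s)^T) swE t0E // mulmxA.
have sv : csmooth V (fun y => \det (th y) + volume vol c y).
  apply: csmoothD => //; first exact: csmooth_det.
  by apply: csmooth_sub (volume_smooth vol c) => y /VU/Uc.
(* The squares of the determinant and of the volume agree, so a nonzero sum excludes the wrong sign.
   This open condition holds at [y0], where the two are equal and nonzero. *)
pose V' := [set y | V y /\ \det (th y) + volume vol c y != 0].
have oV' : open V' by exact: open_neq0.
have V'V : V' `<=` V by move=> y [].
exists V', th; split.
- by move=> y /V'V/VU.
- by split=> //; rewrite /th sE -mulr2n mulrn_eq0.
split.
  split=> //; first by move=> y /V'V/VU/Uc.
    exact: csmooth_mx_sub sth.
  move=> y /V'V Vy; have := metric_nondegenerate W (Uc _ (VU _ Vy)).
  by rewrite thE // !unitmx_mul => /andP[].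
move=> y [Vy H]; split; first by rewrite null_gramE thE.
have /eqP := gramE th thE y Vy; rewrite eqf_sqr => /orP[/eqP //|/eqP E].
by move: H; rewrite E addrN eqxx.
Qed.

End null_cotetrad_existence.

(** * Weyl connections and change of coframe *)

Section connections.
Variables (R : realType) (U : set 'rV[R]_4).
Hypothesis oU : open U.
Local Notation C := R[i].
Implicit Types (th : 'rV[R]_4 -> 'M[C]_4).
Implicit Types (G : 'rV[R]_4 -> 'M[C]_4) (A : 'rV[R]_4 -> 'rV[C]_4).
Implicit Types (Ga : 'I_4 -> 'I_4 -> 'rV[R]_4 -> 'rV[C]_4) (x : 'rV[R]_4).
Implicit Types (a b c i j k l : 'I_4).

(** Evaluating the matrix of forms on d/dx^a turns identities between forms into identities between
    matrices, with the coordinate indices as parameters. *)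
Definition conn_mx Ga a x : 'M[C]_4 := \matrix_(i, j) Ga i j x 0 a.

Definition curv_mx Ga a b x : 'M[C]_4 :=
  (mxpartial a (conn_mx Ga b) x + conn_mx Ga a x *m conn_mx Ga b x)
  - (mxpartial b (conn_mx Ga a) x + conn_mx Ga b x *m conn_mx Ga a x).

Lemma wedgeE (al be : 'rV[C]_4) a b :
  wedge al be a b = al 0 a * be 0 b - al 0 b * be 0 a.
Proof. by rewrite !mxE !big_ord1 !mxE; ring. Qed.

Lemma curvature_formE Ga i j x a b :
  curvature_form Ga i j x a b = curv_mx Ga a b x i j.
Proof.
rewrite /curvature_form /curv_mx [LHS]mxE summxE !mxE.
under eq_bigr do rewrite wedgeE.
rewrite sumrB addrACA opprD; congr (_ + _ + (- _ - _)).
- by congr (cpartial a _ x); apply: funext => y; rewrite mxE.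
- by apply: eq_bigr => k _; rewrite !mxE.
- by congr (cpartial b _ x); apply: funext => y; rewrite mxE.
- by apply: eq_bigr => k _; rewrite !mxE mulrC.
Qed.

(** In this form, absence of torsion means that the covariant derivative along d/dx^a of the column
    [b] of [th] is symmetric in [a] and [b]. *)
Lemma weyl_connectionP th G A Ga :
  weyl_connection U th G A Ga <->
  [/\ forall a, csmooth_mx U (conn_mx Ga a),
      forall x a, U x ->
        mxpartial a (gframe th G) x
        - (gframe th G x *m conn_mx Ga a x + (gframe th G x *m conn_mx Ga a x)^T)
        = - A x 0 a *: gframe th G x
    & forall x a b, U x ->
        mxpartial a (fun y => col b (th y)) x + conn_mx Ga a x *m col b (th x)
        = mxpartial b (fun y => col a (th y)) x + conn_mx Ga b x *m col a (th x)].
Proof.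
have sE : (forall i j, csmooth_mx U (Ga i j)) <-> (forall a, csmooth_mx U (conn_mx Ga a)).
  split=> H.
    by move=> a i j; apply: csmooth_ext (H i j 0 a) => // x _; rewrite mxE.
  move=> i j z a; rewrite ord1.
  by apply: csmooth_ext (H a i j) => // x _; rewrite mxE.
have mE x a i j :
    (mxpartial a (gframe th G) x
     - (gframe th G x *m conn_mx Ga a x + (gframe th G x *m conn_mx Ga a x)^T)) i j
  = (diff0 (fun y => gframe th G y i j) x
          - \sum_k (gframe th G x i k *: Ga k j x
                    + gframe th G x j k *: Ga k i x)) 0 a.
  rewrite !mxE summxE -big_split /=; congr (_ - _).
  by apply: eq_bigr => k _; rewrite !mxE.
have tE x i a b :
  (diff1 (fun y => row i (th y)) x + \sum_j wedge (Ga i j x) (row j (th x))) a b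
  = ((mxpartial a (fun y => col b (th y)) x + conn_mx Ga a x *m col b (th x))
     - (mxpartial b (fun y => col a (th y)) x + conn_mx Ga b x *m col a (th x))) i 0.
  rewrite mxE summxE; under eq_bigr do rewrite wedgeE.
  rewrite sumrB !mxE addrACA opprD; congr (_ + _ + (- _ - _)).
  - by congr (cpartial a _ x); apply: funext => y; rewrite !mxE.
  - by apply: eq_bigr => k _; rewrite !mxE.
  - by congr (cpartial b _ x); apply: funext => y; rewrite !mxE.
  - by apply: eq_bigr => k _; rewrite !mxE mulrC.
split=> [[s m t]|[s m t]]; split.
- exact/sE.
- move=> x a Ux; apply/matrixP => i j; rewrite mE m // !mxE mulNr.
  by rewrite mulrC.
- move=> x a b Ux; apply/eqP; rewrite -subr_eq0; apply/eqP/matrixP => i z.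
  by rewrite (ord1 z) -tE t // addNr !mxE.
- exact/sE.
- move=> x i j Ux; apply/rowP => a; rewrite -mE m // !mxE.
  by rewrite mulNr mulrC.
- move=> x i Ux; apply/eqP; rewrite -addr_eq0; apply/eqP/matrixP => a b.
  by rewrite tE t // subrr !mxE.
Qed.

End connections.

Lemma mx_addE (V : nmodType) p q (A B : 'M[V]_(p, q)) i j : (A + B) i j = A i j + B i j.
Proof. by rewrite mxE. Qed.

Lemma mx_oppE (V : zmodType) p q (A : 'M[V]_(p, q)) i j : (- A) i j = - A i j.
Proof. by rewrite mxE. Qed.

Ltac mx_abel :=
  apply/matrixP => ? ?; rewrite !(mx_addE, mx_oppE);
  repeat match goal with
  | |- context [fun_of_matrix ?A ?i ?j] =>
      let x := fresh in set x := (fun_of_matrix A i j); clearbody x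
  end; ring.

(** The derivatives of [K] coming from [K^T g K] cancel those in the inhomogeneous part of the
    transformed connection. *)
Lemma gauge_metric_identity (F : comNzRingType) n (K dK g dg H : 'M[F]_n) : g^T = g ->
  dK^T *m g *m K + K^T *m dg *m K + K^T *m g *m dK
  - ((K^T *m (g *m H) *m K + K^T *m g *m dK)
     + (K^T *m (g *m H) *m K + K^T *m g *m dK)^T)
  = K^T *m (dg - (g *m H + (g *m H)^T)) *m K.
Proof.
move=> gs; rewrite [(_ + _)^T]linearD /= !trmx_mul trmxK gs.
rewrite mulmxBr mulmxBl mulmxDr mulmxDl !mulmxA.
mx_abel.
Qed.

Lemma gauge_curvature_identity (F : comNzRingType) n (L K p1 p2 r1 r2 s q t : 'M[F]_n) :
  L *m (p1 *m K + q + s + r1 *m K + t) - L *m (p2 *m K + t + s + r2 *m K + q)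
  = L *m (p1 + r1 - (p2 + r2)) *m K.
Proof.
rewrite -mulmxBr -mulmxA; congr (_ *m _); rewrite mulmxBl !mulmxDl; mx_abel.
Qed.

Lemma mulmx1_invmx (F : fieldType) n (A B : 'M[F]_n) : A *m B = 1%:M -> invmx A = B.
Proof.
by move=> AB; have [uA _] := mulmx1_unit AB; rewrite -[RHS](mulKmx uA) AB mulmx1.
Qed.

Section gauge.
Variables (R : realType) (U : set 'rV[R]_4).
Hypothesis oU : open U.
Local Notation C := R[i].
Variables (th : 'rV[R]_4 -> 'M[C]_4) (G : 'rV[R]_4 -> 'M[C]_4).
Variables (A : 'rV[R]_4 -> 'rV[C]_4) (Ga : 'I_4 -> 'I_4 -> 'rV[R]_4 -> 'rV[C]_4).
Variables (L K : 'rV[R]_4 -> 'M[C]_4).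
Hypotheses (sth : csmooth_mx U th) (sG : csmooth_mx U G).
Hypothesis symG : forall x, U x -> (G x)^T = G x.
Hypotheses (uth : forall x, U x -> th x \in unitmx).
Hypotheses (sL : csmooth_mx U L) (sK : csmooth_mx U K).
Hypothesis LK : forall x, U x -> L x *m K x = 1%:M.
Hypothesis conn : weyl_connection U th G A Ga.
Implicit Types (x : 'rV[R]_4) (a b : 'I_4).

Let th' x := L x *m th x.

Definition gauge_connection (i j : 'I_4) x : 'rV[C]_4 :=
  \row_a (L x *m (conn_mx Ga a x *m K x + mxpartial a K x)) i j.
Let Ga' := gauge_connection.

Let KL x : U x -> K x *m L x = 1%:M.
Proof. by move=> Ux; exact/mulmx1C/LK. Qed.

Let conn'E a x : conn_mx Ga' a x = L x *m (conn_mx Ga a x *m K x + mxpartial a K x).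
Proof. by apply/matrixP => i j; rewrite !mxE. Qed.

Let dKL a x : U x -> mxpartial a L x *m K x + L x *m mxpartial a K x = 0.
Proof.
move=> Ux; rewrite -(mxpartialM oU) // -(mxpartial_cst a (1%:M : 'M[C]_4) x).
exact: (mxpartial_ext oU).
Qed.

Let LdKL a x : U x -> L x *m mxpartial a K x *m L x = - mxpartial a L x.
Proof.
move=> Ux; have /eqP := dKL a Ux; rewrite addrC addr_eq0 => /eqP ->.
by rewrite mulNmx -mulmxA KL // mulmx1.
Qed.

Let sconn a : csmooth_mx U (conn_mx Ga a).
Proof. by have [] := (weyl_connectionP oU th G A Ga).1 conn. Qed.

Lemma gauge_gframe x : U x ->
  gframe th' G x = (K x)^T *m gframe th G x *m K x.
Proof.
move=> Ux; rewrite /gframe /frame_components.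
have -> : invmx (th' x) = invmx (th x) *m K x.
  apply: mulmx1_invmx; rewrite /th' mulmxA -(mulmxA (L x)) mulmxV ?uth //.
  by rewrite mulmx1 LK.
by rewrite trmx_mul !mulmxA.
Qed.

Let sg : csmooth_mx U (gframe th G).
Proof.
have sV : csmooth_mx U (fun x => invmx (th x)) by exact: csmooth_inv.
by apply: csmooth_mxM => //; apply: csmooth_mxM => //; exact: csmooth_tr.
Qed.

Let X a x : 'M[C]_4 := conn_mx Ga a x *m K x + mxpartial a K x.

Let sX a : csmooth_mx U (X a).
Proof.
by apply: csmooth_mxD => //; [exact: csmooth_mxM|exact: csmooth_mxpartial].
Qed.

(** The metric equation is multiplied by [K^T] and [K]. In the torsion equation the term with the
    derivative of [L] cancels against [L dK L], which is [- dL] because [L K = 1]. *)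
Lemma gauge_weyl_connection : weyl_connection U th' G A Ga'.
Proof.
have [s m t] := (weyl_connectionP oU th G A Ga).1 conn.
apply/(weyl_connectionP oU); split.
- move=> a; apply: (@csmooth_mx_ext _ _ _ oU _ _ (fun x => L x *m X a x)).
    by move=> x _; rewrite conn'E.
  exact: csmooth_mxM.
- move=> x a Ux; rewrite gauge_gframe // conn'E.
  have -> : mxpartial a (gframe th' G) x =
      (mxpartial a K x)^T *m gframe th G x *m K x
      + (K x)^T *m mxpartial a (gframe th G) x *m K x
      + (K x)^T *m gframe th G x *m mxpartial a K x.
    rewrite (mxpartial_ext oU a (G := fun y => (K y)^T *m gframe th G y *m K y)) //;
      last by move=> y Uy; rewrite gauge_gframe.
    have sKT : csmooth_mx U (fun y => (K y)^T) by exact: csmooth_tr.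
    have sKg : csmooth_mx U (fun y => (K y)^T *m gframe th G y) by exact: csmooth_mxM.
    by rewrite (mxpartialM oU) // (mxpartialM oU) // mxpartial_tr mulmxDl.
  have -> : (K x)^T *m gframe th G x *m K x *m (L x *m (conn_mx Ga a x *m K x + mxpartial a K x))
     = (K x)^T *m (gframe th G x *m conn_mx Ga a x) *m K x
       + (K x)^T *m gframe th G x *m mxpartial a K x.
    rewrite mulmxA -(mulmxA _ (K x) (L x)) KL // mulmx1 mulmxDr.
    by rewrite !mulmxA.
  have gs : (gframe th G x)^T = gframe th G x.
    by rewrite /gframe /frame_components !trmx_mul trmxK symG // mulmxA.
  rewrite gauge_metric_identity // m //.
  by rewrite -scalemxAr -scalemxAl.
- move=> x a b Ux.
  have E c d : mxpartial c (fun y => col d (th' y)) x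
       + conn_mx Ga' c x *m col d (th' x)
     = L x *m (mxpartial c (fun y => col d (th y)) x + conn_mx Ga c x *m col d (th x)).
    have colE y : col d (th' y) = L y *m col d (th y) by rewrite /th' !colE mulmxA.
    rewrite (_ : (fun y => col d (th' y)) = fun y => L y *m col d (th y)); last exact/funext.
    have sc : csmooth_mx U (fun y => col d (th y)).
      by move=> i j; apply: csmooth_ext (sth i d) => // y _; rewrite mxE.
    rewrite (mxpartialM oU) // conn'E colE mulmxDr [in RHS]mulmxDr.
    rewrite mulmxDl [L x *m (_ *m K x)]mulmxA -(mulmxA _ (K x)) (mulmxA (K x)) KL // mul1mx.
    rewrite -(mulmxA _ _ (col d (th x))); rewrite mulmxA -(mulmxA (L x)).
    rewrite [L x *m mxpartial c K x *m _]mulmxA LdKL // mulNmx.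
    mx_abel.
  exact: (etrans (E a b) (etrans (congr1 (mulmx (L x)) (t x a b Ux)) (esym (E b a)))).
Qed.

(** After the derivatives of [L] are eliminated through [LdKL], the remaining inhomogeneous terms
    are symmetric in the two coordinate indices, the second derivatives of [K] by Schwarz, and
    disappear in the antisymmetrization. *)
Lemma gauge_curvature x a b : U x ->
  curv_mx Ga' a b x = L x *m curv_mx Ga a b x *m K x.
Proof.
move=> Ux.
have E c d : mxpartial c (conn_mx Ga' d) x + conn_mx Ga' c x *m conn_mx Ga' d x
  = L x *m (mxpartial c (conn_mx Ga d) x *m K x
            + conn_mx Ga d x *m mxpartial c K x
            + mxpartial c (mxpartial d K) x
            + conn_mx Ga c x *m conn_mx Ga d x *m K x
            + conn_mx Ga c x *m mxpartial d K x).
  have -> : mxpartial c (conn_mx Ga' d) x = mxpartial c (fun y => L y *m X d y) x.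
    by congr (mxpartial _ _ x); apply: funext => y; rewrite conn'E.
  have sGK : csmooth_mx U (fun y => conn_mx Ga d y *m K y) by exact: csmooth_mxM.
  have sdK : csmooth_mx U (mxpartial d K) by exact: csmooth_mxpartial.
  rewrite (mxpartialM oU) // (mxpartialD (U := U)) // (mxpartialM oU) // !conn'E.
  rewrite -[conn_mx Ga d x *m K x + _]/(X d x).
  have -> : L x *m (conn_mx Ga c x *m K x + mxpartial c K x) *m (L x *m X d x)
     = L x *m (conn_mx Ga c x *m X d x) - mxpartial c L x *m X d x.
    rewrite mulmxA mulmxDr mulmxDl LdKL // mulmxBl; congr (_ - _).
    by rewrite -!mulmxA (mulmxA (K x)) KL // mul1mx.
  rewrite addrC addrA subrK -mulmxDr; congr (_ *m _).
  rewrite /X mulmxDr mulmxA.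
  move: (mxpartial c (mxpartial d K) x) (mxpartial c (conn_mx Ga d) x) => u v.
  by move: (_ *m _) (_ *m _) (_ *m _) (_ *m _) => p q r s; mx_abel.
rewrite /curv_mx (E a b) (E b a) (mxpartialC oU b a sK Ux).
exact: gauge_curvature_identity.
Qed.

End gauge.

Section linear_combinations.
Variable F : comNzRingType.
Implicit Types a b c d x y : F.

Lemma lcD a b c d : a = b -> c = d -> a + c = b + d.
Proof. by move=> -> ->. Qed.

Lemma lcZ k a b : a = b -> k * a = k * b.
Proof. by move=> ->. Qed.

(** With [lcD] and [lcZ], a goal is deduced from an explicit linear combination of hypotheses, and
    only an identity for [ring] or [field] remains. All numerical coefficients in the curvature
    computations below are such certificates. *)
Lemma lcP a b x y : a = b -> x - y = a - b -> x = y.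
Proof. by move=> ->; rewrite subrr => /subr0_eq. Qed.

End linear_combinations.

(** The letters stand for the four kinds of terms, with the coordinate indices in the order in which
    they appear: [u] for second derivatives of th, [p] for (dGa) th, [q] for Ga (dth), [r] for Ga Ga
    th. The hypotheses are the differentiated torsion equation, the symmetry of second derivatives,
    and the torsion equation multiplied by Ga. *)
Lemma bianchi_identity (F : comNzRingType) m n
    (ucab uabc ubca ucba uacb ubac pcab pabc pbca pcba pacb pbac
     qcab qabc qbca qcba qacb qbac rcab rabc rbca rcba racb rbac : 'M[F]_(m, n)) :
  ucab + (pcab + qacb) = ucba + (pcba + qbca) ->
  uabc + (pabc + qbac) = uacb + (pacb + qcab) ->
  ubca + (pbca + qcba) = ubac + (pbac + qabc) ->
  ucab = uacb -> uabc = ubac -> ubca = ucba ->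
  qcab + rcab = qcba + rcba -> qabc + rabc = qacb + racb ->
  qbca + rbca = qbac + rbac ->
  (pabc + rabc - (pbac + rbac)) + (pbca + rbca - (pcba + rcba))
  + (pcab + rcab - (pacb + racb)) = 0.
Proof.
move=> + + + s1 s2 s3; rewrite s1 s2 s3.
move=> /matrixP h1 /matrixP h2 /matrixP h3 /matrixP h4 /matrixP h5 /matrixP h6.
apply/matrixP => i j.
move: {h1 h2 h3 h4 h5 h6} (h1 i j) (h2 i j) (h3 i j) (h4 i j) (h5 i j) (h6 i j).
rewrite !mxE => h1 h2 h3 h4 h5 h6.
by apply: (lcP (lcD h1 (lcD h2 (lcD h3 (lcD h4 (lcD h5 h6)))))); ring.
Qed.

Lemma sum3_rot (V : nmodType) (I : finType) (F : I -> I -> I -> V) :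
  \sum_a \sum_b \sum_c F a b c = \sum_a \sum_b \sum_c F b c a.
Proof.
rewrite [RHS]exchange_big; apply: eq_bigr => a _; exact: exchange_big.
Qed.

(** The matrices satisfying such a condition form the Lie algebra of infinitesimal similarities of
    [g]; it is an extension of the orthogonal one by scalars, so its commutators are orthogonal. *)
Lemma commutator_gram_sym (F : comNzRingType) n (g H1 H2 : 'M[F]_n) a1 a2 : g^T = g ->
  g *m H1 + (g *m H1)^T = a1 *: g -> g *m H2 + (g *m H2)^T = a2 *: g ->
  g *m (H1 *m H2 - H2 *m H1) + (g *m (H1 *m H2 - H2 *m H1))^T = 0.
Proof.
move=> gs; rewrite !trmx_mul gs => e1 e2.
have f H a : g *m H + H^T *m g = a *: g -> H^T *m g = a *: g - g *m H.
  by move=> <-; rewrite addrAC subrr add0r.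
have h H a : g *m H + H^T *m g = a *: g -> g *m H = a *: g - H^T *m g.
  by move=> <-; rewrite addrK.
have I1 : g *m H1 *m H2 = a1 *: (g *m H2) - H1^T *m g *m H2.
  by rewrite {1}(h _ _ e1) mulmxBl -scalemxAl.
have I2 : g *m H2 *m H1 = a2 *: (g *m H1) - H2^T *m g *m H1.
  by rewrite {1}(h _ _ e2) mulmxBl -scalemxAl.
have I3 : H2^T *m (H1^T *m g) = a1 *: (H2^T *m g) - H2^T *m g *m H1.
  by rewrite (f _ _ e1) mulmxBr -scalemxAr mulmxA.
have I4 : H1^T *m (H2^T *m g) = a2 *: (H1^T *m g) - H1^T *m g *m H2.
  by rewrite (f _ _ e2) mulmxBr -scalemxAr mulmxA.
rewrite [(H1 *m H2 - _)^T]linearB /= !trmx_mul mulmxBr mulmxBl -!mulmxA I3 I4 !mulmxA I1 I2.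
have e12 : a2 *: (a1 *: g) = a1 *: (a2 *: g) by rewrite !scalerA mulrC.
rewrite -{1}e1 -e2 !scalerDr in e12.
move: e12; move: (_ *m g *m _) (_ *m g *m _) => X Y e12.
apply/matrixP => i j; have := congr1 (fun B : 'M[F]_n => B i j) e12.
rewrite !(mx_addE, mx_oppE) => e; rewrite [RHS]mxE.
by apply: (lcP (lcZ (-1) e)); ring.
Qed.

Lemma curv_mul_expand (F : comNzRingType) n k (p q r s : 'M[F]_n) (v : 'M[F]_(n, k)) :
  (p + q *m r - (s + r *m q)) *m v
  = (p *m v + q *m (r *m v)) - (s *m v + r *m (q *m v)).
Proof. by rewrite mulmxBl !mulmxDl -!mulmxA. Qed.

(** * First Bianchi identity and curvature in a frame *)

Section frame_curvature.
Variables (R : realType) (U : set 'rV[R]_4).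
Hypothesis oU : open U.
Local Notation C := R[i].
Variables (th : 'rV[R]_4 -> 'M[C]_4) (G : 'rV[R]_4 -> 'M[C]_4).
Variables (A : 'rV[R]_4 -> 'rV[C]_4) (Ga : 'I_4 -> 'I_4 -> 'rV[R]_4 -> 'rV[C]_4).
Hypotheses (sth : csmooth_mx U th) (uth : forall x, U x -> th x \in unitmx).
Hypothesis sA : csmooth_mx U A.
Hypothesis conn : weyl_connection U th G A Ga.
Implicit Types (x : 'rV[R]_4) (a b c i j k l : 'I_4).

Let sconn a : csmooth_mx U (conn_mx Ga a).
Proof. by have [] := (weyl_connectionP oU th G A Ga).1 conn. Qed.

(** The exterior derivative of d th = - Ga /\ th, in which d th is replaced once more by the same
    equation. *)
Lemma bianchi_coords a b c x : U x ->
  curv_mx Ga a b x *m col c (th x) + curv_mx Ga b c x *m col a (th x)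
  + curv_mx Ga c a x *m col b (th x) = 0.
Proof.
move=> Ux; have [_ _ t] := (weyl_connectionP oU th G A Ga).1 conn.
have sc d : csmooth_mx U (fun y => col d (th y)).
  by move=> i j; apply: csmooth_ext (sth i d) => // y _; rewrite mxE.
have D d e f :
    mxpartial d (mxpartial e (fun y => col f (th y))) x
    + (mxpartial d (conn_mx Ga e) x *m col f (th x)
       + conn_mx Ga e x *m mxpartial d (fun y => col f (th y)) x)
  = mxpartial d (mxpartial f (fun y => col e (th y))) x
    + (mxpartial d (conn_mx Ga f) x *m col e (th x)
       + conn_mx Ga f x *m mxpartial d (fun y => col e (th y)) x).
  have E g h : mxpartial d (fun y => mxpartial g (fun y => col h (th y)) y
         + conn_mx Ga g y *m col h (th y)) x =
     mxpartial d (mxpartial g (fun y => col h (th y))) x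
     + (mxpartial d (conn_mx Ga g) x *m col h (th x)
       + conn_mx Ga g x *m mxpartial d (fun y => col h (th y)) x).
    rewrite (mxpartialD (U := U)) //; first by rewrite (mxpartialM oU).
      exact: csmooth_mxpartial.
    exact: csmooth_mxM.
  apply: (etrans (esym (E e f))); apply: (etrans _ (E f e)).
  by apply: (mxpartial_ext oU) => // y Uy; exact: t.
have Dab := D c a b; have Dbc := D a b c; have Dca := D b c a.
have Tab := congr1 (mulmx (conn_mx Ga c x)) (t x a b Ux).
have Tbc := congr1 (mulmx (conn_mx Ga a x)) (t x b c Ux).
have Tca := congr1 (mulmx (conn_mx Ga b x)) (t x c a Ux).
rewrite !mulmxDr in Tab Tbc Tca.
have E d e f : curv_mx Ga d e x *m col f (th x) =
   (mxpartial d (conn_mx Ga e) x *m col f (th x)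
     + conn_mx Ga d x *m (conn_mx Ga e x *m col f (th x)))
   - (mxpartial e (conn_mx Ga d) x *m col f (th x)
     + conn_mx Ga e x *m (conn_mx Ga d x *m col f (th x))).
  exact: curv_mul_expand.
apply: (etrans (congr2 +%R (congr2 +%R (E a b c) (E b c a)) (E c a b))).
exact: (bianchi_identity Dab Dbc Dca (mxpartialC oU c a (sc b) Ux)
  (mxpartialC oU a b (sc c) Ux) (mxpartialC oU b c (sc a) Ux) Tab Tbc Tca).
Qed.

Definition frame_curv i j x (k l : 'I_4) : C :=
  frame_components (th x) (curvature_form Ga i j x) k l.

Lemma frame_componentsE (t B : 'M[C]_4) k l :
  frame_components t B k l
  = \sum_a \sum_b invmx t a k * invmx t b l * B a b.
Proof.
rewrite /frame_components !mxE exchange_big /=; apply: eq_bigr => b _.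
rewrite !mxE big_distrl /=; apply: eq_bigr => a _.
by rewrite !mxE mulrAC.
Qed.

Lemma frame_curvE i j x k l :
  frame_curv i j x k l = \sum_a \sum_b
    invmx (th x) a k * invmx (th x) b l * curv_mx Ga a b x i j.
Proof.
rewrite /frame_curv frame_componentsE; apply: eq_bigr => a _; apply: eq_bigr => b _.
by rewrite curvature_formE.
Qed.

Lemma curv_mx_alt a b x : curv_mx Ga a b x = - curv_mx Ga b a x.
Proof. by rewrite /curv_mx opprB. Qed.

Lemma frame_curv_alt i j x k l : frame_curv i j x k l = - frame_curv i j x l k.
Proof.
rewrite !frame_curvE exchange_big /= -sumrN; apply: eq_bigr => b _.
rewrite -sumrN; apply: eq_bigr => a _.
by rewrite (curv_mx_alt a b) mx_oppE; ring.
Qed.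

Lemma frame_contract i k l m x : U x ->
  \sum_a \sum_b \sum_c invmx (th x) a k * invmx (th x) b l * invmx (th x) c m
     * (curv_mx Ga a b x *m col c (th x)) i 0 = frame_curv i m x k l.
Proof.
move=> Ux; rewrite frame_curvE; apply: eq_bigr => a _; apply: eq_bigr => b _.
have -> : curv_mx Ga a b x i m = (curv_mx Ga a b x *m (th x *m invmx (th x))) i m.
  by rewrite mulmxV ?mulmx1 //; exact: uth.
rewrite mulmxA [in RHS]mxE mulr_sumr; apply: eq_bigr => c _.
rewrite -!mulrA; congr (_ * (_ * _)); rewrite mulrC; congr (_ * _).
by rewrite !mxE; apply: eq_bigr => d _; rewrite !mxE.
Qed.

Lemma frame_bianchi i j k l x : U x ->
  frame_curv i j x k l + frame_curv i k x l j + frame_curv i l x j k = 0.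
Proof.
move=> Ux; rewrite -!frame_contract //; set e := invmx (th x).
set u := fun a b c => (curv_mx Ga a b x *m col c (th x)) i 0.
have -> : \sum_a \sum_b \sum_c e a l * e b j * e c k * u a b c
     = \sum_a \sum_b \sum_c e a k * e b l * e c j * u b c a.
  apply: (etrans (sum3_rot (fun a b c => e a l * e b j * e c k * u a b c))).
  by do 3!(apply: eq_bigr => ? _); congr (_ * _); rewrite mulrC mulrA.
have -> : \sum_a \sum_b \sum_c e a j * e b k * e c l * u a b c
     = \sum_a \sum_b \sum_c e a k * e b l * e c j * u c a b.
  apply: (etrans (sum3_rot (fun a b c => e a j * e b k * e c l * u a b c))).
  apply: (etrans (sum3_rot (fun a b c => e b j * e c k * e a l * u b c a))).
  by do 3!(apply: eq_bigr => ? _); congr (_ * _); rewrite -mulrA mulrC.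
rewrite -!big_split /= big1 // => a _; rewrite -!big_split /= big1 // => b _.
rewrite -!big_split /= big1 // => c _; rewrite -!mulrDr /u.
have := congr1 (fun B : 'cV[C]_4 => B i 0) (bianchi_coords a b c Ux).
by rewrite !mx_addE [X in _ = X]mxE => ->; rewrite mulr0.
Qed.

(** For a constant Gram matrix the metric equation reads [g0 Ga + (g0 Ga)^T = A g0]. Differentiating
    it yields dA, while the quadratic part of the curvature is a commutator and contributes nothing
    to the symmetric part. *)
Lemma constant_frame_curvature g0 a b x : g0^T = g0 ->
  (forall y, U y -> gframe th G y = g0) -> U x ->
  g0 *m curv_mx Ga a b x + (g0 *m curv_mx Ga a b x)^T
  = (mxpartial a A x 0 b - mxpartial b A x 0 a) *: g0.
Proof.
move=> gs gc Ux; have [_ m _] := (weyl_connectionP oU th G A Ga).1 conn.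
have mc c y : U y -> g0 *m conn_mx Ga c y + (g0 *m conn_mx Ga c y)^T = A y 0 c *: g0.
  move=> Uy; have := m y c Uy; rewrite (gc y Uy).
  rewrite (mxpartial_ext oU c (G := fun=> g0)) // mxpartial_cst sub0r.
  by rewrite scaleNr => /oppr_inj.
have dm c d : g0 *m mxpartial c (conn_mx Ga d) x
     + (g0 *m mxpartial c (conn_mx Ga d) x)^T = mxpartial c A x 0 d *: g0.
  have sg : csmooth_mx U (fun=> g0) by exact: csmooth_mx_cst.
  have sgG : csmooth_mx U (fun y => g0 *m conn_mx Ga d y) by exact: csmooth_mxM.
  have D : mxpartial c (fun y => g0 *m conn_mx Ga d y) x
      = g0 *m mxpartial c (conn_mx Ga d) x.
    by rewrite (mxpartialM oU) // mxpartial_cst mul0mx add0r.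
  rewrite -D -mxpartial_tr -(mxpartialD (U := U)) //; last exact: csmooth_tr.
  rewrite (mxpartial_ext oU c (G := fun y => A y 0 d *: g0)) // => [|y Uy]; last exact: mc.
  rewrite (mxpartialZ oU c (sA 0 d) sg Ux).
  by rewrite mxpartial_cst scaler0 addr0 mxE.
have := commutator_gram_sym gs (mc a x Ux) (mc b x Ux).
move: (dm a b) (dm b a); rewrite /curv_mx.
move: (mxpartial a (conn_mx Ga b) x) (mxpartial b (conn_mx Ga a) x) => p q.
move: (conn_mx Ga a x *m conn_mx Ga b x) (conn_mx Ga b x *m conn_mx Ga a x) => r s.
rewrite scalerBl => <- <- E; rewrite -[RHS]addr0 -E.
rewrite !mulmxBr !mulmxDr ![(_ - _)^T]linearB /= ![(_ + _)^T]linearD /=.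
mx_abel.
Qed.

End frame_curvature.

(** * Ricci tensor and change of coframe *)

Section ricci.
Variables (R : realType).
Local Notation C := R[i].
Implicit Types (th G : 'rV[R]_4 -> 'M[C]_4).
Implicit Types (Ga : 'I_4 -> 'I_4 -> 'rV[R]_4 -> 'rV[C]_4).
Implicit Types (x : 'rV[R]_4) (a b c i j k l : 'I_4).

(** The contraction R^k_{jkl}, written with sums over coordinate indices so that a change of coframe
    visibly acts on it by congruence. *)
Definition ricci_mx th Ga x : 'M[C]_4 :=
  \sum_a \sum_b (row a (invmx (th x)) *m curv_mx Ga a b x)^T *m row b (invmx (th x)).

Definition tracefree_part (g B : 'M[C]_4) : 'M[C]_4 :=
  2^-1 *: (B + B^T) - (4^-1 * \tr ((invmx g)^T *m B)) *: g.

Lemma ricci_trace th G Ga x j l :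
  (gframe th G x)^T = gframe th G x -> gframe th G x \in unitmx ->
  ricci th G Ga x j l = \sum_k frame_curv th Ga k j x k l.
Proof.
set g := gframe th G x => gs gu.
have E : ricci th G Ga x j l =
    \sum_k \sum_h ((invmx g)^T *m g) k h * frame_curv th Ga h j x k l.
  rewrite /ricci exchange_big /=; apply: eq_bigr => k _.
  under eq_bigr do rewrite /riemann mulr_sumr.
  rewrite exchange_big /=; apply: eq_bigr => h _.
  rewrite [X in _ = X * _]mxE mulr_suml; apply: eq_bigr => i _.
  by rewrite [_^T k i]mxE mulrA.
rewrite E trmx_inv gs mulVmx //; apply: eq_bigr => k _.
rewrite (bigD1 k) //= big1 ?addr0 => [|h hk]; first by rewrite mxE eqxx mul1r.
by rewrite mxE eq_sym (negPf hk) mul0r.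
Qed.

Lemma ricciE th G Ga x j l :
  (gframe th G x)^T = gframe th G x -> gframe th G x \in unitmx ->
  ricci th G Ga x j l = ricci_mx th Ga x j l.
Proof.
move=> gs gu; rewrite ricci_trace // /ricci_mx summxE.
under eq_bigr do rewrite frame_curvE.
rewrite exchange_big /=; apply: eq_bigr => a _; rewrite exchange_big /= summxE.
apply: eq_bigr => b _; move: (invmx (th x)) (curv_mx Ga a b x) => e B.
have -> : ((row a e *m B)^T *m row b e) j l = (row a e *m B) 0 j * e b l.
  by rewrite mxE big_ord1 mxE [row b e _ _]mxE.
rewrite [(row a e *m B) 0 j]mxE mulr_suml.
by apply: eq_bigr => k _; rewrite [row a e _ _]mxE mulrAC.
Qed.

Lemma tracefree_ricciE th G Ga x i j :
  (gframe th G x)^T = gframe th G x -> gframe th G x \in unitmx ->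
  tracefree_ricci th G Ga x i j
  = tracefree_part (gframe th G x) (ricci_mx th Ga x) i j.
Proof.
move=> gs gu; rewrite /tracefree_ricci /tracefree_part !ricciE //.
have -> : scalar_curvature th G Ga x
    = \tr ((invmx (gframe th G x))^T *m ricci_mx th Ga x).
  rewrite /scalar_curvature /mxtrace exchange_big /=; apply: eq_bigr => l _.
  by rewrite mxE; apply: eq_bigr => k _; rewrite ricciE // mxE.
rewrite mx_addE mx_oppE; congr (_ - _); last by rewrite [RHS]mxE.
by rewrite [RHS]mxE mx_addE [_^T i j]mxE mulrC.
Qed.

Lemma tracefree_part_congr (g B K : 'M[C]_4) : K \in unitmx -> g \in unitmx ->
  tracefree_part (K^T *m g *m K) (K^T *m B *m K) = K^T *m tracefree_part g B *m K.
Proof.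
move=> uK ug; rewrite /tracefree_part.
have -> : \tr ((invmx (K^T *m g *m K))^T *m (K^T *m B *m K)) = \tr ((invmx g)^T *m B).
  have -> : invmx (K^T *m g *m K) = invmx K *m invmx g *m (invmx K)^T.
    apply: mulmx1_invmx; rewrite trmx_inv !mulmxA mulmxK // mulmxK //.
    by rewrite mulmxV // unitmx_tr.
  rewrite !trmx_mul trmxK !mulmxA mxtrace_mulC.
  rewrite !mulmxA mulmxV // mul1mx -!mulmxA (mulmxA _^T K^T).
  by rewrite -trmx_mul mulmxV // trmx1 mul1mx.
rewrite mulmxBr mulmxBl -!scalemxAr -!scalemxAl; congr (_ *: _ - _).
by rewrite mulmxDr mulmxDl !trmx_mul trmxK mulmxA.
Qed.

End ricci.

Section gauge_ricci.
Variables (R : realType) (U : set 'rV[R]_4).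
Hypothesis oU : open U.
Local Notation C := R[i].
Variables (th : 'rV[R]_4 -> 'M[C]_4) (G : 'rV[R]_4 -> 'M[C]_4).
Variables (A : 'rV[R]_4 -> 'rV[C]_4) (Ga : 'I_4 -> 'I_4 -> 'rV[R]_4 -> 'rV[C]_4).
Variables (L K : 'rV[R]_4 -> 'M[C]_4).
Hypotheses (sth : csmooth_mx U th) (sG : csmooth_mx U G).
Hypothesis symG : forall x, U x -> (G x)^T = G x.
Hypothesis uG : forall x, U x -> G x \in unitmx.
Hypothesis uth : forall x, U x -> th x \in unitmx.
Hypotheses (sL : csmooth_mx U L) (sK : csmooth_mx U K).
Hypothesis LK : forall x, U x -> L x *m K x = 1%:M.
Hypothesis conn : weyl_connection U th G A Ga.

Lemma gauge_tracefree_ricci x : U x ->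
  (forall i j, tracefree_ricci (fun y => L y *m th y) G
                 (gauge_connection Ga L K) x i j = 0) ->
  forall i j, tracefree_ricci th G Ga x i j = 0.
Proof.
move=> Ux; set th' := fun y => _; set Ga' := gauge_connection Ga L K => S0.
have [uL uK] := mulmx1_unit (LK Ux).
have gs t : (gframe t G x)^T = gframe t G x.
  by rewrite /gframe /frame_components !trmx_mul trmxK symG // mulmxA.
have gu t : t x \in unitmx -> gframe t G x \in unitmx.
  by move=> ut; rewrite /gframe /frame_components !unitmx_mul unitmx_tr unitmx_inv ut uG.
have uth' : th' x \in unitmx by rewrite unitmx_mul uL uth.
have gE : gframe th' G x = (K x)^T *m gframe th G x *m K x.
  exact: (gauge_gframe G uth LK Ux).
have iE : invmx (th' x) = invmx (th x) *m K x.
  apply: mulmx1_invmx; rewrite /th' mulmxA -(mulmxA (L x)) mulmxV ?uth //.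
  by rewrite mulmx1 LK.
have rE : ricci_mx th' Ga' x = (K x)^T *m ricci_mx th Ga x *m K x.
  rewrite /ricci_mx mulmx_sumr mulmx_suml; apply: eq_bigr => a _.
  rewrite mulmx_sumr mulmx_suml; apply: eq_bigr => b _.
  have -> : curv_mx Ga' a b x = L x *m curv_mx Ga a b x *m K x.
    exact: (gauge_curvature oU sL sK LK conn a b Ux).
  rewrite iE !row_mul; move: (row a _) (row b _) => u v.
  have -> : u *m K x *m (L x *m curv_mx Ga a b x *m K x) = u *m curv_mx Ga a b x *m K x.
    by rewrite -!mulmxA (mulmxA (K x)) (mulmx1C (LK Ux)) mul1mx.
  by move: (u *m _) (K x) => w k; rewrite trmx_mul !mulmxA.
have SE : (K x)^T *m tracefree_part (gframe th G x) (ricci_mx th Ga x) *m K x = 0.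
  rewrite -tracefree_part_congr //; last exact/gu/uth.
  rewrite -gE -rE; apply/matrixP => i j.
  by rewrite -tracefree_ricciE ?S0 ?mxE //; exact: gu.
have {}SE : tracefree_part (gframe th G x) (ricci_mx th Ga x) = 0.
  move: SE => /(congr1 (fun B => (L x)^T *m B *m L x)).
  rewrite mulmx0 mul0mx => <-; rewrite !mulmxA -trmx_mul (mulmx1C (LK Ux)).
  by rewrite trmx1 mul1mx -mulmxA (mulmx1C (LK Ux)) mulmx1.
by move=> i j; rewrite tracefree_ricciE // ?SE ?mxE //; exact/gu/uth.
Qed.

End gauge_ricci.

(** * Curvature in a null coframe *)

Section null_frame_algebra.
Variables (R : realType).
Local Notation C := R[i].
Local Notation g0 := (@null_gram R).
Implicit Types (r : 'I_4 -> 'I_4 -> 'I_4 -> 'I_4 -> C) (f B : 'I_4 -> 'I_4 -> C).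

(* The value of the 2-form [B] on the frame [(z m - k, z n - p)] of the
   self-dual plane with parameter [z]. *)
Definition on_sd_plane B z : C :=
  z ^+ 2 * B i1 i3 - z * B i1 i2 + z * B i3 i4 - B i2 i4.

(** The value of dE on the plane: in E the connection forms are replaced by the curvature forms
    [r i j], and dz is dropped. *)
Definition sd_curv_poly r z : C :=
  on_sd_plane (fun k l => - r i3 i2 k l + z * (r i1 i1 k l - r i4 i4 k l)
                          + z ^+ 2 * r i2 i3 k l) z.

(** The corresponding value of dE', still on the self-dual plane; hence it has degree at most 2 in
    each of [z] and [z']. *)
Definition asd_curv_poly r z z' : C :=
  on_sd_plane (fun k l => - r i3 i1 k l + z' * (r i2 i2 k l - r i4 i4 k l)
                          + z' ^+ 2 * r i1 i3 k l) z.

Definition null_ric r j l : C := \sum_k r k j k l.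

(** The matrix [4 *: g0] is the inverse of [g0]. *)
Definition null_scal r : C := \sum_i \sum_j 4 * g0 i j * null_ric r i j.

Definition null_tracefree_ric r i j : C :=
  (null_ric r i j + null_ric r j i) / 2 - 4^-1 * null_scal r * g0 i j.

Definition null_weyl r i j k l : C :=
  \sum_h g0 i h * r h j k l
  - 2^-1 * (g0 i k * null_ric r j l - g0 i l * null_ric r j k
            - g0 j k * null_ric r i l + g0 j l * null_ric r i k)
  + null_scal r / 6 * (g0 i k * g0 j l - g0 i l * g0 j k).

(** What the two criteria use of the curvature of a Weyl connection at a point, in a null cotetrad:
    [r i j k l] is R^i_{jkl}, and [f] holds the components of dA, which vanish in the Levi-Civita
    case. *)
Definition null_curvature r f : Prop :=
  [/\ forall i j k l, r i j k l = - r i j l k,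
      forall i j k l, r i j k l + r i k l j + r i l j k = 0
    & forall i j k l,
        \sum_h g0 i h * r h j k l + \sum_h g0 j h * r h i k l = f k l * g0 i j].

Lemma quadratic_coef0 (a b c : C) :
  (forall z, a + b * z + c * z ^+ 2 = 0) -> [/\ a = 0, b = 0 & c = 0].
Proof.
move=> H; have h0 := H 0; have h1 := H 1; have h2 := H (-1).
have a0 : a = 0 by apply: (lcP h0); ring.
have b0 : b = 0 by apply: (lcP (lcD (lcZ (2^-1) h1) (lcZ (- 2^-1) h2))); field.
by split=> //; move: h1; rewrite a0 b0; move=> h1; apply: (lcP h1); ring.
Qed.

(** Interpolation at 0, 1, -1, 2, -2. Sums and differences at opposite points separate the even from
    the odd coefficients, leaving two systems of size 2. *)
Lemma quartic_coef0 (a b c d e : C) :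
  (forall z, a + b * z + c * z ^+ 2 + d * z ^+ 3 + e * z ^+ 4 = 0) ->
  [/\ a = 0, b = 0, c = 0, d = 0 & e = 0].
Proof.
move=> H; have h0 := H 0; have h1 := H 1; have h2 := H (-1); have h3 := H 2; have h4 := H (-2).
have a0 : a = 0 by apply: (lcP h0); ring.
rewrite a0 {h0 a0} in h1 h2 h3 h4 *.
have b0 : b = 0.
  by apply: (lcP (lcD (lcZ (2 / 3) (lcD h1 (lcZ (-1) h2))) (lcZ (- 12^-1) (lcD h3 (lcZ (-1)
    h4))))); field.
have d0 : d = 0.
  by apply: (lcP (lcD (lcZ (- 6^-1) (lcD h1 (lcZ (-1) h2))) (lcZ (12^-1) (lcD h3 (lcZ (-1)
    h4))))); field.
have c0 : c = 0.
  by apply: (lcP (lcD (lcZ (2 / 3) (lcD h1 h2)) (lcZ (- 24^-1) (lcD h3 h4)))); field.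
have e0 : e = 0.
  by apply: (lcP (lcD (lcZ (- 6^-1) (lcD h1 h2)) (lcZ (24^-1) (lcD h3 h4)))); field.
by [].
Qed.

Variables (r : 'I_4 -> 'I_4 -> 'I_4 -> 'I_4 -> C) (f : 'I_4 -> 'I_4 -> C).
Hypothesis rP : null_curvature r f.

Let alt : forall i j k l, r i j k l = - r i j l k. Proof. by case: rP. Qed.
Let bia : forall i j k l, r i j k l + r i k l j + r i l j k = 0. Proof. by case: rP. Qed.

Let alt0 i j k : r i j k k = 0.
Proof. by apply: (lcP (lcZ (2^-1) (alt i j k k))); field. Qed.

Let g0E : ((((g0 i1 i1 = 0) * (g0 i1 i2 = 2^-1) * (g0 i1 i3 = 0) * (g0 i1 i4 = 0)) *
  ((g0 i2 i1 = 2^-1) * (g0 i2 i2 = 0) * (g0 i2 i3 = 0) * (g0 i2 i4 = 0))) *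
  (((g0 i3 i1 = 0) * (g0 i3 i2 = 0) * (g0 i3 i3 = 0) * (g0 i3 i4 = - 2^-1)) *
  ((g0 i4 i1 = 0) * (g0 i4 i2 = 0) * (g0 i4 i3 = - 2^-1) * (g0 i4 i4 = 0))))%type.
Proof. by do !split; rewrite mxE. Qed.

Let gram i j k l :
  g0 i i1 * r i1 j k l + g0 i i2 * r i2 j k l + g0 i i3 * r i3 j k l + g0 i i4 * r i4 j k l
  + (g0 j i1 * r i1 i k l + g0 j i2 * r i2 i k l + g0 j i3 * r i3 i k l + g0 j i4 * r i4 i k l)
  = f k l * g0 i j.
Proof. by case: rP => _ _ /(_ i j k l); rewrite !sum4. Qed.

(** The skew symmetry up to dA expresses the 16 curvature forms through seven, namely [f],
    [r i1 i1], [r i4 i4], [r i1 i3], [r i1 i4], [r i2 i3], [r i2 i4]. As rewriting rules these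
    equations bring every expression to a normal form. *)
Let rE : (((forall k l, r i1 i2 k l = 0) * (forall k l, r i2 i1 k l = 0)
  * (forall k l, r i3 i4 k l = 0) * (forall k l, r i4 i3 k l = 0)) *
  ((forall k l, r i2 i2 k l = f k l - r i1 i1 k l)
  * (forall k l, r i3 i3 k l = f k l - r i4 i4 k l)) *
  ((forall k l, r i4 i1 k l = r i2 i3 k l) * (forall k l, r i3 i1 k l = r i2 i4 k l)
  * (forall k l, r i4 i2 k l = r i1 i3 k l) * (forall k l, r i3 i2 k l = r i1 i4 k l)))%type.
Proof.
do !split; move=> k l.
- by have := gram i2 i2 k l; rewrite !g0E => h; apply: (lcP h); field.
- by have := gram i1 i1 k l; rewrite !g0E => h; apply: (lcP h); field.
- by have := gram i4 i4 k l; rewrite !g0E => h; apply: (lcP (lcZ (-1) h)); field.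
- by have := gram i3 i3 k l; rewrite !g0E => h; apply: (lcP (lcZ (-1) h)); field.
- by have := gram i1 i2 k l; rewrite !g0E => h; apply: (lcP (lcZ 2 h)); field.
- by have := gram i3 i4 k l; rewrite !g0E => h; apply: (lcP (lcZ (-2) h)); field.
- by have := gram i1 i3 k l; rewrite !g0E => h; apply: (lcP (lcZ (-2) h)); field.
- by have := gram i1 i4 k l; rewrite !g0E => h; apply: (lcP (lcZ (-2) h)); field.
- by have := gram i2 i3 k l; rewrite !g0E => h; apply: (lcP (lcZ (-2) h)); field.
- by have := gram i2 i4 k l; rewrite !g0E => h; apply: (lcP (lcZ (-2) h)); field.
Qed.

Let fE k l : f k l = r i1 i1 k l + r i2 i2 k l.
Proof. by rewrite !rE; ring. Qed.

Let falt k l : f k l = - f l k.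
Proof. by rewrite !fE (alt i1 i1 k) (alt i2 i2 k); ring. Qed.

Let falt0 k : f k k = 0.
Proof. by rewrite fE !alt0 addr0. Qed.

Let altE := (alt0, (fun i j => alt i j i2 i1), (fun i j => alt i j i3 i1), (fun i j => alt i j i4
  i1), (fun i j => alt i j i3 i2),
  (fun i j => alt i j i4 i2), (fun i j => alt i j i4 i3), falt0, falt i2 i1, falt i3 i1, falt i4
    i1,
  falt i3 i2, falt i4 i2, falt i4 i3).

Let atomE := (rE, altE).

(** In the names, the first digit is the upper index and the other three are the distinct lower
    ones; up to the skew symmetry in the last two indices, these 16 instances exhaust the content of
    the first Bianchi identity. *)
Let b1_123 := bia i1 i1 i2 i3.
Let b1_124 := bia i1 i1 i2 i4.
Let b1_134 := bia i1 i1 i3 i4.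
Let b1_234 := bia i1 i2 i3 i4.
Let b2_123 := bia i2 i1 i2 i3.
Let b2_124 := bia i2 i1 i2 i4.
Let b2_134 := bia i2 i1 i3 i4.
Let b2_234 := bia i2 i2 i3 i4.
Let b3_123 := bia i3 i1 i2 i3.
Let b3_124 := bia i3 i1 i2 i4.
Let b3_134 := bia i3 i1 i3 i4.
Let b3_234 := bia i3 i2 i3 i4.
Let b4_123 := bia i4 i1 i2 i3.
Let b4_124 := bia i4 i1 i2 i4.
Let b4_134 := bia i4 i1 i3 i4.
Let b4_234 := bia i4 i2 i3 i4.
Let ricE : (((null_ric r i1 i1 = (- r i2 i4 i1 i3 - r i2 i3 i1 i4)%R) * (null_ric r i1 i2 = (r i1
  i1 i1 i2 - r i2 i4 i2 i3 - r i2 i3 i2 i4)%R) * (null_ric r i1 i3 = (r i1 i1 i1 i3 - r i2 i3 i3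
  i4)%R) * (null_ric r i1 i4 = (r i1 i1 i1 i4 + r i2 i4 i3 i4)%R)) *
  ((null_ric r i2 i1 = (- f i1 i2 + r i1 i1 i1 i2 - r i1 i4 i1 i3 - r i1 i3 i1 i4)%R) * (null_ric
    r i2 i2 = (- r i1 i4 i2 i3 - r i1 i3 i2 i4)%R) * (null_ric r i2 i3 = (f i2 i3 - r i1 i1 i2 i3
    - r i1 i3 i3 i4)%R) * (null_ric r i2 i4 = (f i2 i4 - r i1 i1 i2 i4 + r i1 i4 i3 i4)%R)) *
  ((null_ric r i3 i1 = (- r i2 i3 i1 i2 - f i1 i3 + r i4 i4 i1 i3)%R) * (null_ric r i3 i2 = (r i1
    i3 i1 i2 - f i2 i3 + r i4 i4 i2 i3)%R) * (null_ric r i3 i3 = (r i1 i3 i1 i3 + r i2 i3 i2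
    i3)%R) * (null_ric r i3 i4 = (r i1 i3 i1 i4 + r i2 i3 i2 i4 + f i3 i4 - r i4 i4 i3 i4)%R)) *
  ((null_ric r i4 i1 = (- r i2 i4 i1 i2 - r i4 i4 i1 i4)%R) * (null_ric r i4 i2 = (r i1 i4 i1 i2
    - r i4 i4 i2 i4)%R) * (null_ric r i4 i3 = (r i1 i4 i1 i3 + r i2 i4 i2 i3 - r i4 i4 i3 i4)%R)
    * (null_ric r i4 i4 = (r i1 i4 i1 i4 + r i2 i4 i2 i4)%R)))%type.
Proof. by do !split; rewrite /null_ric sum4 !atomE; ring. Qed.

Let scalE : null_scal r = 4 * r i1 i1 i1 i2 - 4 * r i2 i4 i2 i3 - 4 * r i2 i3 i2 i4 - 2 * f i1 i2
  - 4 * r i1 i4 i1 i3 - 4 * r i1 i3 i1 i4 - 2 * f i3 i4 + 4 * r i4 i4 i3 i4.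
Proof. by rewrite /null_scal !sum4 !g0E !ricE; field. Qed.

(* In both criteria, every equation is a linear combination of the coefficients
   of the polynomial and of the first Bianchi identities. *)
Lemma null_tracefree_ricP :
  (forall i j, null_tracefree_ric r i j = 0) <->
  (forall z z', asd_curv_poly r z z' = 0).
Proof.
split=> [S0 z z'|Q0].
  have := S0 i1 i1; rewrite /null_tracefree_ric scalE !ricE !g0E => s11.
  have := S0 i1 i2; rewrite /null_tracefree_ric scalE !ricE !g0E => s12.
  have := S0 i1 i3; rewrite /null_tracefree_ric scalE !ricE !g0E => s13.
  have := S0 i1 i4; rewrite /null_tracefree_ric scalE !ricE !g0E => s14.
  have := S0 i2 i2; rewrite /null_tracefree_ric scalE !ricE !g0E => s22.
  have := S0 i2 i3; rewrite /null_tracefree_ric scalE !ricE !g0E => s23.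
  have := S0 i2 i4; rewrite /null_tracefree_ric scalE !ricE !g0E => s24.
  have := S0 i3 i3; rewrite /null_tracefree_ric scalE !ricE !g0E => s33.
  have := S0 i3 i4; rewrite /null_tracefree_ric scalE !ricE !g0E => s34.
  have := S0 i4 i4; rewrite /null_tracefree_ric scalE !ricE !g0E => s44.
  have := b1_123; rewrite !atomE => hb1_123.
  have := b1_124; rewrite !atomE => hb1_124.
  have := b1_134; rewrite !atomE => hb1_134.
  have := b1_234; rewrite !atomE => hb1_234.
  have := b2_123; rewrite !atomE => hb2_123.
  have := b2_124; rewrite !atomE => hb2_124.
  have := b2_134; rewrite !atomE => hb2_134.
  have := b2_234; rewrite !atomE => hb2_234.
  have := b3_123; rewrite !atomE => hb3_123.
  have := b3_124; rewrite !atomE => hb3_124.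
  have := b3_134; rewrite !atomE => hb3_134.
  have := b3_234; rewrite !atomE => hb3_234.
  have := b4_123; rewrite !atomE => hb4_123.
  have := b4_124; rewrite !atomE => hb4_124.
  have := b4_134; rewrite !atomE => hb4_134.
  have := b4_234; rewrite !atomE => hb4_234.
  (* [qij] is the coefficient of [z' ^+ i * z ^+ j] in [asd_curv_poly], [sij] comes from the
     component (i, j) of the tracefree Ricci tensor and the [hb] from Bianchi. The nine coefficients
     match the nine components of a tracefree symmetric tensor. *)
  have q00 : r i2 i4 i2 i4 = 0 by apply: (lcP (lcD (lcZ (2^-1) hb3_124) (lcZ (2^-1) s44))); field.
  have q01 : r i2 i4 i1 i2 - r i2 i4 i3 i4 = 0 by apply: (lcP (lcD (lcZ (- 2^-1) hb3_134) (lcD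
    (lcZ (2^-1) hb2_124) (lcZ (-1) s14)))); field.
  have q02 : - r i2 i4 i1 i3 = 0 by apply: (lcP (lcD (lcZ (- 2^-1) hb2_134) (lcZ (2^-1) s11)));
    field.
  have q10 : - f i2 i4 + r i1 i1 i2 i4 + r i4 i4 i2 i4 = 0 by apply: (lcP (lcD (lcZ (2^-1)
    hb3_234) (lcD (lcZ (2^-1) hb1_124) (lcZ (-1) s24)))); field.
  have q11 : - f i1 i2 + r i1 i1 i1 i2 + r i4 i4 i1 i2 + f i3 i4 - r i1 i1 i3 i4 - r i4 i4 i3 i4
    = 0 by apply: (lcP (lcD (lcZ (2^-1) hb4_124) (lcD (lcZ (- 2^-1) hb3_123) (lcD (lcZ (2^-1)
    hb2_234) (lcD (lcZ (- 2^-1) hb1_134) (lcZ 2 s12)))))); field.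
  have q12 : f i1 i3 - r i1 i1 i1 i3 - r i4 i4 i1 i3 = 0 by apply: (lcP (lcD (lcZ (- 2^-1)
    hb4_134) (lcD (lcZ (- 2^-1) hb2_123) (lcZ (-1) s13)))); field.
  have q20 : - r i1 i3 i2 i4 = 0 by apply: (lcP (lcD (lcZ (2^-1) hb1_234) (lcZ (2^-1) s22)));
    field.
  have q21 : - r i1 i3 i1 i2 + r i1 i3 i3 i4 = 0 by apply: (lcP (lcD (lcZ (2^-1) hb4_234) (lcD
    (lcZ (- 2^-1) hb1_123) (lcZ (-1) s23)))); field.
  have q22 : r i1 i3 i1 i3 = 0 by apply: (lcP (lcD (lcZ (- 2^-1) hb4_123) (lcZ (2^-1) s33)));
    field.
  rewrite /asd_curv_poly /on_sd_plane !atomE.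
  by apply: (lcP (lcD (lcZ (z' ^+ 2 * z ^+ 2) q22) (lcD (lcZ (z' ^+ 2 * z) q21) (lcD (lcZ (z' ^+
    2) q20) (lcD (lcZ (z' * z ^+ 2) q12) (lcD (lcZ (z' * z) q11) (lcD (lcZ z' q10) (lcD (lcZ (z
    ^+ 2) q02) (lcD (lcZ z q01) q00))))))))); ring.
(* For fixed [z'] the polynomial is quadratic in [z]; its three coefficients are in turn quadratic
   in [z']. *)
have H z' : [/\ (r i2 i4 i2 i4) + (- f i2 i4 + r i1 i1 i2 i4 + r i4 i4 i2 i4) * z' + (- r i1 i3
  i2 i4) * z' ^+ 2 = 0,
   (r i2 i4 i1 i2 - r i2 i4 i3 i4) + (- f i1 i2 + r i1 i1 i1 i2 + r i4 i4 i1 i2 + f i3 i4 - r i1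
     i1 i3 i4 - r i4 i4 i3 i4) * z' + (- r i1 i3 i1 i2 + r i1 i3 i3 i4) * z' ^+ 2 = 0
 & (- r i2 i4 i1 i3) + (f i1 i3 - r i1 i1 i1 i3 - r i4 i4 i1 i3) * z' + (r i1 i3 i1 i3) * z' ^+ 2
   = 0].
  apply: quadratic_coef0 => z; have := Q0 z z'.
  rewrite /asd_curv_poly /on_sd_plane !atomE => h; by apply: (lcP h); ring.
have [q00 q10 q20] : [/\ r i2 i4 i2 i4 = 0, - f i2 i4 + r i1 i1 i2 i4 + r i4 i4 i2 i4 = 0 & - r
  i1 i3 i2 i4 = 0].
  by apply: quadratic_coef0 => z'; case: (H z').
have [q01 q11 q21] : [/\ r i2 i4 i1 i2 - r i2 i4 i3 i4 = 0, - f i1 i2 + r i1 i1 i1 i2 + r i4 i4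
  i1 i2 + f i3 i4 - r i1 i1 i3 i4 - r i4 i4 i3 i4 = 0 & - r i1 i3 i1 i2 + r i1 i3 i3 i4 = 0].
  by apply: quadratic_coef0 => z'; case: (H z').
have [q02 q12 q22] : [/\ - r i2 i4 i1 i3 = 0, f i1 i3 - r i1 i1 i1 i3 - r i4 i4 i1 i3 = 0 & r i1
  i3 i1 i3 = 0].
  by apply: quadratic_coef0 => z'; case: (H z').
have := b1_123; rewrite !atomE => hb1_123.
have := b1_124; rewrite !atomE => hb1_124.
have := b1_134; rewrite !atomE => hb1_134.
have := b1_234; rewrite !atomE => hb1_234.
have := b2_123; rewrite !atomE => hb2_123.
have := b2_124; rewrite !atomE => hb2_124.
have := b2_134; rewrite !atomE => hb2_134.
have := b2_234; rewrite !atomE => hb2_234.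
have := b3_123; rewrite !atomE => hb3_123.
have := b3_124; rewrite !atomE => hb3_124.
have := b3_134; rewrite !atomE => hb3_134.
have := b3_234; rewrite !atomE => hb3_234.
have := b4_123; rewrite !atomE => hb4_123.
have := b4_124; rewrite !atomE => hb4_124.
have := b4_134; rewrite !atomE => hb4_134.
have := b4_234; rewrite !atomE => hb4_234.
by elim/ord4P; elim/ord4P; rewrite /null_tracefree_ric scalE !ricE !g0E;
  [apply: (lcP (lcD hb2_134 (lcZ 2 q02))); field
  |apply: (lcP (lcD (lcZ (- 4^-1) hb4_124) (lcD (lcZ (4^-1) hb3_123) (lcD (lcZ (- 4^-1) hb2_234)
    (lcD (lcZ (4^-1) hb1_134) (lcZ (2^-1) q11)))))); field
  |apply: (lcP (lcD (lcZ (- 2^-1) hb4_134) (lcD (lcZ (- 2^-1) hb2_123) (lcZ (-1) q12)))); field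
  |apply: (lcP (lcD (lcZ (- 2^-1) hb3_134) (lcD (lcZ (2^-1) hb2_124) (lcZ (-1) q01)))); field
  |apply: (lcP (lcD (lcZ (- 4^-1) hb4_124) (lcD (lcZ (4^-1) hb3_123) (lcD (lcZ (- 4^-1) hb2_234)
    (lcD (lcZ (4^-1) hb1_134) (lcZ (2^-1) q11)))))); field
  |apply: (lcP (lcD (lcZ (-1) hb1_234) (lcZ 2 q20))); field
  |apply: (lcP (lcD (lcZ (2^-1) hb4_234) (lcD (lcZ (- 2^-1) hb1_123) (lcZ (-1) q21)))); field
  |apply: (lcP (lcD (lcZ (2^-1) hb3_234) (lcD (lcZ (2^-1) hb1_124) (lcZ (-1) q10)))); field
  |apply: (lcP (lcD (lcZ (- 2^-1) hb4_134) (lcD (lcZ (- 2^-1) hb2_123) (lcZ (-1) q12)))); field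
  |apply: (lcP (lcD (lcZ (2^-1) hb4_234) (lcD (lcZ (- 2^-1) hb1_123) (lcZ (-1) q21)))); field
  |apply: (lcP (lcD hb4_123 (lcZ 2 q22))); field
  |apply: (lcP (lcD (lcZ (- 4^-1) hb4_124) (lcD (lcZ (4^-1) hb3_123) (lcD (lcZ (- 4^-1) hb2_234)
    (lcD (lcZ (4^-1) hb1_134) (lcZ (2^-1) q11)))))); field
  |apply: (lcP (lcD (lcZ (- 2^-1) hb3_134) (lcD (lcZ (2^-1) hb2_124) (lcZ (-1) q01)))); field
  |apply: (lcP (lcD (lcZ (2^-1) hb3_234) (lcD (lcZ (2^-1) hb1_124) (lcZ (-1) q10)))); field
  |apply: (lcP (lcD (lcZ (- 4^-1) hb4_124) (lcD (lcZ (4^-1) hb3_123) (lcD (lcZ (- 4^-1) hb2_234)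
    (lcD (lcZ (4^-1) hb1_134) (lcZ (2^-1) q11)))))); field
  |apply: (lcP (lcD (lcZ (-1) hb3_124) (lcZ 2 q00))); field].
Qed.

Section levi_civita_case.
Hypothesis f0 : forall k l, f k l = 0.

(** The equations on the left say that each w_ij has no self-dual part. The Bianchi identities
    reduce them to five, as many as the quartic has coefficients. *)
Lemma null_weylP :
  (forall i j, [/\ null_weyl r i j i1 i3 = 0, null_weyl r i j i2 i4 = 0
     & null_weyl r i j i1 i2 = null_weyl r i j i3 i4]) <->
  (forall z, sd_curv_poly r z = 0).
Proof.
split=> [w0 z|Q0].
  have [_ _ +] := w0 i1 i2; rewrite /null_weyl scalE !ricE !sum4 !g0E !atomE ?f0 => w12_d.
  have [+ _ _] := w0 i1 i3; rewrite /null_weyl scalE !ricE !sum4 !g0E !atomE ?f0 => w13_13.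
  have [_ + _] := w0 i1 i3; rewrite /null_weyl scalE !ricE !sum4 !g0E !atomE ?f0 => w13_24.
  have [_ _ +] := w0 i1 i3; rewrite /null_weyl scalE !ricE !sum4 !g0E !atomE ?f0 => w13_d.
  have [_ + _] := w0 i2 i4; rewrite /null_weyl scalE !ricE !sum4 !g0E !atomE ?f0 => w24_24.
  have [_ _ +] := w0 i2 i4; rewrite /null_weyl scalE !ricE !sum4 !g0E !atomE ?f0 => w24_d.
  have [_ _ +] := w0 i3 i4; rewrite /null_weyl scalE !ricE !sum4 !g0E !atomE ?f0 => w34_d.
  (* [ck] is the coefficient of [z ^+ k] in the quartic. *)
  have c0 : r i1 i4 i2 i4 = 0 by apply: (lcP (lcZ 2 w24_24)); field.
  have c1 : r i1 i4 i1 i2 - r i1 i4 i3 i4 - r i1 i1 i2 i4 + r i4 i4 i2 i4 = 0 by apply: (lcP (lcZ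
    4 w24_d)); field.
  have c2 : - r i1 i4 i1 i3 - r i1 i1 i1 i2 + r i4 i4 i1 i2 + r i1 i1 i3 i4 - r i4 i4 i3 i4 - r
    i2 i3 i2 i4 = 0 by apply: (lcP (lcD (lcZ (-2) w34_d) (lcD (lcZ (-4) w13_24) (lcZ 2 w12_d))));
    field.
  have c3 : r i1 i1 i1 i3 - r i4 i4 i1 i3 - r i2 i3 i1 i2 + r i2 i3 i3 i4 = 0 by apply: (lcP (lcZ
    (-4) w13_d)); field.
  have c4 : r i2 i3 i1 i3 = 0 by apply: (lcP (lcZ 2 w13_13)); field.
  rewrite /sd_curv_poly /on_sd_plane !atomE ?f0.
  by apply: (lcP (lcD (lcZ (z ^+ 4) c4) (lcD (lcZ (z ^+ 3) c3) (lcD (lcZ (z ^+ 2) c2) (lcD (lcZ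
    (z) c1) c0))))); ring.
have [c0 c1 c2 c3 c4] : [/\ r i1 i4 i2 i4 = 0, r i1 i4 i1 i2 - r i1 i4 i3 i4 - r i1 i1 i2 i4 + r
  i4 i4 i2 i4 = 0, - r i1 i4 i1 i3 - r i1 i1 i1 i2 + r i4 i4 i1 i2 + r i1 i1 i3 i4 - r i4 i4 i3
  i4 - r i2 i3 i2 i4 = 0, r i1 i1 i1 i3 - r i4 i4 i1 i3 - r i2 i3 i1 i2 + r i2 i3 i3 i4 = 0 & r
  i2 i3 i1 i3 = 0].
  apply: quartic_coef0 => z; have := Q0 z.
  rewrite /sd_curv_poly /on_sd_plane !atomE ?f0 => h; by apply: (lcP h); ring.
have := b1_123; rewrite !atomE ?f0 => hb1_123.
have := b1_124; rewrite !atomE ?f0 => hb1_124.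
have := b1_134; rewrite !atomE ?f0 => hb1_134.
have := b1_234; rewrite !atomE ?f0 => hb1_234.
have := b2_123; rewrite !atomE ?f0 => hb2_123.
have := b2_124; rewrite !atomE ?f0 => hb2_124.
have := b2_134; rewrite !atomE ?f0 => hb2_134.
have := b2_234; rewrite !atomE ?f0 => hb2_234.
have := b3_123; rewrite !atomE ?f0 => hb3_123.
have := b3_124; rewrite !atomE ?f0 => hb3_124.
have := b3_134; rewrite !atomE ?f0 => hb3_134.
have := b3_234; rewrite !atomE ?f0 => hb3_234.
have := b4_123; rewrite !atomE ?f0 => hb4_123.
have := b4_124; rewrite !atomE ?f0 => hb4_124.
have := b4_134; rewrite !atomE ?f0 => hb4_134.
have := b4_234; rewrite !atomE ?f0 => hb4_234.
by elim/ord4P; elim/ord4P;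
  [split; rewrite /null_weyl scalE !ricE !sum4 !g0E !atomE ?f0;
     [field
     |field
     |field]
  |split; rewrite /null_weyl scalE !ricE !sum4 !g0E !atomE ?f0;
     [apply: (lcP (lcD (lcZ (- 8^-1) hb4_134) (lcD (lcZ (- 8^-1) hb2_123) (lcZ (- 8^-1) c3))));
       field
     |apply: (lcP (lcD (lcZ (- 8^-1) hb3_234) (lcD (lcZ (- 8^-1) hb1_124) (lcZ (8^-1) c1))));
       field
     |apply: (lcP (lcD (lcZ (- 12^-1) hb4_124) (lcD (lcZ (12^-1) hb3_123) (lcD (lcZ (- 6^-1)
       hb2_234) (lcD (lcZ (6^-1) hb1_134) (lcZ (6^-1) c2)))))); field]
  |split; rewrite /null_weyl scalE !ricE !sum4 !g0E !atomE ?f0;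
     [apply: (lcP (lcZ (2^-1) c4)); field
     |apply: (lcP (lcD (lcZ (24^-1) hb4_124) (lcD (lcZ (- 24^-1) hb3_123) (lcD (lcZ (- 24^-1)
       hb2_234) (lcD (lcZ (24^-1) hb1_134) (lcZ (- 12^-1) c2)))))); field
     |apply: (lcP (lcZ (- 4^-1) c3)); field]
  |split; rewrite /null_weyl scalE !ricE !sum4 !g0E !atomE ?f0;
     [apply: (lcP (lcZ (4^-1) hb2_134)); field
     |apply: (lcP (lcZ (4^-1) hb3_124)); field
     |apply: (lcP (lcD (lcZ (- 4^-1) hb3_134) (lcZ (4^-1) hb2_124))); field]
  |split; rewrite /null_weyl scalE !ricE !sum4 !g0E !atomE ?f0;
     [apply: (lcP (lcD (lcZ (8^-1) hb4_134) (lcD (lcZ (8^-1) hb2_123) (lcZ (8^-1) c3)))); field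
     |apply: (lcP (lcD (lcZ (8^-1) hb3_234) (lcD (lcZ (8^-1) hb1_124) (lcZ (- 8^-1) c1)))); field
     |apply: (lcP (lcD (lcZ (12^-1) hb4_124) (lcD (lcZ (- 12^-1) hb3_123) (lcD (lcZ (6^-1)
       hb2_234) (lcD (lcZ (- 6^-1) hb1_134) (lcZ (- 6^-1) c2)))))); field]
  |split; rewrite /null_weyl scalE !ricE !sum4 !g0E !atomE ?f0;
     [field
     |field
     |field]
  |split; rewrite /null_weyl scalE !ricE !sum4 !g0E !atomE ?f0;
     [apply: (lcP (lcZ (- 4^-1) hb4_123)); field
     |apply: (lcP (lcZ (- 4^-1) hb1_234)); field
     |apply: (lcP (lcD (lcZ (- 4^-1) hb4_234) (lcZ (4^-1) hb1_123))); field]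
  |split; rewrite /null_weyl scalE !ricE !sum4 !g0E !atomE ?f0;
     [apply: (lcP (lcD (lcZ (24^-1) hb4_124) (lcD (lcZ (- 24^-1) hb3_123) (lcD (lcZ (- 24^-1)
       hb2_234) (lcD (lcZ (24^-1) hb1_134) (lcZ (- 12^-1) c2)))))); field
     |apply: (lcP (lcZ (2^-1) c0)); field
     |apply: (lcP (lcZ (4^-1) c1)); field]
  |split; rewrite /null_weyl scalE !ricE !sum4 !g0E !atomE ?f0;
     [apply: (lcP (lcZ (- 2^-1) c4)); field
     |apply: (lcP (lcD (lcZ (- 24^-1) hb4_124) (lcD (lcZ (24^-1) hb3_123) (lcD (lcZ (24^-1)
       hb2_234) (lcD (lcZ (- 24^-1) hb1_134) (lcZ (12^-1) c2)))))); field
     |apply: (lcP (lcZ (4^-1) c3)); field]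
  |split; rewrite /null_weyl scalE !ricE !sum4 !g0E !atomE ?f0;
     [apply: (lcP (lcZ (4^-1) hb4_123)); field
     |apply: (lcP (lcZ (4^-1) hb1_234)); field
     |apply: (lcP (lcD (lcZ (4^-1) hb4_234) (lcZ (- 4^-1) hb1_123))); field]
  |split; rewrite /null_weyl scalE !ricE !sum4 !g0E !atomE ?f0;
     [field
     |field
     |field]
  |split; rewrite /null_weyl scalE !ricE !sum4 !g0E !atomE ?f0;
     [apply: (lcP (lcD (lcZ (- 8^-1) hb4_134) (lcD (lcZ (- 8^-1) hb2_123) (lcZ (8^-1) c3))));
       field
     |apply: (lcP (lcD (lcZ (- 8^-1) hb3_234) (lcD (lcZ (- 8^-1) hb1_124) (lcZ (- 8^-1) c1))));
       field
     |apply: (lcP (lcD (lcZ (- 6^-1) hb4_124) (lcD (lcZ (6^-1) hb3_123) (lcD (lcZ (- 12^-1)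
       hb2_234) (lcD (lcZ (12^-1) hb1_134) (lcZ (- 6^-1) c2)))))); field]
  |split; rewrite /null_weyl scalE !ricE !sum4 !g0E !atomE ?f0;
     [apply: (lcP (lcZ (- 4^-1) hb2_134)); field
     |apply: (lcP (lcZ (- 4^-1) hb3_124)); field
     |apply: (lcP (lcD (lcZ (4^-1) hb3_134) (lcZ (- 4^-1) hb2_124))); field]
  |split; rewrite /null_weyl scalE !ricE !sum4 !g0E !atomE ?f0;
     [apply: (lcP (lcD (lcZ (- 24^-1) hb4_124) (lcD (lcZ (24^-1) hb3_123) (lcD (lcZ (24^-1)
       hb2_234) (lcD (lcZ (- 24^-1) hb1_134) (lcZ (12^-1) c2)))))); field
     |apply: (lcP (lcZ (- 2^-1) c0)); field
     |apply: (lcP (lcZ (- 4^-1) c1)); field]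
  |split; rewrite /null_weyl scalE !ricE !sum4 !g0E !atomE ?f0;
     [apply: (lcP (lcD (lcZ (8^-1) hb4_134) (lcD (lcZ (8^-1) hb2_123) (lcZ (- 8^-1) c3)))); field
     |apply: (lcP (lcD (lcZ (8^-1) hb3_234) (lcD (lcZ (8^-1) hb1_124) (lcZ (8^-1) c1)))); field
     |apply: (lcP (lcD (lcZ (6^-1) hb4_124) (lcD (lcZ (- 6^-1) hb3_123) (lcD (lcZ (12^-1)
       hb2_234) (lcD (lcZ (- 12^-1) hb1_134) (lcZ (6^-1) c2)))))); field]
  |split; rewrite /null_weyl scalE !ricE !sum4 !g0E !atomE ?f0;
     [field
     |field
     |field]].
Qed.

End levi_civita_case.

End null_frame_algebra.

Lemma sum2_linear (F : comNzRingType) (I : finType) (d e : I -> F) (u v w : I -> I -> F) c :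
  (forall a b, u a b + v a b = w a b * c) ->
  \sum_a \sum_b d a * e b * u a b + \sum_a \sum_b d a * e b * v a b
  = (\sum_a \sum_b d a * e b * w a b) * c.
Proof.
move=> uvw; rewrite mulr_suml -big_split /=; apply: eq_bigr => a _.
rewrite mulr_suml -big_split /=; apply: eq_bigr => b _.
by rewrite -mulrDr uvw mulrA.
Qed.

Lemma mx_scaleE (F : pzRingType) p q a (A : 'M[F]_(p, q)) i j : (a *: A) i j = a * A i j.
Proof. by rewrite mxE. Qed.

Section null_frame_curvature.
Variables (R : realType) (U : set 'rV[R]_4).
Hypothesis oU : open U.
Local Notation C := R[i].
Local Notation g0 := (@null_gram R).
Variables (th : 'rV[R]_4 -> 'M[C]_4) (G : 'rV[R]_4 -> 'M[C]_4).
Variables (A : 'rV[R]_4 -> 'rV[C]_4) (Ga : 'I_4 -> 'I_4 -> 'rV[R]_4 -> 'rV[C]_4).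
Hypotheses (sth : csmooth_mx U th) (uth : forall x, U x -> th x \in unitmx).
Hypothesis sA : csmooth_mx U A.
Hypothesis conn : weyl_connection U th G A Ga.
Hypothesis nullG : forall x, U x -> gframe th G x = g0.
Implicit Types (x : 'rV[R]_4) (a b i j k l : 'I_4).

Lemma null_gram_sym : g0^T = g0.
Proof. by apply/matrixP => i j; rewrite !mxE; elim/ord4P: i; elim/ord4P: j. Qed.

Lemma null_gram_sqr : g0 *m g0 = 4^-1%:M.
Proof.
apply/matrixP => i j; rewrite !mxE sum4 !mxE.
by elim/ord4P: i; elim/ord4P: j; rewrite /=; field.
Qed.

Lemma invmx_null_gram : invmx g0 = 4 *: g0.
Proof.
apply: mulmx1_invmx; rewrite -scalemxAr null_gram_sqr scale_scalar_mx.
by rewrite mulfV // pnatr_eq0.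
Qed.

Lemma null_gram_unit : g0 \in unitmx.
Proof.
have : g0 *m (4 *: g0) = 1%:M.
  by rewrite -scalemxAr null_gram_sqr scale_scalar_mx mulfV // pnatr_eq0.
by move/mulmx1_unit => [].
Qed.

Lemma null_frame_curvature x : U x ->
  null_curvature (fun i j => frame_curv th Ga i j x)
    (fun k l => \sum_a \sum_b invmx (th x) a k * invmx (th x) b l
                * (mxpartial a A x 0 b - mxpartial b A x 0 a)).
Proof.
move=> Ux; split=> [i j k l|i j k l|i j k l].
- exact: frame_curv_alt.
- exact: (frame_bianchi oU sth uth conn).
have E p q : \sum_h g0 p h * frame_curv th Ga h q x k l = \sum_a \sum_b
    invmx (th x) a k * invmx (th x) b l * (g0 *m curv_mx Ga a b x) p q.
  under eq_bigr do rewrite frame_curvE mulr_sumr.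
  rewrite exchange_big /=; apply: eq_bigr => a _.
  under eq_bigr do rewrite mulr_sumr.
  rewrite exchange_big /=; apply: eq_bigr => b _.
  rewrite [in RHS]mxE mulr_sumr; apply: eq_bigr => h _.
  by rewrite mulrCA.
apply: (etrans (congr2 +%R (E i j) (E j i))).
apply: (@sum2_linear _ _ (fun a => invmx (th x) a k) (fun b => invmx (th x) b l)) => a b.
have := constant_frame_curvature oU sA conn a b null_gram_sym nullG Ux.
by move=> /(congr1 (fun B : 'M[C]_4 => B i j)); rewrite mx_addE [_^T i j]mxE [RHS]mxE.
Qed.

Lemma null_ricci x j l : U x ->
  ricci th G Ga x j l = null_ric (fun i j => frame_curv th Ga i j x) j l.
Proof.
by move=> Ux; rewrite ricci_trace // nullG // ?null_gram_sym // null_gram_unit.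
Qed.

Lemma null_scalar_curvature x : U x ->
  scalar_curvature th G Ga x = null_scal (fun i j => frame_curv th Ga i j x).
Proof.
move=> Ux; rewrite /scalar_curvature nullG // invmx_null_gram.
apply: eq_bigr => i _; apply: eq_bigr => j _.
by rewrite null_ricci // [(4 *: g0) i j]mxE.
Qed.

Lemma null_tracefree_ricci x i j : U x ->
  tracefree_ricci th G Ga x i j
  = null_tracefree_ric (fun i j => frame_curv th Ga i j x) i j.
Proof.
move=> Ux; rewrite /tracefree_ricci !null_ricci // null_scalar_curvature //.
by rewrite nullG.
Qed.

Lemma null_weyl_tensor x i j k l : U x ->
  weyl_tensor th G Ga x i j k l
  = null_weyl (fun i j => frame_curv th Ga i j x) i j k l.
Proof.
move=> Ux; rewrite /weyl_tensor !null_ricci // null_scalar_curvature // nullG //.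
by rewrite /riemann nullG.
Qed.

End null_frame_curvature.

(** * Self-dual and anti-self-dual 2-forms in components *)

Section dual_2forms.
Variable R : realType.
Local Notation C := R[i].
Implicit Types (t B : 'M[C]_4) (u : 'I_4 -> 'I_4 -> C).

Definition frame_2form t u : 'M[C]_4 :=
  2^-1 *: \sum_k \sum_l u k l *: wedge (row k t) (row l t).

Lemma frame_2form_comp t u a b : frame_2form t u a b =
  2^-1 * \sum_k \sum_l u k l * (t k a * t l b - t k b * t l a).
Proof.
rewrite mxE summxE; congr (_ * _); apply: eq_bigr => k _; rewrite summxE.
by apply: eq_bigr => l _; rewrite mxE wedgeE !mxE.
Qed.

Lemma frame_components_inj t : t \in unitmx -> injective (frame_components t).
Proof.
move=> ut B B' /(congr1 (fun X => t^T *m X *m t)).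
rewrite /frame_components !mulmxA -!trmx_mul mulVmx // trmx1 !mul1mx.
by rewrite -!mulmxA mulVmx // !mulmx1.
Qed.

Lemma frame_components_wedge t al be :
  frame_components t (wedge al be) = wedge (al *m invmx t) (be *m invmx t).
Proof.
by rewrite /frame_components /wedge mulmxBr mulmxBl !trmx_mul !mulmxA.
Qed.

Lemma frame_components_wedge_row t k l : t \in unitmx ->
  frame_components t (wedge (row k t) (row l t)) = wedge (delta_mx 0 k) (delta_mx 0 l).
Proof.
move=> ut; apply: (etrans (frame_components_wedge _ _ _)).
by rewrite -row_mul -(row_mul l) (mulmxV ut) 2!row1.
Qed.

Lemma frame_components_2form t u : t \in unitmx ->
  frame_components t (frame_2form t u) = frame_2form 1%:M u.
Proof.
move=> ut; rewrite /frame_2form {1}/frame_components -scalemxAr -scalemxAl.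
congr (_ *: _); rewrite mulmx_sumr mulmx_suml; apply: eq_bigr => k _.
rewrite mulmx_sumr mulmx_suml; apply: eq_bigr => l _.
rewrite -scalemxAr -scalemxAl; congr (_ *: _).
by rewrite 2!row1; exact: frame_components_wedge_row.
Qed.

Lemma frame_2form1 u p q : frame_2form 1%:M u p q = 2^-1 * (u p q - u q p).
Proof.
rewrite frame_2form_comp !sum4; elim/ord4P: p; elim/ord4P: q; rewrite !mxE /=; ring.
Qed.

(** The three equations annihilate the coefficients along the basis of self-dual 2-forms; those of
    [sd_2form] do the same for anti-self-dual ones. *)
Definition asd_2form u : Prop := [/\ u i1 i3 = 0, u i2 i4 = 0 & u i1 i2 = u i3 i4].
Definition sd_2form u : Prop := [/\ u i2 i3 = 0, u i1 i4 = 0 & u i1 i2 = - u i3 i4].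

Section criterion.
Variables (t : 'M[C]_4) (u : 'I_4 -> 'I_4 -> C).
Hypotheses (ut : t \in unitmx) (alt : forall k l, u k l = - u l k).

Let compE p q : frame_components t (frame_2form t u) p q = u p q.
Proof.
rewrite frame_components_2form // frame_2form1.
by apply: (lcP (lcZ (- 2^-1) (alt q p))); field.
Qed.

Let wedgeE' p q k l : frame_components t (wedge (row k t) (row l t)) p q
  = (p == k)%:R * (q == l)%:R - (q == k)%:R * (p == l)%:R.
Proof. by rewrite frame_components_wedge_row // wedgeE !mxE /=. Qed.

Let comb (a b c : C) (B1 B2 B3 : 'M[C]_4) p q :
  frame_components t (a *: B1 + b *: B2 + c *: B3) p q
  = a * frame_components t B1 p q + b * frame_components t B2 p q
    + c * frame_components t B3 p q.
Proof.
rewrite /frame_components !mulmxDr !mulmxDl -!scalemxAr -!scalemxAl !mx_addE.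
by congr (_ + _ + _); exact: mx_scaleE.
Qed.

Let compD (B1 B2 : 'M[C]_4) p q : frame_components t (B1 + B2) p q
  = frame_components t B1 p q + frame_components t B2 p q.
Proof. by rewrite /frame_components !mulmxDr !mulmxDl mx_addE. Qed.

Let compB (B1 B2 : 'M[C]_4) p q : frame_components t (B1 - B2) p q
  = frame_components t B1 p q - frame_components t B2 p q.
Proof. by rewrite /frame_components !mulmxBr !mulmxBl mx_addE mx_oppE. Qed.

Let uE : (forall k, u k k = 0).
Proof. by move=> k; apply: (lcP (lcZ (2^-1) (alt k k))); field. Qed.

Let W (k l p q : 'I_4) : C := (p == k)%:R * (q == l)%:R - (q == k)%:R * (p == l)%:R.

Let asdE (a b c : C) p q : frame_components t
    (a *: wedge (row i1 t) (row i4 t)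
     + b *: (wedge (row i3 t) (row i4 t) + wedge (row i1 t) (row i2 t))
     + c *: wedge (row i3 t) (row i2 t)) p q
  = a * W i1 i4 p q + b * (W i3 i4 p q + W i1 i2 p q) + c * W i3 i2 p q.
Proof.
apply: (etrans (comb _ _ _ _ _ _ _ _)); congr (_ * _ + _ * _ + _ * _); try exact: wedgeE'.
exact: (etrans (compD _ _ _ _) (congr2 +%R (wedgeE' _ _ _ _) (wedgeE' _ _ _ _))).
Qed.

Let sdE (a b c : C) p q : frame_components t
    (a *: wedge (row i2 t) (row i4 t)
     + b *: (wedge (row i3 t) (row i4 t) - wedge (row i1 t) (row i2 t))
     + c *: wedge (row i3 t) (row i1 t)) p q
  = a * W i2 i4 p q + b * (W i3 i4 p q - W i1 i2 p q) + c * W i3 i1 p q.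
Proof.
apply: (etrans (comb _ _ _ _ _ _ _ _)); congr (_ * _ + _ * _ + _ * _); try exact: wedgeE'.
apply: (etrans (compB _ _ _ _)).
by congr (_ - _); exact: wedgeE'.
Qed.

Lemma anti_self_dual_2formP :
  anti_self_dual_2form t (frame_2form t u) <-> asd_2form u.
Proof.
split=> [[a [b [c E]]]|[u13 u24 u12]].
  have E' p q := etrans (esym (compE p q))
    (etrans (congr1 (fun B : 'M[C]_4 => frame_components t B p q) E) (asdE a b c p q)).
  by split; rewrite ?(E' i1 i3) ?(E' i2 i4) ?(E' i1 i2) ?(E' i3 i4) /W /=; ring.
exists (u i1 i4), (u i3 i4), (u i3 i2).
apply: (frame_components_inj ut); apply/matrixP => p q.
apply: (etrans (compE p q)); apply: (etrans _ (esym (asdE _ _ _ p q))).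
elim/ord4P: p; elim/ord4P: q; rewrite /W /= ?uE ?(alt i2 i1) ?(alt i3 i1) ?(alt i4 i1)
  ?(alt i2 i3) ?(alt i4 i2) ?(alt i4 i3) ?u13 ?u24 ?u12; ring.
Qed.

Lemma self_dual_2formP :
  self_dual_2form t (frame_2form t u) <-> sd_2form u.
Proof.
split=> [[a [b [c E]]]|[u23 u14 u12]].
  have E' p q := etrans (esym (compE p q))
    (etrans (congr1 (fun B : 'M[C]_4 => frame_components t B p q) E) (sdE a b c p q)).
  by split; rewrite ?(E' i2 i3) ?(E' i1 i4) ?(E' i1 i2) ?(E' i3 i4) /W /=; ring.
exists (u i2 i4), (u i3 i4), (u i3 i1).
apply: (frame_components_inj ut); apply/matrixP => p q.
apply: (etrans (compE p q)); apply: (etrans _ (esym (sdE _ _ _ p q))).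
elim/ord4P: p; elim/ord4P: q; rewrite /W /= ?uE ?(alt i2 i1) ?(alt i1 i3) ?(alt i4 i1)
  ?(alt i3 i2) ?(alt i4 i2) ?(alt i4 i3) ?u23 ?u14 ?u12; ring.
Qed.

End criterion.

End dual_2forms.

(** * Exchange of the two orientations *)

Section orientation_swap.
Variable R : realType.
Local Notation C := R[i].
Local Notation g0 := (@null_gram R).
Implicit Types (s : bool) (r : 'I_4 -> 'I_4 -> 'I_4 -> 'I_4 -> C).
Implicit Types (f u : 'I_4 -> 'I_4 -> C).

(* Exchanging [M] and [P] exchanges self-dual and anti-self-dual 2-forms, and
   [z] and [z'].  With the boolean [s], both halves of the theorem are proved
   at once. *)
Definition swap s (i : 'I_4) : 'I_4 :=
  if s then (if i == i1 then i2 else if i == i2 then i1 else i) else i.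

Lemma swapK s : involutive (swap s).
Proof. by case: s; elim/ord4P. Qed.

Lemma swap_gram s i j : g0 (swap s i) (swap s j) = g0 i j.
Proof. by case: s => //; rewrite !mxE; elim/ord4P: i; elim/ord4P: j. Qed.

Lemma sum_swap s (V : nmodType) (F : 'I_4 -> V) : \sum_i F (swap s i) = \sum_i F i.
Proof. by case: s => //; rewrite !sum4 /swap /= (addrC (F i2)). Qed.

Definition swap_curv s r i j k l := r (swap s i) (swap s j) (swap s k) (swap s l).

Lemma null_curvature_swap s r f : null_curvature r f ->
  null_curvature (swap_curv s r) (fun k l => f (swap s k) (swap s l)).
Proof.
move=> [alt bia gram]; split=> [i j k l|i j k l|i j k l].
- exact: alt.
- exact: bia.
rewrite -(swap_gram s i j) -gram -!(sum_swap s (fun h => _ * r h _ _ _)).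
by congr (_ + _); apply: eq_bigr => h _; rewrite swap_gram.
Qed.

Lemma null_ric_swap s r j l :
  null_ric (swap_curv s r) j l = null_ric r (swap s j) (swap s l).
Proof. exact: (sum_swap s (fun k => r k (swap s j) k (swap s l))). Qed.

Lemma null_scal_swap s r : null_scal (swap_curv s r) = null_scal r.
Proof.
rewrite /null_scal -[RHS](sum_swap s); apply: eq_bigr => i _.
rewrite -[RHS](sum_swap s); apply: eq_bigr => j _.
by rewrite null_ric_swap swap_gram.
Qed.

Lemma null_tracefree_ric_swap s r i j :
  null_tracefree_ric (swap_curv s r) i j = null_tracefree_ric r (swap s i) (swap s j).
Proof. by rewrite /null_tracefree_ric !null_ric_swap null_scal_swap swap_gram. Qed.

Lemma null_weyl_swap s r i j k l : null_weyl (swap_curv s r) i j k l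
  = null_weyl r (swap s i) (swap s j) (swap s k) (swap s l).
Proof.
rewrite /null_weyl !null_ric_swap null_scal_swap !swap_gram; congr (_ - _ + _).
rewrite -[RHS](sum_swap s); apply: eq_bigr => h _.
by rewrite swap_gram.
Qed.

Lemma null_weyl_alt r f i j k l : null_curvature r f ->
  null_weyl r i j k l = - null_weyl r i j l k.
Proof. by case=> alt _ _; rewrite /null_weyl !sum4 !(alt _ j k l); ring. Qed.

Definition dual_2form s u : Prop := if s then sd_2form u else asd_2form u.

Lemma dual_2form_swap s u : (forall k l, u k l = - u l k) ->
  dual_2form s u <-> asd_2form (fun k l => u (swap s k) (swap s l)).
Proof.
move=> alt; case: s => //=; rewrite /sd_2form /asd_2form /swap /= (alt i2 i1).
split=> [[-> -> ->]|[-> -> <-]]; split=> //.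
  by rewrite opprK.
by rewrite opprK.
Qed.

Lemma swap_tracefree_ricP s r f : null_curvature r f ->
  (forall i j, null_tracefree_ric r i j = 0) <->
  (forall z z', asd_curv_poly (swap_curv s r) z z' = 0).
Proof.
move=> /(null_curvature_swap s) /null_tracefree_ricP <-; split=> H i j.
  by rewrite null_tracefree_ric_swap.
by have := H (swap s i) (swap s j); rewrite null_tracefree_ric_swap !swapK.
Qed.

Lemma swap_weylP s r f : null_curvature r f -> (forall k l, f k l = 0) ->
  (forall i j, dual_2form s (null_weyl r i j)) <->
  (forall z, sd_curv_poly (swap_curv s r) z = 0).
Proof.
move=> rP f0.
have [h1 h2] := null_weylP (null_curvature_swap s rP) (fun k l => f0 _ _).
have alt i j k l : null_weyl r i j k l = - null_weyl r i j l k by exact: null_weyl_alt rP.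
have E i j : dual_2form s (null_weyl r (swap s i) (swap s j)) <->
    [/\ null_weyl (swap_curv s r) i j i1 i3 = 0, null_weyl (swap_curv s r) i j i2 i4 = 0
     & null_weyl (swap_curv s r) i j i1 i2 = null_weyl (swap_curv s r) i j i3 i4].
  by rewrite !null_weyl_swap; apply: dual_2form_swap; exact: alt.
split=> [H|H i j].
  by apply: h1 => i j; apply/E.
by rewrite -(swapK s i) -(swapK s j); apply/E; exact: h2.
Qed.

End orientation_swap.

(** * Forms on the twistor bundle *)

Section exterior_calculus.
Variables (R : realType) (n : nat).
Local Notation C := R[i].
Implicit Types (B : 'M[C]_n) (X Y : 'rV[C]_n) (a b : 'I_n).

Definition eval2 B X Y : C := \sum_a \sum_b X 0 a * Y 0 b * B a b.

Lemma eval2D B B' X Y : eval2 (B + B') X Y = eval2 B X Y + eval2 B' X Y.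
Proof.
rewrite /eval2 -big_split /=; apply: eq_bigr => a _.
by rewrite -big_split /=; apply: eq_bigr => b _; rewrite mx_addE mulrDr.
Qed.

Lemma eval2Z c B X Y : eval2 (c *: B) X Y = c * eval2 B X Y.
Proof.
rewrite /eval2 mulr_sumr; apply: eq_bigr => a _.
by rewrite mulr_sumr; apply: eq_bigr => b _; rewrite mx_scaleE mulrCA.
Qed.

Lemma eval2N B X Y : eval2 (- B) X Y = - eval2 B X Y.
Proof. by rewrite -scaleN1r eval2Z mulN1r. Qed.

Lemma eval2B B B' X Y : eval2 (B - B') X Y = eval2 B X Y - eval2 B' X Y.
Proof. by rewrite eval2D eval2N. Qed.

Lemma eval20 X Y : eval2 0 X Y = 0.
Proof. by rewrite -(scale0r (0 : 'M[C]_n)) eval2Z mul0r. Qed.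

Lemma eval2_sum (I : finType) (F : I -> 'M[C]_n) X Y :
  eval2 (\sum_i F i) X Y = \sum_i eval2 (F i) X Y.
Proof.
exact: (big_morph (fun B => eval2 B X Y) (fun B B' => eval2D B B' X Y) (eval20 X Y)).
Qed.

Lemma eval2_wedge (al be : 'rV[C]_n) X Y : eval2 (wedge al be) X Y
  = pairing al X * pairing be Y - pairing al Y * pairing be X.
Proof.
rewrite /eval2 /pairing !big_distrl /= -sumrB.
under [RHS]eq_bigr do rewrite !big_distrr /=.
have E : \sum_a \sum_b al 0 a * Y 0 a * (be 0 b * X 0 b)
       = \sum_a \sum_b al 0 b * Y 0 b * (be 0 a * X 0 a) by exact: exchange_big.
rewrite sumrB E -sumrB; apply: eq_bigr => a _; rewrite -sumrB; apply: eq_bigr => b _.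
by rewrite !mxE !big_ord1 !mxE; ring.
Qed.

Lemma pairingD (al be : 'rV[C]_n) X : pairing (al + be) X = pairing al X + pairing be X.
Proof. by rewrite /pairing -big_split; apply: eq_bigr => a _; rewrite mxE mulrDl. Qed.

Lemma pairingZ c (al : 'rV[C]_n) X : pairing (c *: al) X = c * pairing al X.
Proof. by rewrite /pairing mulr_sumr; apply: eq_bigr => a _; rewrite mxE mulrA. Qed.

Lemma pairingN (al : 'rV[C]_n) X : pairing (- al) X = - pairing al X.
Proof. by rewrite -scaleN1r pairingZ mulN1r. Qed.

Lemma pairingB (al be : 'rV[C]_n) X : pairing (al - be) X = pairing al X - pairing be X.
Proof. by rewrite pairingD pairingN. Qed.

Section open_set.
Variable V : set 'rV[R]_n.
Hypothesis oV : open V.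
Implicit Types (al be : 'rV[R]_n -> 'rV[C]_n) (f : 'rV[R]_n -> C).

(** In Cartan's formula d al (X, Y) = X (al Y) - Y (al X) - al [X, Y] the first two terms on the
    right vanish. *)
Lemma cartan_bracket al (X Y : 'rV[R]_n -> 'rV[C]_n) y :
  csmooth_mx V al -> csmooth_mx V X -> csmooth_mx V Y ->
  (forall y, V y -> pairing (al y) (X y) = 0) ->
  (forall y, V y -> pairing (al y) (Y y) = 0) -> V y ->
  pairing (al y) (bracket X Y y) = - eval2 (diff1 al y) (X y) (Y y).
Proof.
move=> sal sX sY aX aY Vy.
(* The Leibniz rule for the function [pairing (al y) (Z y)], which is zero on [V]: derivatives of
   [Z] are traded for derivatives of [al]. *)
have D (Z : 'rV[R]_n -> 'rV[C]_n) a : csmooth_mx V Z ->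
    (forall y, V y -> pairing (al y) (Z y) = 0) ->
    \sum_b al y 0 b * cpartial a (fun y => Z y 0 b) y
    = - \sum_b cpartial a (fun y => al y 0 b) y * Z y 0 b.
  move=> sZ aZ; have S : \sum_b cpartial a (fun y => al y 0 b * Z y 0 b) y = 0.
    have sb b : csmooth V (fun y => al y 0 b * Z y 0 b) by exact: csmoothM.
    rewrite -(cpartial_sum oV a (index_enum 'I_n) xpredT sb Vy).
    exact: (etrans (cpartial_ext oV a aZ Vy) (cpartial_cst _ _ _)).
  apply/eqP; rewrite -addr_eq0 -big_split /=; apply/eqP; apply: (etrans _ S).
  by apply: eq_bigr => b _; rewrite (cpartialM oV) // addrC.
have -> : pairing (al y) (bracket X Y y)
   = \sum_a X y 0 a * (\sum_b al y 0 b * cpartial a (fun y => Y y 0 b) y)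
     - \sum_a Y y 0 a * (\sum_b al y 0 b * cpartial a (fun y => X y 0 b) y).
  under [X in _ = X - _]eq_bigr do rewrite mulr_sumr.
  under [X in _ = _ - X]eq_bigr do rewrite mulr_sumr.
  rewrite exchange_big /= [X in _ = _ - X]exchange_big /= -sumrB.
  apply: eq_bigr => b _; rewrite mxE mulr_sumr -sumrB; apply: eq_bigr => a _.
  by rewrite mulrBr !mulrA !(mulrC (al y 0 b)).
under eq_bigr do rewrite (D Y) // mulrN mulr_sumr.
under [X in _ - X]eq_bigr do rewrite (D X) // mulrN mulr_sumr.
rewrite !sumrN opprK [X in _ + X]exchange_big /= /eval2.
rewrite addrC -[LHS]opprK opprB; congr (- _).
rewrite -sumrB; apply: eq_bigr => a _; rewrite -sumrB; apply: eq_bigr => b _.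
by rewrite [diff1 _ _ _ _]mxE; ring.
Qed.

Lemma diff1D al be y : csmooth_mx V al -> csmooth_mx V be -> V y ->
  diff1 (fun y => al y + be y) y = diff1 al y + diff1 be y.
Proof.
move=> sal sbe Vy; apply/matrixP => a b; rewrite !mxE.
under [fun y => (al y + be y) 0 b]eq_fun do rewrite mxE.
under [fun y => (al y + be y) 0 a]eq_fun do rewrite mxE.
rewrite (cpartialD (U := V)) // (cpartialD (U := V)) //; ring.
Qed.

Lemma diff1Z f al y : csmooth V f -> csmooth_mx V al -> V y ->
  diff1 (fun y => f y *: al y) y = wedge (diff0 f y) (al y) + f y *: diff1 al y.
Proof.
move=> sf sal Vy; apply/matrixP => a b.
rewrite mx_addE mx_scaleE [wedge _ _ a b]mxE mx_oppE !mxE !big_ord1 !mxE.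
under [fun y => (f y *: al y) 0 b]eq_fun do rewrite mxE.
under [fun y => (f y *: al y) 0 a]eq_fun do rewrite mxE.
rewrite (cpartialM oV) // (cpartialM oV) //; ring.
Qed.

Lemma diff1N al y : csmooth_mx V al -> V y ->
  diff1 (fun y => - al y) y = - diff1 al y.
Proof.
move=> sal Vy; apply/matrixP => a b; rewrite !mxE.
under [fun y => (- al y) 0 b]eq_fun do rewrite mxE.
under [fun y => (- al y) 0 a]eq_fun do rewrite mxE.
rewrite (cpartialN (U := V)) // (cpartialN (U := V)) //; ring.
Qed.

End open_set.

Lemma diff1_cst (al : 'rV[C]_n) y : diff1 (fun=> al) y = 0.
Proof. by apply/matrixP => a b; rewrite !mxE !cpartial_cst subrr. Qed.

Lemma smooth_coord (V : set 'rV[R]_n) (j : 'I_n) : open V -> smooth V (fun y => y 0 j).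
Proof.
move=> oV.
have D (y v : 'rV[R]_n) : is_derive y v (fun y : 'rV[R]_n => y 0 j) (v 0 j).
  have dc := differentiable_coord y 0 j.
  apply: DeriveDef; first exact: diff_derivable.
  have := derive_mx (@derivable_id _ _ y v); rewrite derive_id.
  by move=> /matrixP/(_ 0 j); rewrite mxE.
case=> [|k] /=; first by move=> y _; exact: coord_continuous.
split=> [y a _|a]; first by have [] := D y (delta_mx 0 a).
apply: (Ck_ext oV) (smooth_cst oV ((delta_mx 0 a : 'rV[R]_n) 0 j) k) => y _.
by have [_ <-] := D y (delta_mx 0 a).
Qed.

End exterior_calculus.

(** * Pullback of functions and forms from the base *)

Section pullbacks.
Variables (R : realType).
Local Notation C := R[i].
Local Notation rV8 := 'rV[R]_(4 + 4).
Implicit Types (U : set 'rV[R]_4) (y : rV8).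

Local Notation above U := [set y : rV8 | U (base y)].

Lemma base_continuous : continuous (@base R).
Proof. exact: continuous_lsubmx. Qed.

Lemma open_above U : open U -> open (above U).
Proof. by move=> oU; apply: open_comp => // y _; exact: base_continuous. Qed.

(** Since [base] is linear, the difference quotients coincide literally. Derivatives therefore
    transfer from directional derivability alone, which would not suffice for a chain rule. *)
Lemma growth_base (f : 'rV[R]_4 -> R) y (v : rV8) :
  (fun h : R => h^-1 *: (((f \o @base R) \o shift y) (h *: v) - f (base y)))
  = (fun h => h^-1 *: ((f \o shift (base y)) (h *: base v) - f (base y))).
Proof.
apply: funext => h /=; congr (_ *: (f _ - _)).
by apply/rowP => j; rewrite /base !mxE.
Qed.

Lemma derivable_base (f : 'rV[R]_4 -> R) y (v : rV8) :
  derivable f (base y) (base v) -> derivable (f \o @base R) y v.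
Proof. by rewrite /derivable growth_base. Qed.

Lemma derive_base (f : 'rV[R]_4 -> R) y (v : rV8) :
  'D_v (f \o @base R) y = 'D_(base v) f (base y).
Proof. by rewrite /derive growth_base. Qed.

Lemma base_lshift (a : 'I_4) :
  base (delta_mx 0 (lshift 4 a) : rV8) = delta_mx 0 a.
Proof.
by apply/rowP => j; rewrite !mxE eq_shift.
Qed.

Lemma base_rshift (a : 'I_4) : base (delta_mx 0 (rshift 4 a) : rV8) = 0.
Proof. by apply/rowP => j; rewrite !mxE eq_shift. Qed.

Lemma partial_base_l (f : 'rV[R]_4 -> R) y a :
  partial (lshift 4 a) (f \o @base R) y = partial a f (base y).
Proof. by rewrite /partial derive_base base_lshift. Qed.

Lemma partial_base_r (f : 'rV[R]_4 -> R) y a :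
  partial (rshift 4 a) (f \o @base R) y = 0.
Proof. by rewrite /partial derive_base base_rshift derive0. Qed.

Lemma smooth_base U f : open U -> smooth U f -> smooth (above U) (f \o @base R).
Proof.
move=> oU sf k; elim: k f sf => [|k IH] f sf /=.
  move=> y Uy; apply: continuous_comp; first exact: base_continuous.
  exact: (smooth_continuous sf Uy).
split=> [y a Uy|a].
  apply: derivable_base; case: (split_ordP a) => b ->.
    by rewrite base_lshift; exact: (smooth_derivable sf Uy).
  by rewrite base_rshift; exact: derivable0.
case: (split_ordP a) => b ->.
  rewrite (_ : partial _ _ = partial b f \o @base R).
    exact: (IH _ (smooth_partial b sf)).
  by apply: funext => y; rewrite partial_base_l.
rewrite (_ : partial _ _ = cst 0).
  exact: (smooth_cst (open_above oU) 0 k).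
by apply: funext => y; rewrite partial_base_r.
Qed.

Lemma csmooth_base U (f : 'rV[R]_4 -> C) : open U -> csmooth U f ->
  csmooth (above U) (fun y => f (base y)).
Proof.
move=> oU [fr fi]; split; first exact: (smooth_base oU fr).
exact: (smooth_base oU fi).
Qed.

Lemma cpartial_base_l (f : 'rV[R]_4 -> C) y a :
  cpartial (lshift 4 a) (fun y => f (base y)) y = cpartial a f (base y).
Proof.
exact: (congr2 (@Complex R) (partial_base_l (fun x => complex.Re (f x)) y a)
  (partial_base_l (fun x => complex.Im (f x)) y a)).
Qed.

Lemma cpartial_base_r (f : 'rV[R]_4 -> C) y a :
  cpartial (rshift 4 a) (fun y => f (base y)) y = 0.
Proof.
exact: (congr2 (@Complex R) (partial_base_r (fun x => complex.Re (f x)) y a)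
  (partial_base_r (fun x => complex.Im (f x)) y a)).
Qed.

Lemma csmooth_mx_base U p q (F : 'rV[R]_4 -> 'M[C]_(p, q)) : open U ->
  csmooth_mx U F -> csmooth_mx (above U) (fun y => F (base y)).
Proof. by move=> oU sF i j; exact: (csmooth_base oU (sF i j)). Qed.

Lemma csmooth_pullback U al : open U -> csmooth_mx U al ->
  csmooth_mx (above U) (pullback al).
Proof.
move=> oU sal i j; case: (split_ordP j) => k ->.
  apply: csmooth_ext (csmooth_base oU (sal i k)); first exact: open_above.
  by move=> y _; rewrite /pullback row_mxEl.
apply: csmooth_ext (csmooth_cst (open_above oU) (0 : C)); first exact: open_above.
by move=> y _; rewrite /pullback row_mxEr mxE.
Qed.

Lemma sum_ord8 (F : 'I_(4 + 4) -> C) :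
  \sum_i F i = \sum_(i < 4) F (lshift 4 i) + \sum_(i < 4) F (rshift 4 i).
Proof. exact: big_split_ord. Qed.

Lemma pairing_pullback al y (X : 'rV[C]_(4 + 4)) :
  pairing (pullback al y) X = pairing (al (base y)) (lsubmx X).
Proof.
rewrite /pairing sum_ord8 [X in _ + X]big1 => [|a _].
  by rewrite addr0; apply: eq_bigr => a _; rewrite /pullback row_mxEl [lsubmx X 0 a]mxE.
by rewrite /pullback row_mxEr mxE mul0r.
Qed.

Lemma eval2_diff1_pullback (al : 'rV[R]_4 -> 'rV[C]_4) y (X Y : 'rV[C]_(4 + 4)) :
  eval2 (diff1 (pullback al) y) X Y
  = eval2 (diff1 al (base y)) (lsubmx X) (lsubmx Y).
Proof.
have pl (b : 'I_4) : (fun y => pullback al y 0 (lshift 4 b)) = (fun y => al (base y) 0 b).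
  by apply: funext => z; rewrite /pullback row_mxEl.
have pr (b : 'I_4) : (fun y => pullback al y 0 (rshift 4 b)) = (fun=> 0).
  by apply: funext => z; rewrite /pullback row_mxEr mxE.
have Ell a b : diff1 (pullback al) y (lshift 4 a) (lshift 4 b) = diff1 al (base y) a b.
  by rewrite !mxE !pl (cpartial_base_l (fun x => al x 0 b)) (cpartial_base_l (fun x => al x 0 a)).
have Elr a b : diff1 (pullback al) y (lshift 4 a) (rshift 4 b) = 0.
  by rewrite !mxE pl pr (cpartial_base_r (fun x => al x 0 a)) cpartial_cst subrr.
have Erl a b : diff1 (pullback al) y (rshift 4 a) (lshift 4 b) = 0.
  by rewrite !mxE pl pr (cpartial_base_r (fun x => al x 0 b)) cpartial_cst subrr.
have Err a b : diff1 (pullback al) y (rshift 4 a) (rshift 4 b) = 0.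
  by rewrite !mxE !pr !cpartial_cst subrr.
rewrite /eval2 sum_ord8 [X in _ + X]big1 => [|a _]; last first.
  rewrite sum_ord8 big1 => [|b _]; last by rewrite Erl mulr0.
  by rewrite big1 ?addr0 // => b _; rewrite Err mulr0.
rewrite addr0; apply: eq_bigr => a _.
rewrite sum_ord8 [X in _ + X]big1 => [|b _]; last by rewrite Elr mulr0.
by rewrite addr0; apply: eq_bigr => b _; rewrite Ell [lsubmx X 0 a]mxE [lsubmx Y 0 b]mxE.
Qed.

Lemma csmooth_fiber_coord V (j k : 'I_4) : open V ->
  csmooth V (fun y : rV8 => rsubmx y 0 j +i* rsubmx y 0 k).
Proof.
move=> oV; split; [pose i := j|pose i := k];
  apply: smooth_ext (smooth_coord (rshift 4 i) oV) => // y _; by rewrite /= mxE.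
Qed.

Lemma partial_coord (i a : 'I_(4 + 4)) y :
  partial a (fun y : rV8 => y 0 i) y = (a == i)%:R.
Proof.
have := derive_mx (@derivable_id _ _ y (delta_mx 0 a : rV8)); rewrite derive_id.
by move=> /matrixP/(_ 0 i); rewrite /partial !mxE /= => <-; rewrite eq_sym.
Qed.

Lemma diff0_fiber_coord (j k : 'I_4) y :
  diff0 (fun y : rV8 => rsubmx y 0 j +i* rsubmx y 0 k) y
  = row_mx 0 (delta_mx 0 j + (0 +i* 1) *: delta_mx 0 k).
Proof.
have E i : (fun y : rV8 => rsubmx y 0 i) = (fun y : rV8 => y 0 (rshift 4 i)).
  by apply: funext => z; rewrite mxE.
apply/rowP => a; rewrite mxE /cpartial /= !E !partial_coord.
case: (split_ordP a) => b ->.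
  by rewrite row_mxEl mxE !eq_shift.
rewrite row_mxEr !mxE !eq_shift /=.
by apply/eqP; rewrite eq_complex; case: (b == j); case: (b == k);
  rewrite /= ?mulr0 ?mulr1 ?mul0r ?mul1r ?addr0 ?add0r ?subr0 ?sub0r ?oppr0 !eqxx.
Qed.

End pullbacks.

(** * Pointwise identities behind dE, dF and dH *)

Section connection_identities.
Variables (R : realType).
Local Notation C := R[i].
Local Notation g0 := (@null_gram R).
Implicit Types (s : bool) (c w : 'I_4 -> 'I_4 -> C) (t : 'I_4 -> C).

(** The metric equation of a Weyl connection in a null cotetrad, evaluated on one vector: [c] holds
    the values of the connection forms and [al] that of A. *)
Definition gram_form c (al : C) : Prop := forall i j,
  \sum_h g0 i h * c h j + \sum_h g0 j h * c h i = al * g0 i j.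

Lemma gram_formE c al : gram_form c al ->
  (((c i1 i2 = 0) * (c i2 i1 = 0) * (c i3 i4 = 0) * (c i4 i3 = 0)) *
   ((c i2 i2 = al - c i1 i1)%R * (c i3 i3 = al - c i4 i4)%R) *
   ((c i4 i1 = c i2 i3) * (c i3 i1 = c i2 i4) *
    (c i4 i2 = c i1 i3) * (c i3 i2 = c i1 i4)))%type.
Proof.
move=> gram.
have h i j : g0 i i1 * c i1 j + g0 i i2 * c i2 j + g0 i i3 * c i3 j + g0 i i4 * c i4 j
  + (g0 j i1 * c i1 i + g0 j i2 * c i2 i + g0 j i3 * c i3 i + g0 j i4 * c i4 i)
  = al * g0 i j by have := gram i j; rewrite !sum4.
do !split.
- by have := h i2 i2; rewrite !mxE /= => e; apply: (lcP e); field.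
- by have := h i1 i1; rewrite !mxE /= => e; apply: (lcP e); field.
- by have := h i4 i4; rewrite !mxE /= => e; apply: (lcP (lcZ (-1) e)); field.
- by have := h i3 i3; rewrite !mxE /= => e; apply: (lcP (lcZ (-1) e)); field.
- by have := h i1 i2; rewrite !mxE /= => e; apply: (lcP (lcZ 2 e)); field.
- by have := h i3 i4; rewrite !mxE /= => e; apply: (lcP (lcZ (-2) e)); field.
- by have := h i1 i3; rewrite !mxE /= => e; apply: (lcP (lcZ (-2) e)); field.
- by have := h i1 i4; rewrite !mxE /= => e; apply: (lcP (lcZ (-2) e)); field.
- by have := h i2 i3; rewrite !mxE /= => e; apply: (lcP (lcZ (-2) e)); field.
- by have := h i2 i4; rewrite !mxE /= => e; apply: (lcP (lcZ (-2) e)); field.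
Qed.

Lemma gram_form_swap s c al : gram_form c al ->
  gram_form (fun i j => c (swap s i) (swap s j)) al.
Proof.
move=> gram i j; rewrite -(swap_gram R s i j) -gram -!(sum_swap s (fun h => _ * c h _)).
by congr (_ + _); apply: eq_bigr => h _; rewrite swap_gram.
Qed.

(** The part of E other than dz, as a function of a matrix of scalars. It is applied to values of
    the connection forms, of the curvature forms, and of the difference of two connections. *)
Definition twistor_form c (z : C) : C :=
  - c i3 i2 + z * (c i1 i1 - c i4 i4) + z ^+ 2 * c i2 i3.

(* [d], [d'] are the values of dz, and [c], [c'] those of the connection
   forms, on two vectors annihilated by E. *)
Lemma twistor_curvature_identity c c' dc w al al' z d d' :
  gram_form c al -> gram_form c' al' ->
  (forall i j, w i j = dc i j + \sum_k (c i k * c' k j - c' i k * c k j)) ->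
  d + twistor_form c z = 0 -> d' + twistor_form c' z = 0 ->
  - dc i3 i2 + (d * (c' i1 i1 - c' i4 i4) - d' * (c i1 i1 - c i4 i4)
     + z * (dc i1 i1 - dc i4 i4))
  + (2 * z * d * c' i2 i3 - 2 * z * d' * c i2 i3 + z ^+ 2 * dc i2 i3) = twistor_form w z.
Proof.
have N (a b : C) : a + b = 0 -> a = - b by move/eqP; rewrite addr_eq0 => /eqP.
move=> /gram_formE g /gram_formE g' wE /N -> /N ->.
by rewrite /twistor_form !wE !sum4 !g !g'; ring.
Qed.

(** The conclusions are the values of dF = dM + dz /\ K + z dK and of dH = dN + dz /\ P + z dP. The
    torsion equation gives the values [ta] of the d th^i, E = 0 eliminates dz, and F = H = 0
    eliminate the components 1 and 3; everything then cancels. *)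
Lemma twistor_torsion_identity c c' t t' ta al al' z d d' :
  gram_form c al -> gram_form c' al' ->
  (forall i, ta i = - \sum_j (c i j * t' j - c' i j * t j)) ->
  d + twistor_form c z = 0 -> d' + twistor_form c' z = 0 ->
  t i1 + z * t i4 = 0 -> t' i1 + z * t' i4 = 0 ->
  t i3 + z * t i2 = 0 -> t' i3 + z * t' i2 = 0 ->
  ta i1 + (d * t' i4 - d' * t i4 + z * ta i4) = 0 /\
  ta i3 + (d * t' i2 - d' * t i2 + z * ta i2) = 0.
Proof.
have N (a b : C) : a + b = 0 -> a = - b by move/eqP; rewrite addr_eq0 => /eqP.
move=> /gram_formE g /gram_formE g' tE /N -> /N -> /N e1 /N e1' /N e3 /N e3'.
by rewrite /twistor_form !tE !sum4 !e1 !e1' !e3 !e3' !g !g'; split; ring.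
Qed.

(** The hypotheses say that the vectors are [- t4 (z m - k) - t2 (z n - p)] and the same with [t'];
    the first factor is the determinant of these coefficients. *)
Lemma on_sd_planeE (B : 'I_4 -> 'I_4 -> C) t t' z : (forall k l, B k l = - B l k) ->
  t i1 + z * t i4 = 0 -> t' i1 + z * t' i4 = 0 ->
  t i3 + z * t i2 = 0 -> t' i3 + z * t' i2 = 0 ->
  \sum_k \sum_l t k * t' l * B k l
  = (t i4 * t' i2 - t i2 * t' i4) * on_sd_plane B z.
Proof.
have N (a b : C) : a + b = 0 -> a = - b by move/eqP; rewrite addr_eq0 => /eqP.
move=> alt /N e1 /N e2 /N e3 /N e4.
have B0 k : B k k = 0 by apply: (lcP (lcZ (2^-1) (alt k k))); field.
rewrite !sum4 !e1 !e2 !e3 !e4 /on_sd_plane !B0 (alt i2 i1) (alt i3 i1) (alt i4 i1)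
  (alt i3 i2) (alt i4 i2) (alt i4 i3); ring.
Qed.

End connection_identities.

Lemma eval2E (R : realType) n (B : 'M[R[i]]_n) (X Y : 'rV[R[i]]_n) :
  eval2 B X Y = (X *m B *m Y^T) 0 0.
Proof.
rewrite mxE /eval2 exchange_big /=; apply: eq_bigr => b _.
rewrite [(X *m B) 0 b]mxE mulr_suml; apply: eq_bigr => a _.
by rewrite [Y^T b 0]mxE mulrAC.
Qed.

Lemma eval2_frame (R : realType) (t B : 'M[R[i]]_4) (X Y : 'rV[R[i]]_4) : t \in unitmx ->
  eval2 B X Y = \sum_k \sum_l pairing (row k t) X * pairing (row l t) Y
                              * frame_components t B k l.
Proof.
move=> ut.
have E k (Z : 'rV[R[i]]_4) : pairing (row k t) Z = (Z *m t^T) 0 k.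
  by rewrite mxE; apply: eq_bigr => a _; rewrite !mxE mulrC.
under eq_bigr do under eq_bigr do rewrite !E.
rewrite -[RHS]/(eval2 (frame_components t B) (X *m t^T) (Y *m t^T)) !eval2E.
rewrite /frame_components trmx_mul trmxK.
rewrite -!mulmxA (mulmxA t^T) -trmx_mul mulVmx // trmx1 mul1mx.
by rewrite (mulmxA (invmx t)) mulVmx // mul1mx.
Qed.

Lemma eval2_shape (R : realType) n (B1 B2 B3 B4 W1 W2 : 'M[R[i]]_n) a b X Y :
  eval2 (- B1 + (W1 + a *: (B2 - B3)) + (W2 + b *: B4)) X Y
  = - eval2 B1 X Y + (eval2 W1 X Y + a * (eval2 B2 X Y - eval2 B3 X Y))
    + (eval2 W2 X Y + b * eval2 B4 X Y).
Proof. by rewrite !eval2D !eval2N !eval2Z eval2B. Qed.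

(** * Exterior derivatives of E, F and H on the bundle *)

Section twistor_forms_calculus.
Variables (R : realType).
Local Notation C := R[i].
Local Notation rV8 := 'rV[R]_(4 + 4).
Local Notation g0 := (@null_gram R).
Local Notation above U := [set y : rV8 | U (base y)].
Implicit Types (s : bool) (y : rV8) (X Y : 'rV[C]_(4 + 4)).

Definition twz s y : C := if s then zcoord' y else zcoord y.
Definition twdz s : 'rV[C]_(4 + 4) := if s then dz' R else dz R.

Lemma csmooth_twz s V : open V -> csmooth V (twz s).
Proof. by case: s => oV; exact: csmooth_fiber_coord. Qed.

Lemma diff0_twz s y : diff0 (twz s) y = twdz s.
Proof. by case: s; exact: diff0_fiber_coord. Qed.

Section connection.
Variables (th : 'rV[R]_4 -> 'M[C]_4) (Ga : 'I_4 -> 'I_4 -> 'rV[R]_4 -> 'rV[C]_4).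

Let Gp (i j : 'I_4) := pullback (Ga i j).
Let tp (i : 'I_4) := pullback (fun x => row i (th x)).

Definition twE s y : 'rV[C]_(4 + 4) :=
  twdz s - Gp (swap s i3) (swap s i2) y
  + twz s y *: (Gp (swap s i1) (swap s i1) y - Gp (swap s i4) (swap s i4) y)
  + twz s y ^+ 2 *: Gp (swap s i2) (swap s i3) y.

Definition twF s y : 'rV[C]_(4 + 4) := tp (swap s i1) y + twz s y *: tp (swap s i4) y.
Definition twH s y : 'rV[C]_(4 + 4) := tp (swap s i3) y + twz s y *: tp (swap s i2) y.

Definition tw_bundle s y X : Prop :=
  [/\ pairing (twF s y) X = 0, pairing (twH s y) X = 0,
      pairing (twE s y) X = 0 & pairing (twE (~~ s) y) X = 0].

Lemma twF_pairing s y X : pairing (twF s y) X =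
  pairing (row (swap s i1) (th (base y))) (lsubmx X)
  + twz s y * pairing (row (swap s i4) (th (base y))) (lsubmx X).
Proof. by rewrite pairingD pairingZ !pairing_pullback. Qed.

Lemma twH_pairing s y X : pairing (twH s y) X =
  pairing (row (swap s i3) (th (base y))) (lsubmx X)
  + twz s y * pairing (row (swap s i2) (th (base y))) (lsubmx X).
Proof. by rewrite pairingD pairingZ !pairing_pullback. Qed.

Lemma twE_pairing s y X : pairing (twE s y) X = pairing (twdz s) X
  + twistor_form (fun i j => pairing (Ga (swap s i) (swap s j) (base y)) (lsubmx X)) (twz s y).
Proof.
rewrite /twE !(pairingD, pairingN, pairingZ) !pairing_pullback /twistor_form.
by rewrite !addrA.
Qed.

Lemma twE_false y : twE false y = formE Ga y.
Proof. by rewrite /twE /formE /twdz /twz /swap /=. Qed.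

Lemma twE_true y : twE true y = formE' Ga y.
Proof. by rewrite /twE /formE' /twdz /twz /swap /=. Qed.

Lemma twF_false y : twF false y = formF th y.
Proof. by rewrite /twF /formF /twz /swap /=. Qed.

Lemma twF_true y : twF true y = formF' th y.
Proof. by rewrite /twF /formF' /twz /swap /=. Qed.

Lemma bundleNF_tw y X : bundleNF th Ga y X <-> tw_bundle false y X.
Proof.
have E : pairing (formLambda th y) X
   = - pairing (twH false y) X - zcoord' y * pairing (twF false y) X.
  rewrite /formLambda !pairingB !pairingN !pairingZ !pairing_pullback.
  by rewrite twH_pairing twF_pairing /=; ring.
have p al be : al = be -> pairing al X = 0 -> pairing be X = 0 by move=> ->.
split=> [[L F E1 E2]|[F H E1 E2]].
  have F' := p _ _ (esym (twF_false y)) F.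
  split; [exact: F'| |exact: (p _ _ (esym (twE_false y)) E1)|exact: (p _ _ (esym (twE_true y)) E2)].
  by move/eqP: L; rewrite E F' mulr0 subr0 oppr_eq0 => /eqP.
have L : pairing (formLambda th y) X = 0 by rewrite E H F oppr0 mulr0 subr0.
split; [exact: L|exact: (p _ _ (twF_false y) F)|
  exact: (p _ _ (twE_false y) E1)|exact: (p _ _ (twE_true y) E2)].
Qed.

Lemma bundleNF'_tw y X : bundleNF' th Ga y X <-> tw_bundle true y X.
Proof.
have E : pairing (formLambda th y) X
   = - pairing (twH true y) X - zcoord y * pairing (twF true y) X.
  rewrite /formLambda !pairingB !pairingN !pairingZ !pairing_pullback.
  by rewrite twH_pairing twF_pairing /=; ring.
have p al be : al = be -> pairing al X = 0 -> pairing be X = 0 by move=> ->.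
split=> [[L F E1 E2]|[F H E1 E2]].
  have F' := p _ _ (esym (twF_true y)) F.
  split; [exact: F'| |exact: (p _ _ (esym (twE_true y)) E2)|exact: (p _ _ (esym (twE_false y)) E1)].
  by move/eqP: L; rewrite E F' mulr0 subr0 oppr_eq0 => /eqP.
have L : pairing (formLambda th y) X = 0 by rewrite E H F oppr0 mulr0 subr0.
split; [exact: L|exact: (p _ _ (twF_true y) F)|
  exact: (p _ _ (twE_false y) E2)|exact: (p _ _ (twE_true y) E1)].
Qed.

Section derivatives.
Variables (U : set 'rV[R]_4) (G : 'rV[R]_4 -> 'M[C]_4) (A : 'rV[R]_4 -> 'rV[C]_4).
Hypothesis oU : open U.
Hypotheses (sth : csmooth_mx U th) (uth : forall x, U x -> th x \in unitmx).
Hypothesis conn : weyl_connection U th G A Ga.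
Hypothesis nullG : forall x, U x -> gframe th G x = g0.

Let oV : open (above U). Proof. exact: open_above. Qed.

Lemma csmooth_tp i : csmooth_mx (above U) (tp i).
Proof.
apply: csmooth_pullback => // k j.
by apply: csmooth_ext (sth i j) => // x _; rewrite mxE.
Qed.

Lemma csmooth_Gp i j : csmooth_mx (above U) (Gp i j).
Proof. by apply: csmooth_pullback => //; case: conn. Qed.

Let sz s : csmooth (above U) (twz s). Proof. exact: csmooth_twz. Qed.

Let sz2 s : csmooth (above U) (fun y => twz s y ^+ 2).
Proof. exact: (csmoothM oV (sz s) (sz s)). Qed.

Lemma csmooth_twF s : csmooth_mx (above U) (twF s).
Proof. by apply: csmooth_mxD => //; [|apply: csmooth_mxZ => //]; exact: csmooth_tp. Qed.

Lemma csmooth_twH s : csmooth_mx (above U) (twH s).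
Proof. by apply: csmooth_mxD => //; [|apply: csmooth_mxZ => //]; exact: csmooth_tp. Qed.

Let sdz s : csmooth_mx (above U) (fun y : rV8 => twdz s).
Proof. exact: csmooth_mx_cst. Qed.

Let sE1 s : csmooth_mx (above U) (fun y => twdz s - Gp (swap s i3) (swap s i2) y).
Proof. by apply: csmooth_mxB => //; exact: csmooth_Gp. Qed.

Let sE2 s : csmooth_mx (above U)
  (fun y => Gp (swap s i1) (swap s i1) y - Gp (swap s i4) (swap s i4) y).
Proof. by apply: csmooth_mxB => //; exact: csmooth_Gp. Qed.

Lemma csmooth_twE s : csmooth_mx (above U) (twE s).
Proof.
apply: csmooth_mxD => //; last by apply: csmooth_mxZ => //; exact: csmooth_Gp.
by apply: csmooth_mxD => //; exact: csmooth_mxZ.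
Qed.

Lemma pairing_sum (n : nat) (I : finType) (F : I -> 'rV[C]_n) (v : 'rV[C]_n) :
  pairing (\sum_i F i) v = \sum_i pairing (F i) v.
Proof.
have p0 : pairing (0 : 'rV[C]_n) v = 0.
  by rewrite /pairing big1 // => a _; rewrite mxE mul0r.
exact: (big_morph (fun al => pairing al v) (fun al be => pairingD al be v) p0).
Qed.

Lemma gram_form_connection x v : U x ->
  gram_form (fun i j => pairing (Ga i j x) v) (pairing (A x) v).
Proof.
move=> Ux i j; have [_ m _] := conn.
have := m x i j Ux; rewrite nullG //.
have -> : diff0 (fun x' => gframe th G x' i j) x = 0.
  apply/rowP => a; rewrite !mxE -(cpartial_cst a (g0 i j) x).
  by apply: (cpartial_ext oU) => // z Uz; rewrite nullG.
rewrite sub0r => /oppr_inj /(congr1 (fun al => pairing al v)).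
rewrite pairing_sum pairingZ mulrC => <-; rewrite -big_split; apply: eq_bigr => k _ /=.
by rewrite pairingD !pairingZ.
Qed.

Lemma eval2_curvature_form i j x v w : eval2 (curvature_form Ga i j x) v w
  = eval2 (diff1 (Ga i j) x) v w
    + \sum_k (pairing (Ga i k x) v * pairing (Ga k j x) w
              - pairing (Ga i k x) w * pairing (Ga k j x) v).
Proof.
rewrite eval2D eval2_sum; congr (_ + _); apply: eq_bigr => k _.
exact: eval2_wedge.
Qed.

Lemma eval2_torsion i x v w : U x -> eval2 (diff1 (fun x => row i (th x)) x) v w
  = - \sum_j (pairing (Ga i j x) v * pairing (row j (th x)) w
              - pairing (Ga i j x) w * pairing (row j (th x)) v).
Proof.
move=> Ux; have [_ _ t] := conn.
rewrite t // eval2N eval2_sum; congr (- _); apply: eq_bigr => k _.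
exact: eval2_wedge.
Qed.

Lemma diff0_sqr s y : above U y ->
  diff0 (fun y => twz s y ^+ 2) y = (2 * twz s y) *: twdz s.
Proof.
move=> Uy; rewrite -(diff0_twz s y); apply/rowP => a; rewrite mxE mx_scaleE mxE.
apply: (etrans (cpartialM oV a (sz s) (sz s) Uy)); ring.
Qed.

(** On vectors annihilated by E, dz equals minus the connection part of E. The terms of dE with a
    factor dz thereby become the quadratic terms of the curvature, and the fibre components of [X],
    [Y] drop out. *)
Lemma eval2_diff1_twE s y X Y : above U y ->
  pairing (twE s y) X = 0 -> pairing (twE s y) Y = 0 ->
  eval2 (diff1 (twE s) y) X Y
  = twistor_form (fun i j => eval2 (curvature_form Ga (swap s i) (swap s j) (base y))
                               (lsubmx X) (lsubmx Y)) (twz s y).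
Proof.
move=> Uy EX EY.
have -> : diff1 (twE s) y =
   - diff1 (Gp (swap s i3) (swap s i2)) y
   + (wedge (twdz s) (Gp (swap s i1) (swap s i1) y - Gp (swap s i4) (swap s i4) y)
      + twz s y *: (diff1 (Gp (swap s i1) (swap s i1)) y
                    - diff1 (Gp (swap s i4) (swap s i4)) y))
   + (wedge ((2 * twz s y) *: twdz s) (Gp (swap s i2) (swap s i3) y)
      + twz s y ^+ 2 *: diff1 (Gp (swap s i2) (swap s i3)) y).
  have sG i j := csmooth_Gp i j.
  have s2 := csmooth_mxZ oV (sz s) (sE2 s).
  have s3 := csmooth_mxZ oV (sz2 s) (sG (swap s i2) (swap s i3)).
  have sN i j := csmooth_mxN oV (sG i j).
  apply: (etrans (diff1D (csmooth_mxD oV (sE1 s) s2) s3 Uy)); congr (_ + _); last first.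
    rewrite -(diff0_sqr s Uy).
    exact: (diff1Z oV (sz2 s) (sG (swap s i2) (swap s i3)) Uy).
  apply: (etrans (diff1D (sE1 s) s2 Uy)); congr (_ + _).
    apply: (etrans (diff1D (sdz s) (sN _ _) Uy)); rewrite diff1_cst add0r.
    exact: (diff1N (sG _ _) Uy).
  apply: (etrans (diff1Z oV (sz s) (sE2 s) Uy)); congr (wedge _ _ + _ *: _).
    exact: diff0_twz.
  apply: (etrans (diff1D (sG _ _) (sN _ _) Uy)); congr (_ + _).
  exact: (diff1N (sG _ _) Uy).
rewrite eval2_shape 2!eval2_wedge !pairingZ !pairingB.
rewrite !eval2_diff1_pullback !pairing_pullback.
move: EX EY; rewrite !twE_pairing; move: (twz s y) (pairing (twdz s) _) (pairing (twdz s) _).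
have : U (base y) by [].
move: (base y) (lsubmx X) (lsubmx Y) => x v w Ux z d d' EX EY.
have gv := gram_form_swap s (gram_form_connection v Ux).
have gw := gram_form_swap s (gram_form_connection w Ux).
have wE i j : eval2 (curvature_form Ga (swap s i) (swap s j) x) v w
   = eval2 (diff1 (Ga (swap s i) (swap s j)) x) v w
    + \sum_k (pairing (Ga (swap s i) (swap s k) x) v * pairing (Ga (swap s k) (swap s j) x) w
              - pairing (Ga (swap s i) (swap s k) x) w * pairing (Ga (swap s k) (swap s j) x) v).
  rewrite eval2_curvature_form; congr (_ + _).
  exact: (esym (sum_swap s (fun k => pairing (Ga (swap s i) k x) v * pairing (Ga k (swap s j) x) w
    - pairing (Ga (swap s i) k x) w * pairing (Ga k (swap s j) x) v))).
exact: (twistor_curvature_identity gv gw wE EX EY).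
Qed.

Lemma eval2_diff1_twF_twH s y X Y : above U y ->
  [/\ pairing (twF s y) X = 0, pairing (twH s y) X = 0 & pairing (twE s y) X = 0] ->
  [/\ pairing (twF s y) Y = 0, pairing (twH s y) Y = 0 & pairing (twE s y) Y = 0] ->
  eval2 (diff1 (twF s) y) X Y = 0 /\ eval2 (diff1 (twH s) y) X Y = 0.
Proof.
move=> Uy [FX HX EX] [FY HY EY].
have D i j : diff1 (fun y => tp i y + twz s y *: tp j y) y
    = diff1 (tp i) y + (wedge (twdz s) (tp j y) + twz s y *: diff1 (tp j) y).
  apply: (etrans (diff1D (csmooth_tp i) (csmooth_mxZ oV (sz s) (csmooth_tp j)) Uy)).
  rewrite -(diff0_twz s y); congr (_ + _).
  exact: (diff1Z oV (sz s) (csmooth_tp j) Uy).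
have Dv i j : eval2 (diff1 (fun y => tp i y + twz s y *: tp j y) y) X Y
    = eval2 (diff1 (fun x => row i (th x)) (base y)) (lsubmx X) (lsubmx Y)
      + (pairing (twdz s) X * pairing (row j (th (base y))) (lsubmx Y)
         - pairing (twdz s) Y * pairing (row j (th (base y))) (lsubmx X)
         + twz s y * eval2 (diff1 (fun x => row j (th x)) (base y)) (lsubmx X) (lsubmx Y)).
  by rewrite D 2!eval2D eval2Z eval2_wedge !eval2_diff1_pullback !pairing_pullback.
have e1 := Dv (swap s i1) (swap s i4); have e2 := Dv (swap s i3) (swap s i2).
suff [h1 h2] : 
  eval2 (diff1 (fun x => row (swap s i1) (th x)) (base y)) (lsubmx X) (lsubmx Y)
      + (pairing (twdz s) X * pairing (row (swap s i4) (th (base y))) (lsubmx Y)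
         - pairing (twdz s) Y * pairing (row (swap s i4) (th (base y))) (lsubmx X)
         + twz s y * eval2 (diff1 (fun x => row (swap s i4) (th x)) (base y)) (lsubmx X) (lsubmx Y)) = 0
  /\ eval2 (diff1 (fun x => row (swap s i3) (th x)) (base y)) (lsubmx X) (lsubmx Y)
      + (pairing (twdz s) X * pairing (row (swap s i2) (th (base y))) (lsubmx Y)
         - pairing (twdz s) Y * pairing (row (swap s i2) (th (base y))) (lsubmx X)
         + twz s y * eval2 (diff1 (fun x => row (swap s i2) (th x)) (base y)) (lsubmx X) (lsubmx Y)) = 0.
  by split; [exact: etrans e1 h1|exact: etrans e2 h2].
move: FX FY HX HY EX EY; rewrite !twE_pairing !twF_pairing !twH_pairing {e1 e2 Dv D}.
have Ux : U (base y) by [].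
move: Ux (twz s y) (pairing (twdz s) _) (pairing (twdz s) _).
move: (base y) (lsubmx X) (lsubmx Y) => x v w Ux z d d' FX FY HX HY EX EY.
have gv := gram_form_swap s (gram_form_connection v Ux).
have gw := gram_form_swap s (gram_form_connection w Ux).
pose ta i := eval2 (diff1 (fun x => row (swap s i) (th x)) x) v w.
have tE i : ta i = - \sum_j (pairing (Ga (swap s i) (swap s j) x) v * pairing (row (swap s j) (th x)) w
              - pairing (Ga (swap s i) (swap s j) x) w * pairing (row (swap s j) (th x)) v).
  rewrite /ta eval2_torsion //; congr (- _).
  exact: (esym (sum_swap s (fun j => pairing (Ga (swap s i) j x) v * pairing (row j (th x)) w
              - pairing (Ga (swap s i) j x) w * pairing (row j (th x)) v))).
exact: (twistor_torsion_identity (t := fun i => pairing (row (swap s i) (th x)) v)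
  (t' := fun i => pairing (row (swap s i) (th x)) w) (ta := ta) gv gw tE EX EY FX FY HX HY).
Qed.

End derivatives.

End connection.

End twistor_forms_calculus.

Section twistor_curvature.
Variables (R : realType).
Local Notation C := R[i].
Local Notation rV8 := 'rV[R]_(4 + 4).
Local Notation g0 := (@null_gram R).
Local Notation above U := [set y : rV8 | U (base y)].
Implicit Types (s : bool) (y : rV8) (X Y : 'rV[C]_(4 + 4)).

Lemma swapN s i : swap (~~ s) i = swap s (swap true i).
Proof. by case: s; rewrite ?swapK. Qed.

Lemma twistor_form_ext (c c' : 'I_4 -> 'I_4 -> C) z : (forall i j, c i j = c' i j) ->
  twistor_form c z = twistor_form c' z.
Proof. by move=> cc'; rewrite /twistor_form !cc'. Qed.

Lemma twistor_form_sd r (a z : C) :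
  twistor_form (fun i j => a * on_sd_plane (r i j) z) z = a * sd_curv_poly r z.
Proof. by rewrite /twistor_form /sd_curv_poly /on_sd_plane; ring. Qed.

Lemma twistor_form_asd r (a z z' : C) :
  twistor_form (fun i j => a * on_sd_plane (r (swap true i) (swap true j)) z) z'
  = a * asd_curv_poly r z z'.
Proof. by rewrite /twistor_form /asd_curv_poly /on_sd_plane /swap /=; ring. Qed.

Variables (th : 'rV[R]_4 -> 'M[C]_4) (Ga : 'I_4 -> 'I_4 -> 'rV[R]_4 -> 'rV[C]_4).
Variables (U : set 'rV[R]_4) (G : 'rV[R]_4 -> 'M[C]_4) (A : 'rV[R]_4 -> 'rV[C]_4).
Hypothesis oU : open U.
Hypotheses (sth : csmooth_mx U th) (uth : forall x, U x -> th x \in unitmx).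
Hypothesis conn : weyl_connection U th G A Ga.
Hypothesis nullG : forall x, U x -> gframe th G x = g0.

Definition null_comp s y X i : C := pairing (row (swap s i) (th (base y))) (lsubmx X).

(** The determinant of the projections of [X] and [Y] in the basis of the null plane. By
    [on_sd_planeE] every 2-form on the plane takes this multiple of its value on the basis. *)
Definition plane_area s y X Y : C :=
  null_comp s y X i4 * null_comp s y Y i2 - null_comp s y X i2 * null_comp s y Y i4.

Definition curv_at s y := swap_curv s (fun i j => frame_curv th Ga i j (base y)).

Lemma curvature_on_plane s y X Y i j : U (base y) ->
  pairing (twF th s y) X = 0 -> pairing (twH th s y) X = 0 ->
  pairing (twF th s y) Y = 0 -> pairing (twH th s y) Y = 0 ->
  eval2 (curvature_form Ga (swap s i) (swap s j) (base y)) (lsubmx X) (lsubmx Y)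
  = plane_area s y X Y * on_sd_plane (curv_at s y i j) (twz s y).
Proof.
move=> Uy; rewrite !twF_pairing !twH_pairing => FX HX FY HY.
rewrite (eval2_frame _ _ _ (uth Uy)).
rewrite -(sum_swap s); under eq_bigr do rewrite -(sum_swap s).
have alt k l : curv_at s y i j k l = - curv_at s y i j l k by exact: frame_curv_alt.
exact: (on_sd_planeE (t := null_comp s y X) (t' := null_comp s y Y) alt FX FY HX HY).
Qed.

Lemma twE_sd_curvature s y X Y : U (base y) ->
  [/\ pairing (twF th s y) X = 0, pairing (twH th s y) X = 0 & pairing (twE Ga s y) X = 0] ->
  [/\ pairing (twF th s y) Y = 0, pairing (twH th s y) Y = 0 & pairing (twE Ga s y) Y = 0] ->
  eval2 (diff1 (twE Ga s) y) X Y
    = plane_area s y X Y * sd_curv_poly (curv_at s y) (twz s y).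
Proof.
move=> Uy [FX HX EX] [FY HY EY].
have W i j := curvature_on_plane i j Uy FX HX FY HY.
apply: (etrans (eval2_diff1_twE oU conn nullG Uy EX EY)).
by apply: (etrans (twistor_form_ext _ W)); exact: twistor_form_sd.
Qed.

Lemma twE_asd_curvature s y X Y : U (base y) ->
  tw_bundle th Ga s y X -> tw_bundle th Ga s y Y ->
  eval2 (diff1 (twE Ga (~~ s)) y) X Y
    = plane_area s y X Y * asd_curv_poly (curv_at s y) (twz s y) (twz (~~ s) y).
Proof.
move=> Uy [FX HX EX EX'] [FY HY EY EY'].
have W i j := curvature_on_plane i j Uy FX HX FY HY.
apply: (etrans (eval2_diff1_twE oU conn nullG Uy EX' EY')).
apply: (etrans (twistor_form_ext _ _)) (twistor_form_asd _ _ _ _) => i j.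
by rewrite !swapN; exact: W.
Qed.

Definition twist_flat s : Prop := forall x, U x ->
  let r := swap_curv s (fun i j => frame_curv th Ga i j x) in
  (forall z, sd_curv_poly r z = 0) /\ (forall z z', asd_curv_poly r z z' = 0).

Lemma flat_bracket s V (X Y : rV8 -> 'rV[C]_(4 + 4)) y : twist_flat s -> open V ->
  V `<=` above U -> smooth_section V (tw_bundle th Ga s) X ->
  smooth_section V (tw_bundle th Ga s) Y -> V y ->
  tw_bundle th Ga s y (bracket X Y y).
Proof.
move=> fl oV VU [sX bX] [sY bY] Vy; have Uy := VU y Vy.
have [p1 p2] := fl _ Uy.
have [FX HX EX _] := bX y Vy; have [FY HY EY _] := bY y Vy.
have c1 := twE_sd_curvature Uy (And3 FX HX EX) (And3 FY HY EY).
have c2 := twE_asd_curvature Uy (bX y Vy) (bY y Vy).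
have [dF dH] := eval2_diff1_twF_twH oU sth conn nullG Uy
   (And3 FX HX EX) (And3 FY HY EY).
have B al : csmooth_mx (above U) al -> (forall y, V y -> pairing (al y) (X y) = 0) ->
   (forall y, V y -> pairing (al y) (Y y) = 0) -> eval2 (diff1 al y) (X y) (Y y) = 0 ->
   pairing (al y) (bracket X Y y) = 0.
  move=> sal aX aY e.
  by rewrite (cartan_bracket oV (csmooth_mx_sub VU sal) sX sY aX aY Vy) e oppr0.
split.
- by apply: (B _ (csmooth_twF oU sth s)) => // z Vz; [case: (bX z Vz)|case: (bY z Vz)].
- by apply: (B _ (csmooth_twH oU sth s)) => // z Vz; [case: (bX z Vz)|case: (bY z Vz)].
- apply: (B _ (csmooth_twE oU conn s)); last by rewrite c1 p1 mulr0.
    by move=> z Vz; case: (bX z Vz).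
  by move=> z Vz; case: (bY z Vz).
- apply: (B _ (csmooth_twE oU conn (~~ s))); last by rewrite c2 p2 mulr0.
    by move=> z Vz; case: (bX z Vz).
  by move=> z Vz; case: (bY z Vz).
Qed.

Definition frame_vec (x : 'rV[R]_4) i : 'rV[C]_4 := (col i (invmx (th x)))^T.

Lemma pairing_frame_vec x i j : U x ->
  pairing (row i (th x)) (frame_vec x j) = (i == j)%:R.
Proof.
move=> Ux; have := congr1 (fun B : 'M[C]_4 => B i j) (mulmxV (uth Ux)).
rewrite !mxE => <-; apply: eq_bigr => k _.
by rewrite !mxE.
Qed.

Definition plane_vec s (b : bool) y : 'rV[C]_4 :=
  twz s y *: frame_vec (base y) (swap s (if b then i3 else i1))
  - frame_vec (base y) (swap s (if b then i2 else i4)).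

Definition fiber_part y (v : 'rV[C]_4) s : C :=
  twistor_form (fun i j => pairing (Ga (swap s i) (swap s j) (base y)) v) (twz s y).

(** The equations E = E' = 0 prescribe dz and dz', which determine the vertical part only up to
    d/dzbar and d/dz'bar. The choice made here consists of complex multiples of d/d(Re z) and d/d(Re
    z'), on which dz and dz' are 1. *)
Definition lift s b y : 'rV[C]_(4 + 4) :=
  row_mx (plane_vec s b y)
    (- fiber_part y (plane_vec s b y) false *: delta_mx 0 i1
     - fiber_part y (plane_vec s b y) true *: delta_mx 0 i3).

Lemma lift_base s b y : lsubmx (lift s b y) = plane_vec s b y.
Proof. exact: row_mxKl. Qed.

Lemma pairing_twdz s s' b y : pairing (twdz R s') (lift s b y) =
  - fiber_part y (plane_vec s b y) s'.
Proof.
rewrite /pairing sum_ord8 [X in X + _]big1 ?add0r => [|a _]; last first.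
  by rewrite /twdz /dz /dz'; case: s'; rewrite row_mxEl mxE mul0r.
rewrite sum4 /lift !row_mxEr /twdz /dz /dz'; case: s'; rewrite !row_mxEr !mxE /=; ring.
Qed.

Lemma null_comp_lift s b y i : U (base y) -> null_comp s y (lift s b y) i =
  twz s y * (i == (if b then i3 else i1))%:R - (i == (if b then i2 else i4))%:R.
Proof.
move=> Uy; have inj := inv_inj (swapK s).
rewrite /null_comp lift_base /plane_vec.
have pD (al u w : 'rV[C]_4) (c : C) : pairing al (c *: u - w) = c * pairing al u - pairing al w.
  rewrite /pairing mulr_sumr -sumrB; apply: eq_bigr => a _.
  by rewrite !mxE; ring.
by rewrite pD !pairing_frame_vec // !(inj_eq inj).
Qed.

Lemma lift_bundle s b y : U (base y) -> tw_bundle th Ga s y (lift s b y).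
Proof.
move=> Uy; split.
- rewrite twF_pairing -!/(null_comp s y (lift s b y) _) !null_comp_lift //.
  by case: b; rewrite /=; ring.
- rewrite twH_pairing -!/(null_comp s y (lift s b y) _) !null_comp_lift //.
  by case: b; rewrite /=; ring.
- by rewrite twE_pairing pairing_twdz lift_base addNr.
- by rewrite twE_pairing pairing_twdz lift_base addNr.
Qed.

Lemma plane_area_lift s y : U (base y) ->
  plane_area s y (lift s false y) (lift s true y) = 1.
Proof. by move=> Uy; rewrite /plane_area !null_comp_lift //=; ring. Qed.

End twistor_curvature.

(** * Integrability and flatness along the null planes *)

Section lifts_flat.
Variables (R : realType).
Local Notation C := R[i].
Local Notation rV8 := 'rV[R]_(4 + 4).
Local Notation g0 := (@null_gram R).
Local Notation above U := [set y : rV8 | U (base y)].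
Implicit Types (s : bool) (y : rV8).
Variables (th : 'rV[R]_4 -> 'M[C]_4) (Ga : 'I_4 -> 'I_4 -> 'rV[R]_4 -> 'rV[C]_4).
Variables (U : set 'rV[R]_4) (G : 'rV[R]_4 -> 'M[C]_4) (A : 'rV[R]_4 -> 'rV[C]_4).
Hypothesis oU : open U.
Hypotheses (sth : csmooth_mx U th) (uth : forall x, U x -> th x \in unitmx).
Hypothesis conn : weyl_connection U th G A Ga.
Hypothesis nullG : forall x, U x -> gframe th G x = g0.

Let oV : open (above U). Proof. exact: open_above. Qed.

Let sz s : csmooth (above U) (twz s). Proof. exact: csmooth_twz. Qed.

Lemma csmooth_row_mx V p q (F : rV8 -> 'rV[C]_p) (H : rV8 -> 'rV[C]_q) : open V ->
  csmooth_mx V F -> csmooth_mx V H -> csmooth_mx V (fun y => row_mx (F y) (H y)).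
Proof.
move=> oV' sF sH i j; case: (split_ordP j) => k ->.
  by apply: csmooth_ext (sF i k) => // y _; rewrite row_mxEl.
by apply: csmooth_ext (sH i k) => // y _; rewrite row_mxEr.
Qed.

Lemma csmooth_plane_vec s b : csmooth_mx (above U) (plane_vec th s b).
Proof.
have sV : csmooth_mx U (fun x => invmx (th x)) by exact: csmooth_inv.
have sf i : csmooth_mx (above U) (fun y => frame_vec th (base y) i).
  apply: (@csmooth_mx_base _ U _ _ (fun x => frame_vec th x i)) => // k j.
  by apply: csmooth_ext (sV j i) => // x _; rewrite !mxE.
exact: (csmooth_mxB oV (csmooth_mxZ oV (sz s) (sf _)) (sf _)).
Qed.

Lemma csmooth_fiber_part s b s' :
  csmooth (above U) (fun y => fiber_part Ga y (plane_vec th s b y) s').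
Proof.
have sp i j : csmooth (above U)
    (fun y => pairing (Ga (swap s' i) (swap s' j) (base y)) (plane_vec th s b y)).
  have [sGa _ _] := conn.
  apply: (csmooth_sum oV) => a; apply: (csmoothM oV); last exact: csmooth_plane_vec.
  exact: (csmooth_base oU (sGa _ _ 0 a)).
have sz2 : csmooth (above U) (fun y => twz s' y ^+ 2) by exact: csmoothM.
apply: (csmoothD oV); last exact: (csmoothM oV sz2 (sp _ _)).
apply: (csmoothD oV); first exact: (csmoothN oV (sp _ _)).
exact: (csmoothM oV (sz s') (csmoothB oV (sp _ _) (sp _ _))).
Qed.

Lemma csmooth_lift s b : csmooth_mx (above U) (lift th Ga s b).
Proof.
apply: csmooth_row_mx => //; first exact: csmooth_plane_vec.
have sd s' (i : 'I_4) : csmooth_mx (above U)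
    (fun y => fiber_part Ga y (plane_vec th s b y) s' *: (delta_mx 0 i : 'rV[C]_4)).
  apply: (csmooth_mxZ oV (csmooth_fiber_part s b s')); exact: csmooth_mx_cst.
apply: csmooth_mx_ext (csmooth_mxB oV (csmooth_mxN oV (sd false i1)) (sd true i3)) => //.
by move=> y _; rewrite scaleNr.
Qed.

Lemma fiber_point (x : 'rV[R]_4) s (z z' : C) :
  exists y : rV8, [/\ base y = x, twz s y = z & twz (~~ s) y = z'].
Proof.
pose fib (w w' : C) : 'rV[R]_4 := \row_a
  nth 0 [:: complex.Re w; complex.Im w; complex.Re w'; complex.Im w'] a.
exists (row_mx x (if s then fib z' z else fib z z')).
split; first by rewrite /base row_mxKl.
  by case: s; rewrite /twz /zcoord /zcoord' row_mxKr !mxE /=; case: z.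
by case: s; rewrite /twz /zcoord /zcoord' row_mxKr !mxE /=; case: z'.
Qed.

Lemma bracket_flat_at s y : U (base y) ->
  tw_bundle th Ga s y (bracket (lift th Ga s false) (lift th Ga s true) y) ->
  sd_curv_poly (curv_at th Ga s y) (twz s y) = 0 /\
  asd_curv_poly (curv_at th Ga s y) (twz s y) (twz (~~ s) y) = 0.
Proof.
move=> Uy [_ _ B1 B2].
have bl b y' Uy' := lift_bundle Ga uth s b (Uy' : U (base y')).
have [F0 H0 E0 _] := bl false y Uy; have [F1 H1 E1 _] := bl true y Uy.
have c1 := twE_sd_curvature oU uth conn nullG Uy (And3 F0 H0 E0) (And3 F1 H1 E1).
have c2 := twE_asd_curvature oU uth conn nullG Uy (bl false y Uy) (bl true y Uy).
(* The projections of the two lifts are the basis of the plane, so dE and dE' take exactly the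
   values of the polynomials on them. *)
have ar := plane_area_lift Ga uth s Uy.
rewrite ar mul1r in c1; rewrite ar mul1r in c2.
have e s' : (forall b y', U (base y') -> pairing (twE Ga s' y') (lift th Ga s b y') = 0) ->
    pairing (twE Ga s' y) (bracket (lift th Ga s false) (lift th Ga s true) y) = 0 ->
    eval2 (diff1 (twE Ga s') y) (lift th Ga s false y) (lift th Ga s true y) = 0.
  move=> h; rewrite (cartan_bracket oV (csmooth_twE oU conn s')
    (csmooth_lift s false) (csmooth_lift s true) (h false) (h true) Uy).
  by move/eqP; rewrite oppr_eq0 => /eqP.
have d1 := e s (fun b y' Uy' => let: And4 _ _ h _ := bl b y' Uy' in h) B1.
have d2 := e (~~ s) (fun b y' Uy' => let: And4 _ _ _ h := bl b y' Uy' in h) B2.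
exact: conj (etrans (esym c1) d1) (etrans (esym c2) d2).
Qed.

Lemma bracket_flat s :
  (forall y, U (base y) -> tw_bundle th Ga s y
      (bracket (lift th Ga s false) (lift th Ga s true) y)) ->
  twist_flat th Ga U s.
Proof.
move=> H x Ux; have P z z' :
    sd_curv_poly (swap_curv s (fun i j => frame_curv th Ga i j x)) z = 0 /\
    asd_curv_poly (swap_curv s (fun i j => frame_curv th Ga i j x)) z z' = 0.
  have [y [bx <- <-]] := fiber_point x s z z'; move: Ux; case: _ / bx => Uy.
  exact: bracket_flat_at Uy (H y Uy).
by split=> [z|z z']; [case: (P z 0)|case: (P z z')].
Qed.

End lifts_flat.

(** * Change of the 1-form of a Weyl geometry *)

Section connection_shift.
Variables (R : realType).
Local Notation C := R[i].
Local Notation rV8 := 'rV[R]_(4 + 4).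
Local Notation g0 := (@null_gram R).
Local Notation above U := [set y : rV8 | U (base y)].
Implicit Types (s : bool) (y : rV8).

(* The difference of the Weyl connections of two 1-forms differing by
   [b_k th^k], evaluated on a vector with components [t]. *)
Definition shift_coef (b t : 'I_4 -> C) (i j : 'I_4) : C :=
  2^-1 * ((i == j)%:R * \sum_k b k * t k + b j * t i
          - (\sum_k 4 * g0 i k * b k) * \sum_l g0 j l * t l).

Lemma shift_coef_gram (b t : 'I_4 -> C) i j :
  \sum_k (g0 i k * shift_coef b t k j + g0 j k * shift_coef b t k i)
  = g0 i j * \sum_k b k * t k.
Proof.
rewrite /shift_coef !sum4 !mxE.
by elim/ord4P: i; elim/ord4P: j; rewrite /=; field.
Qed.

(** Up to the factor 1/2, the shift along [t] applied to [u] is b(t) u + b(u) t - g(t, u) b^#, with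
    b^# the vector dual to b for g; it is symmetric in [t] and [u], so the torsion is unchanged. *)
Lemma shift_coef_torsion (b t u : 'I_4 -> C) i :
  \sum_j (shift_coef b t i j * u j - shift_coef b u i j * t j) = 0.
Proof.
rewrite /shift_coef !sum4 !mxE.
by elim/ord4P: i; rewrite /=; field.
Qed.

Lemma shift_coef_swap s b t i j : shift_coef b t (swap s i) (swap s j)
  = shift_coef (fun k => b (swap s k)) (fun k => t (swap s k)) i j.
Proof.
rewrite /shift_coef (inj_eq (inv_inj (swapK s))) (sum_swap s (fun k => b k * t k)).
rewrite -(sum_swap s (fun k => 4 * g0 (swap s i) k * b k)).
rewrite -(sum_swap s (fun l => g0 (swap s j) l * t l)).
congr (_ * (_ + _ - _ * _)); apply: eq_bigr => k _; by rewrite swap_gram.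
Qed.

Lemma shift_coef_twistor b t z : twistor_form (shift_coef b t) z
  = 2^-1 * (z * b i1 - b i4) * (t i1 + z * t i4)
    + 2^-1 * (z * b i3 - b i2) * (t i3 + z * t i2).
Proof. by rewrite /twistor_form /shift_coef !sum4 !mxE /=; field. Qed.

End connection_shift.

Lemma twistor_formD (R : realType) (c d : 'I_4 -> 'I_4 -> R[i]) z :
  twistor_form (fun i j => c i j + d i j) z = twistor_form c z + twistor_form d z.
Proof. by rewrite /twistor_form; ring. Qed.

Section combinations.
Variables (R : realType) (n : nat).
Implicit Types (B : 'M[R[i]]_n) (al X Y : 'rV[R[i]]_n).

Lemma pairing_combination al1 al2 al3 a b X :
  pairing (al1 + (a *: al2 + b *: al3)) X
  = pairing al1 X + (a * pairing al2 X + b * pairing al3 X).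
Proof. by rewrite !pairingD !pairingZ. Qed.

Lemma eval2_combination B1 B2 B3 al1 al2 al3 al4 a b X Y :
  pairing al2 X = 0 -> pairing al2 Y = 0 -> pairing al4 X = 0 -> pairing al4 Y = 0 ->
  eval2 B2 X Y = 0 -> eval2 B3 X Y = 0 ->
  eval2 (B1 + (wedge al1 al2 + a *: B2 + (wedge al3 al4 + b *: B3))) X Y
  = eval2 B1 X Y.
Proof.
move=> h2X h2Y h4X h4Y e2 e3; rewrite 4!eval2D 2!eval2Z 2!eval2_wedge.
by rewrite h2X h2Y h4X h4Y e2 e3 !mulr0 subrr !addr0.
Qed.

End combinations.

Section shifted_connection.
Variables (R : realType).
Local Notation C := R[i].
Local Notation rV8 := 'rV[R]_(4 + 4).
Local Notation g0 := (@null_gram R).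
Local Notation above U := [set y : rV8 | U (base y)].
Implicit Types (s : bool).
Variables (th : 'rV[R]_4 -> 'M[C]_4) (Ga : 'I_4 -> 'I_4 -> 'rV[R]_4 -> 'rV[C]_4).
Variables (U : set 'rV[R]_4) (G : 'rV[R]_4 -> 'M[C]_4) (A B : 'rV[R]_4 -> 'rV[C]_4).

Definition shift_comp x k : C := (B x *m invmx (th x)) 0 k.

Definition shift_form i j x : 'rV[C]_4 :=
  \row_a shift_coef (shift_comp x) (fun k => th x k a) i j.

Definition shift_connection i j x : 'rV[C]_4 := Ga i j x + shift_form i j x.

Lemma pairing_shift_form i j x v : pairing (shift_form i j x) v
  = shift_coef (shift_comp x) (fun k => pairing (row k (th x)) v) i j.
Proof.
rewrite /pairing /shift_form; move: (shift_comp x) => b.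
rewrite /shift_coef; move: g0 (2^-1 : C) => g h; rewrite !sum4 !mxE !sum4; ring.
Qed.

Definition shift_twist s (k l : 'I_4) (y : rV8) : C := 2^-1 *
  (twz s y * shift_comp (base y) (swap s k) - shift_comp (base y) (swap s l)).

Lemma twE_shift s y : twE shift_connection s y = twE Ga s y
  + (shift_twist s i1 i4 y *: twF th s y + shift_twist s i3 i2 y *: twH th s y).
Proof.
have P X : pairing (twE shift_connection s y) X = pairing (twE Ga s y
    + (shift_twist s i1 i4 y *: twF th s y + shift_twist s i3 i2 y *: twH th s y)) X.
  pose t k := pairing (row (swap s k) (th (base y))) (lsubmx X).
  pose b k := shift_comp (base y) (swap s k).
  have E i j : pairing (shift_connection (swap s i) (swap s j) (base y)) (lsubmx X)
    = pairing (Ga (swap s i) (swap s j) (base y)) (lsubmx X) + shift_coef b t i j.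
    by rewrite pairingD pairing_shift_form shift_coef_swap.
  apply: (etrans (twE_pairing _ _ _ _)); apply: (etrans _ (esym (pairing_combination _ _ _ _ _ _))).
  rewrite [in X in _ = _ + X](twF_pairing th s y X) [in X in _ = _ + X](twH_pairing th s y X).
  rewrite (twistor_form_ext _ E) twistor_formD (shift_coef_twistor b t) addrA.
  by congr (_ + _); exact: (esym (twE_pairing _ _ _ _)).
apply/rowP => a; have := P (delta_mx 0 a).
have pd (al : 'rV[C]_(4 + 4)) : pairing al (delta_mx 0 a) = al 0 a.
  rewrite /pairing (bigD1 a) //= big1 ?addr0 => [|b /negPf ba].
    by rewrite mxE !eqxx mulr1.
  by rewrite mxE ba andbF mulr0.
by rewrite !pd.
Qed.

Hypothesis oU : open U.
Hypotheses (sth : csmooth_mx U th) (uth : forall x, U x -> th x \in unitmx).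
Hypothesis sB : csmooth_mx U B.
Hypothesis conn : weyl_connection U th G A Ga.
Hypothesis nullG : forall x, U x -> gframe th G x = g0.

Lemma csmooth_shift_comp k : csmooth U (fun x => shift_comp x k).
Proof. exact: (csmooth_mxM oU sB (csmooth_inv oU sth uth) 0 k). Qed.

Lemma csmooth_shift_form i j : csmooth_mx U (shift_form i j).
Proof.
move=> z a; pose f x := shift_coef (shift_comp x) (fun k => th x k a) i j.
apply: (csmooth_ext oU (f := f)); first by move=> x _; rewrite mxE.
have sb := csmooth_shift_comp; have sc (c : C) := csmooth_cst oU c.
apply: (csmoothM oU (sc _)); apply: (csmoothB oU); first apply: (csmoothD oU).
- apply: (csmoothM oU (sc _)); apply: (csmooth_sum oU) => k.
  exact: (csmoothM oU (sb k) (sth k a)).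
- exact: (csmoothM oU (sb j) (sth i a)).
- apply: (csmoothM oU); apply: (csmooth_sum oU) => k.
    exact: (csmoothM oU (sc _) (sb k)).
  exact: (csmoothM oU (sc _) (sth k a)).
Qed.

Lemma shift_weyl_connection :
  weyl_connection U th G (fun x => A x + B x) shift_connection.
Proof.
have [s m t] := conn; split.
- by move=> i j; exact: (csmooth_mxD oU (s i j) (csmooth_shift_form i j)).
- move=> x i j Ux; have gE := nullG Ux.
  have -> : \sum_k (gframe th G x i k *: shift_connection k j x
        + gframe th G x j k *: shift_connection k i x)
    = \sum_k (gframe th G x i k *: Ga k j x + gframe th G x j k *: Ga k i x)
      + gframe th G x i j *: B x.
    have -> : gframe th G x i j *: B x
        = \sum_k (gframe th G x i k *: shift_form k j x + gframe th G x j k *: shift_form k i x).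
      rewrite gE; apply/rowP => a; rewrite summxE.
      have := shift_coef_gram (shift_comp x) (fun k => th x k a) i j.
      have -> : \sum_k shift_comp x k * th x k a = B x 0 a.
        by rewrite -[in RHS](mulmxKV (uth Ux) (B x)) mxE.
      rewrite mx_scaleE => <-; apply: eq_bigr => k _.
      by rewrite mx_addE !mx_scaleE [shift_form k j x 0 a]mxE [shift_form k i x 0 a]mxE.
    by rewrite -big_split; apply: eq_bigr => k _; rewrite /= !scalerDr addrACA.
  by rewrite opprD addrA m // scalerDr opprD.
- move=> x i Ux; rewrite t //; congr (- _); apply/matrixP => a b; rewrite !summxE.
  have Z := shift_coef_torsion (shift_comp x) (fun k => th x k a) (fun k => th x k b) i.
  pose S j (c : 'I_4) := shift_coef (shift_comp x) (fun k => th x k c) i j.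
  have E j : wedge (shift_connection i j x) (row j (th x)) a b
      = wedge (Ga i j x) (row j (th x)) a b + (S j a * th x j b - S j b * th x j a).
    by rewrite !wedgeE !mx_addE [shift_form i j x 0 a]mxE [shift_form i j x 0 b]mxE
     [row j (th x) 0 a]mxE [row j (th x) 0 b]mxE -/(S j a) -/(S j b); ring.
  by rewrite (eq_bigr _ (fun j _ => E j)) big_split /= Z addr0.
Qed.

Let oV : open (above U). Proof. exact: open_above. Qed.

Lemma csmooth_shift_twist s k l : csmooth (above U) (shift_twist s k l).
Proof.
have sb j := csmooth_base oU (csmooth_shift_comp j).
have sz := csmooth_twz s oV; have sc (c : C) := csmooth_cst oV c.
exact: (csmoothM oV (sc _) (csmoothB oV (csmoothM oV sz (sb _)) (sb _))).
Qed.

(** Besides [f d be] and [h d ga], the Leibniz rule only produces wedge products with [be] or [ga]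
    as a factor, and all of these vanish on [X], [Y]. *)
Lemma eval2_diff1_combination (al be ga : rV8 -> 'rV[C]_(4 + 4)) (f h : rV8 -> C) y X Y :
  csmooth_mx (above U) al -> csmooth_mx (above U) be -> csmooth_mx (above U) ga ->
  csmooth (above U) f -> csmooth (above U) h -> above U y ->
  pairing (be y) X = 0 -> pairing (be y) Y = 0 ->
  pairing (ga y) X = 0 -> pairing (ga y) Y = 0 ->
  eval2 (diff1 be y) X Y = 0 -> eval2 (diff1 ga y) X Y = 0 ->
  eval2 (diff1 (fun y => al y + (f y *: be y + h y *: ga y)) y) X Y
  = eval2 (diff1 al y) X Y.
Proof.
move=> sal sbe sga sf sh Uy bX bY gX gY dbe dga.
have s1 := csmooth_mxZ oV sf sbe; have s2 := csmooth_mxZ oV sh sga.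
rewrite (diff1D sal (csmooth_mxD oV s1 s2) Uy) (diff1D s1 s2 Uy).
rewrite (diff1Z oV sf sbe Uy) (diff1Z oV sh sga Uy).
exact: eval2_combination.
Qed.

Lemma shift_sd_curv_at s y : U (base y) ->
  sd_curv_poly (curv_at th shift_connection s y) (twz s y)
  = sd_curv_poly (curv_at th Ga s y) (twz s y).
Proof.
move=> Uy.
have [F0 H0 E0 _] := lift_bundle Ga uth s false Uy.
have [F1 H1 E1 _] := lift_bundle Ga uth s true Uy.
have E' X : pairing (twF th s y) X = 0 -> pairing (twH th s y) X = 0 ->
    pairing (twE Ga s y) X = 0 -> pairing (twE shift_connection s y) X = 0.
  by move=> F H E; rewrite twE_shift pairing_combination F H E !mulr0 !addr0.
have c := twE_sd_curvature oU uth conn nullG Uy (And3 F0 H0 E0) (And3 F1 H1 E1).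
have c' := twE_sd_curvature oU uth shift_weyl_connection nullG Uy
  (And3 F0 H0 (E' _ F0 H0 E0)) (And3 F1 H1 (E' _ F1 H1 E1)).
have [dF dH] := eval2_diff1_twF_twH oU sth conn nullG Uy
  (And3 F0 H0 E0) (And3 F1 H1 E1).
have ar := plane_area_lift Ga uth s Uy.
rewrite ar mul1r in c; rewrite ar mul1r in c'.
have D := eval2_diff1_combination (csmooth_twE oU conn s) (csmooth_twF oU sth s)
  (csmooth_twH oU sth s) (csmooth_shift_twist s i1 i4) (csmooth_shift_twist s i3 i2)
  Uy F0 F1 H0 H1 dF dH.
have e : twE shift_connection s = fun y => twE Ga s y
    + (shift_twist s i1 i4 y *: twF th s y + shift_twist s i3 i2 y *: twH th s y).
  by apply: funext => y'; exact: twE_shift.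
rewrite e in c'; exact: (etrans (esym c') (etrans D c)).
Qed.

Lemma shift_sd_curv s x z : U x ->
  sd_curv_poly (swap_curv s (fun i j => frame_curv th shift_connection i j x)) z
  = sd_curv_poly (swap_curv s (fun i j => frame_curv th Ga i j x)) z.
Proof.
have [y [bx <- _]] := fiber_point x s z 0; case: _ / bx => Uy.
exact: shift_sd_curv_at.
Qed.

End shifted_connection.

Lemma weyl_connection_sub (R : realType) (U V : set 'rV[R]_4) th G A Ga : V `<=` U ->
  weyl_connection U th G A Ga -> weyl_connection V th G A Ga.
Proof.
move=> VU [s m t]; split.
- by move=> i j; exact: (csmooth_mx_sub VU (s i j)).
- by move=> x i j /VU; exact: m.
- by move=> x i /VU; exact: t.
Qed.

(** * Integrability, duality and the Einstein-Weyl equations *)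

Section twistor_integrability.
Variables (R : realType) (M : oriented_manifold R 4) (W : weyl_geometry M).
Variable vol : volume_form W.
Local Notation C := R[i].
Local Notation g0 := (@null_gram R).
Implicit Types (s : bool) (c : chart M).

Definition tw_dual s : Prop := if s then self_dual vol else anti_self_dual vol.

Definition tw_null_bundle s := if s then @bundleNF' R else @bundleNF R.

Lemma tw_null_bundleE s th Ga y X :
  tw_null_bundle s th Ga y X <-> tw_bundle th Ga s y X.
Proof. by case: s; [exact: bundleNF'_tw|exact: bundleNF_tw]. Qed.

Section null_cotetrad.
Variables (c : chart M) (U : set 'rV[R]_4) (th : 'rV[R]_4 -> 'M[C]_4).
Hypothesis nth : null_cotetrad vol c U th.

Lemma null_cotetrad_gframe x : U x -> gframe th (metric W c) x = g0.
Proof.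
case: nth => [[_ _ _ uth] gE] Ux; have [e _] := gE x Ux.
rewrite /gframe e null_gramE /frame_components !mulmxA -trmx_mul.
by rewrite mulmxV ?uth // trmx1 mul1mx -mulmxA mulmxV ?uth // mulmx1.
Qed.

(** Integrability is stated at the points of the twistor space, so every coordinate value has to be
    realized by a pair of planes before the condition can be used there. *)
Lemma twistor_point (y : 'rV[R]_(4 + 4)) : U (base y) ->
  exists q : twistor_space vol, twistor_coordinates c th q y.
Proof.
case: nth => [[_ Uc _ _] gE] Uy.
have cy : null_cotetrad_at vol c (Defs.coord c (param c (base y))) (th (base y)).
  by rewrite paramK; [exact: gE|exact: Uc].
have dy := param_dom (Uc _ Uy).
pose q := @TwistorSpace R M W vol (param c (base y))
  (sd_plane (param c (base y)) c (th (base y)) (Some (zcoord y)))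
  (asd_plane (param c (base y)) c (th (base y)) (Some (zcoord' y)))
  (ex_intro _ c (ex_intro _ _ (ex_intro _ _ (And3 dy cy erefl))))
  (ex_intro _ c (ex_intro _ _ (ex_intro _ _ (And3 dy cy erefl)))).
by exists q.
Qed.

Variables (A : 'rV[R]_4 -> 'rV[C]_4) (Ga : 'I_4 -> 'I_4 -> 'rV[R]_4 -> 'rV[C]_4).
Hypotheses (sA : csmooth_mx U A) (conn : weyl_connection U th (metric W c) A Ga).

Let oU : open U. Proof. by case: nth => [[]]. Qed.
Let sth : csmooth_mx U th. Proof. by case: nth => [[]]. Qed.
Let uth x : U x -> th x \in unitmx. Proof. by case: nth => [[_ _ _ uth] _]; exact: uth. Qed.

Lemma twist_flatP s : twist_flat th Ga U s <->
  (forall x, U x -> forall z,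
     sd_curv_poly (swap_curv s (fun i j => frame_curv th Ga i j x)) z = 0) /\
  (forall x i j, U x -> tracefree_ricci th (metric W c) Ga x i j = 0).
Proof.
have rP x Ux := swap_tracefree_ricP s
  (null_frame_curvature oU sth uth sA conn null_cotetrad_gframe (Ux : U x)).
split=> [fl|[h1 h2] x Ux].
  split=> [x Ux|x i j Ux]; first by case: (fl x Ux).
  rewrite (null_tracefree_ricci Ga null_cotetrad_gframe i j Ux).
  by move: i j; apply/(rP x Ux); case: (fl x Ux).
split; first exact: h1.
apply/(rP x Ux) => i j.
by rewrite -(null_tracefree_ricci Ga null_cotetrad_gframe i j Ux); exact: h2.
Qed.

(** From left to right, the condition is applied to the two lifts over the whole coordinate domain;
    conversely, Cartan's formula treats arbitrary sections. *)
Lemma integrable_flatP s :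
  (forall V : set 'rV[R]_(4 + 4), open V -> V `<=` [set y | U (base y)] ->
    forall X Y, smooth_section V (tw_null_bundle s th Ga) X ->
      smooth_section V (tw_null_bundle s th Ga) Y ->
    forall (q : twistor_space vol) y, V y -> twistor_coordinates c th q y ->
      tw_null_bundle s th Ga y (bracket X Y y)) <->
  twist_flat th Ga U s.
Proof.
split=> [H|fl V oV VU X Y [sX bX] [sY bY] q y Vy _].
  apply: (bracket_flat oU sth uth conn null_cotetrad_gframe) => y Uy.
  have [q qy] := twistor_point Uy.
  have sec b : smooth_section [set y | U (base y)] (tw_null_bundle s th Ga) (lift th Ga s b).
    split; first exact: (csmooth_lift oU sth uth conn).
    by move=> y' Uy'; apply/tw_null_bundleE; exact: (lift_bundle Ga uth s b Uy').
  apply/tw_null_bundleE.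
  exact: (H _ (open_above oU) (fun=> id) _ _ (sec false) (sec true) q y Uy qy).
apply/tw_null_bundleE.
apply: (flat_bracket oU sth uth conn null_cotetrad_gframe fl oV VU _ _ Vy).
  by split=> // y' Vy'; apply/tw_null_bundleE; exact: bX.
by split=> // y' Vy'; apply/tw_null_bundleE; exact: bY.
Qed.

End null_cotetrad.

Lemma weyl_dualP s c U th Ga : null_cotetrad vol c U th ->
  levi_civita U th (metric W c) Ga ->
  (forall x i j, U x -> (if s then @self_dual_2form R else @anti_self_dual_2form R) (th x)
     (weyl_2form th (metric W c) Ga x i j)) <->
  (forall x, U x -> forall z,
     sd_curv_poly (swap_curv s (fun i j => frame_curv th Ga i j x)) z = 0).
Proof.
move=> nth lc; have [[oU Uc sth uth] _] := nth.
have s0 : csmooth_mx U (fun=> 0 : 'rV[C]_4) by exact: csmooth_mx_cst.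
have rP x Ux := null_frame_curvature oU sth uth s0 lc (null_cotetrad_gframe nth) (Ux : U x).
have f0 x k l : \sum_a \sum_b invmx (th x) a k * invmx (th x) b l *
    (mxpartial a (fun=> 0 : 'rV[C]_4) x 0 b - mxpartial b (fun=> 0 : 'rV[C]_4) x 0 a) = 0.
  by rewrite big1 // => a _; rewrite big1 // => b _; rewrite !mxpartial_cst !mxE subrr mulr0.
have E x i j : U x -> (if s then @self_dual_2form R else @anti_self_dual_2form R) (th x)
     (weyl_2form th (metric W c) Ga x i j) <->
    dual_2form s (null_weyl (fun i j => frame_curv th Ga i j x) i j).
  move=> Ux.
  have -> : weyl_2form th (metric W c) Ga x i j
      = frame_2form (th x) (null_weyl (fun i j => frame_curv th Ga i j x) i j).
    rewrite /weyl_2form /frame_2form; congr (_ *: _).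
    apply: eq_bigr => k _; apply: eq_bigr => l _; congr (_ *: _).
    exact: (null_weyl_tensor Ga (null_cotetrad_gframe nth) i j k l Ux).
  have alt k l := null_weyl_alt i j k l (rP x Ux).
  case: (s).
    exact: (self_dual_2formP (uth _ Ux) alt).
  exact: (anti_self_dual_2formP (uth _ Ux) alt).
split=> [H x Ux|H x i j Ux].
  by apply/(swap_weylP s (rP x Ux) (f0 x)) => i j; apply/(E x i j Ux); exact: H.
by apply/(E x i j Ux); move: i j; apply/(swap_weylP s (rP x Ux) (f0 x)); exact: H.
Qed.

Lemma integrable_einstein_weyl s :
  twistor_integrable vol (tw_null_bundle s) -> einstein_weyl W.
Proof.
move=> int c U th Ga [oU Uc sth uth] conn y i j Uy.
have [V [th1 [VU Vy nth1]]] := null_cotetrad_exists vol oU Uc Uy.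
have [[oV _ sth1 uth1] gE1] := nth1.
(* The transition matrix from the given coframe to the null cotetrad, and its inverse. The given
   connection is transported along it, integrability is used there, and the vanishing of the tensor
   is carried back. *)
pose L x := th1 x *m invmx (th x); pose K x := th x *m invmx (th1 x).
have uthV x (Vx : V x) := uth x (VU x Vx); have sthV := csmooth_mx_sub VU sth.
have VC : V `<=` img c by move=> x /VU/Uc.
have sG := csmooth_mx_sub VC (metric_smooth W c).
have symG x (Vx : V x) := Defs.metric_sym W (VC x Vx).
have uG x (Vx : V x) := metric_nondegenerate W (VC x Vx).
have sA := csmooth_mx_sub VC (weyl_form_smooth W c).
have sL : csmooth_mx V L by exact: (csmooth_mxM oV sth1 (csmooth_inv oV sthV uthV)).
have sK : csmooth_mx V K by exact: (csmooth_mxM oV sthV (csmooth_inv oV sth1 uth1)).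
have LK x : V x -> L x *m K x = 1%:M.
  move=> Vx; rewrite /L /K mulmxA -(mulmxA (th1 x)) mulVmx ?mulmx1; last exact: uthV.
  by rewrite mulmxV //; exact: uth1.
have Lth x : V x -> th1 x = L x *m th x.
  by move=> Vx; rewrite /L mulmxKV //; exact: uthV.
have connV := weyl_connection_sub VU conn.
have conn' := gauge_weyl_connection oV sthV sG symG uthV sL sK LK connV.
have nth' : null_cotetrad vol c V (fun x => L x *m th x).
  split; last by move=> x Vx; rewrite -(Lth x Vx); exact: gE1.
  split=> //; first exact: (csmooth_mx_ext oV Lth sth1).
  by move=> x Vx; rewrite -(Lth x Vx); exact: uth1.
have fl := (integrable_flatP nth' conn' s).1 (int c V _ _ nth' conn').
have [_ S0] := (twist_flatP nth' sA conn' s).1 fl.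
move: i j; apply: (gauge_tracefree_ricci oV symG uG uthV sL sK LK connV Vy) => k l.
exact: S0.
Qed.

(** Duality starts from a Levi-Civita connection. Shifting it by the 1-form of [W] gives the Weyl
    connection to which integrability applies, and the quartic is the same for both. *)
Lemma integrable_dual s : twistor_integrable vol (tw_null_bundle s) -> tw_dual s.
Proof.
move=> int.
have H c U th Ga : null_cotetrad vol c U th -> levi_civita U th (metric W c) Ga ->
    forall x i j, U x -> (if s then @self_dual_2form R else @anti_self_dual_2form R) (th x)
      (weyl_2form th (metric W c) Ga x i j).
  move=> nth lc; apply/(weyl_dualP s nth lc) => x Ux z.
  have [[oU Uc sth uth] _] := nth.
  have sA := csmooth_mx_sub Uc (weyl_form_smooth W c).
  rewrite -(shift_sd_curv oU sth uth sA lc (null_cotetrad_gframe nth) s z Ux).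
  have conn := shift_weyl_connection oU sth uth sA lc (null_cotetrad_gframe nth).
  have e : (fun x => 0 + weyl_form W c x) = weyl_form W c.
    by apply: funext => x'; rewrite add0r.
  rewrite e in conn.
  have fl := (integrable_flatP nth conn s).1 (int c U th _ nth conn).
  by have [h _] := (twist_flatP nth sA conn s).1 fl; exact: h.
by move: H; case: (s) => H c U th Ga nth lc x i j Ux; exact: (H c U th Ga nth lc).
Qed.

(** Conversely, the shift by minus the 1-form turns the given Weyl connection into a Levi-Civita
    one, to which duality applies. *)
Lemma dual_integrable s : tw_dual s -> einstein_weyl W ->
  twistor_integrable vol (tw_null_bundle s).
Proof.
move=> dual ew c U th Ga nth conn.
have [[oU Uc sth uth] _] := nth.
have sA := csmooth_mx_sub Uc (weyl_form_smooth W c).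
apply/(integrable_flatP nth conn s); apply/(twist_flatP nth sA conn s); split; last first.
  by move=> x i j Ux; exact: (ew c U th Ga nth.1 conn x i j Ux).
move=> x Ux z; have sN := csmooth_mxN oU sA.
rewrite -(shift_sd_curv oU sth uth sN conn (null_cotetrad_gframe nth) s z Ux).
have lc := shift_weyl_connection oU sth uth sN conn (null_cotetrad_gframe nth).
have e : (fun x => weyl_form W c x - weyl_form W c x) = fun=> 0.
  by apply: funext => x'; rewrite subrr.
rewrite e in lc.
apply: ((weyl_dualP s nth lc).1 _ x Ux z) => x' i j Ux'.
by move: dual; case: (s) => dual; exact: (dual c U th _ nth lc).
Qed.

Lemma integrableP s :
  twistor_integrable vol (tw_null_bundle s) <-> tw_dual s /\ einstein_weyl W.
Proof.
split=> [int|[dual ew]]; last exact: dual_integrable.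
by split; [exact: integrable_dual|exact: (@integrable_einstein_weyl s)].
Qed.

End twistor_integrability.

Theorem theorem6p3 (R : realType) (M : oriented_manifold R 4)
    (W : weyl_geometry M) (vol : volume_form W) :
  (twistor_integrable vol (@bundleNF R) <->
     anti_self_dual vol /\ einstein_weyl W) /\
  (twistor_integrable vol (@bundleNF' R) <->
     self_dual vol /\ einstein_weyl W).
Proof. exact: conj (integrableP vol false) (integrableP vol true). Qed.
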